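(* Let $A$ be a self-adjoint operator on an infinite-dimensional Hilbert space $\mathcal{H}$, let $B,C$ be bounded symmetric operators on $\mathcal{H}$, and let $\gamma\in\rho(A+C)\cap\mathbb{R}$. Assume $\langle x,Bx\rangle\ge\langle x,Cx\rangle$ for all $x\in\operatorname{Ran}P_{A+B}(\gamma)$ and (i) $\lVert B-C\rVert<\tfrac12\operatorname{dist}(\gamma,\sigma(A+C))$, or (ii) $0\le B-C$ and $\lVert B-C\rVert<\operatorname{dist}(\gamma,\sigma(A+C))$. Then for all $k\in\mathbb{N}\cup\{\infty\}$ we have $$\lambda^{\leftarrow}_{k,\gamma}(A+B)\ \ge\ \lambda^{\leftarrow}_{k,\gamma}(A+C).$$
   Context: $P_A(E)=\mathbf{1}_{(-\infty,E]}(A)$ is the spectral projection of a self-adjoint operator $A$. $A$ need not be semi-bounded. For $\gamma\in\rho(A)\cap\mathbb{R}$ set $\lambda^{\leftarrow}_{\infty,\gamma}(A)=\sup\{\lambda<\gamma:\lambda\in\sigma_{\mathrm{ess}}(A)\}$ ($=-\infty$ if there is no essential spectrum below $\gamma$). $(\lambda^{\leftarrow}_{k,\gamma}(A))_{k\in\mathbb{N}}$ denotes the eigenvalues of $A$ in $(\lambda^{\leftarrow}_{\infty,\gamma}(A),\gamma)$, enumerated non-increasingly and counting multiplicities; if there are exactly $N\in\mathbb{N}_0$ of them, one sets $\lambda^{\leftarrow}_{k,\gamma}(A)=\lambda^{\leftarrow}_{\infty,\gamma}(A)$ for all $k>N$. *)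

(* Defs.v *)
From HB Require Import structures.
From mathcomp Require Import all_boot all_order all_algebra.
From mathcomp Require Import sesquilinear complex.
From mathcomp Require Import all_classical all_reals all_analysis.
Set Implicit Arguments.
Unset Strict Implicit.
Unset Printing Implicit Defensive.
Import Order.TTheory GRing.Theory Num.Theory.
Import numFieldNormedType.Exports.
Local Open Scope classical_set_scope.
Local Open Scope card_scope.
Local Open Scope complex_scope.
Local Open Scope ring_scope.

(* A complex Hilbert space is a complete normed space [H] over [R[i]] together
   with a form [dot : {dot H for Num.conj}] (linear in the first argument,
   conjugate-linear in the second) inducing the norm: [hilbert_dot dot]. *)
Definition hilbert_dot (R : realType) (H : completeNormedModType R[i])
    (dot : {dot H for Num.conj}) : Prop :=
  forall x : H, dot x x = `|x| ^+ 2.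

(* Only the values of [act] on [dom] are meaningful. *)
Record unbounded_op (R : realType) (H : completeNormedModType R[i]) :=
  UnboundedOp { dom : set H ; act :> H -> H }.

Section operators.
Context {R : realType} {H : completeNormedModType R[i]}.
Implicit Types (A : unbounded_op H) (T : H -> H) (V : set H).

Definition perturb A T : unbounded_op H :=
  UnboundedOp (dom A) (fun x => A x + T x).

Definition bounded_op T : Prop :=
  exists M : R, forall x : H, `|T x| <= M%:C * `|x|.

Definition op_norm T : \bar R :=
  ereal_sup [set (complex.Re `|T x|)%:E | x in [set x : H | `|x| <= 1]].

Definition free_family (n : nat) (v : 'I_n -> H) : Prop :=
  forall c : 'I_n -> R[i], \sum_(i < n) c i *: v i = 0 -> forall i, c i = 0.

Definition has_dim V (n : nat) : Prop :=
  exists v : 'I_n -> H, [/\ free_family v, forall i, V (v i) &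
    forall x, V x -> exists c : 'I_n -> R[i], x = \sum_(i < n) c i *: v i].

Definition linear_op A : Prop :=
  [/\ dom A 0, forall (a : R[i]) x y, dom A x -> dom A y -> dom A (a *: x + y) &
   forall (a : R[i]) x y, dom A x -> dom A y -> A (a *: x + y) = a *: A x + A y].

(* The right-hand side of the equivalence says that [y] is in the domain of
   [A] and [A y = z], the left-hand side that [y] is in the domain of the
   adjoint of [A], which maps [y] to [z]. *)
Definition self_adjoint (dot : {dot H for Num.conj}) A : Prop :=
  [/\ linear_op A, dense (dom A) &
   forall y z : H,
     (forall x, dom A x -> dot (A x) y = dot x z) <-> dom A y /\ A y = z].

Definition symmetric_op (dot : {dot H for Num.conj}) T : Prop :=
  forall x y : H, dot (T x) y = dot x (T y).

Definition resolvent_set A : set R[i] :=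
  [set z | exists S : {linear H -> H},
    [/\ bounded_op S,
        forall x, dom A x -> S (A x - z *: x) = x &
        forall y, dom A (S y) /\ A (S y) - z *: S y = y]].

Definition spectrum A : set R[i] := ~` resolvent_set A.

Definition dist_set (z : R[i]) (D : set R[i]) : \bar R :=
  ereal_inf [set (complex.Re `|z - w|)%:E | w in D].

Definition eigen_space A (z : R[i]) : set H :=
  [set x | dom A x /\ A x = z *: x].

Definition is_eigenvalue A (z : R[i]) : Prop :=
  exists2 x, eigen_space A z x & x != 0.

Definition discrete_spectrum A : set R[i] :=
  [set z | [/\ isolated (spectrum A : set R[i]^o) z, is_eigenvalue A z &
               exists n, has_dim (eigen_space A z) n]].

Definition essential_spectrum A : set R[i] :=
  spectrum A `\` discrete_spectrum A.

Definition lambda_infty A (g : R) : \bar R :=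
  ereal_sup
    [set l%:E | l in [set l : R | l < g /\ essential_spectrum A l%:C]].

(* Entry [k] of [lam], [k = 0, 1, ...], is [lambda_(k+1)] in one-based numbering. If
   only [N] entries are eigenvalues, then, [lam] being non-increasing, these
   are the first [N] entries and the others are all [lambda_infty]. *)
Definition eigenvalue_enumeration A (g : R) (lam : nat -> \bar R) : Prop :=
  [/\ {homo lam : m n / (m <= n)%N >-> (n <= m)%E},
      forall k, lam k = lambda_infty A g \/
        exists l : R, [/\ (lambda_infty A g < l%:E)%E, l < g,
                          is_eigenvalue A l%:C & lam k = l%:E] &
      forall l : R, (lambda_infty A g < l%:E)%E -> l < g ->
        exists2 m, has_dim (eigen_space A l%:C) m
                 & [set k | lam k = l%:E] #= `I_m].

Definition orthogonal_projection (dot : {dot H for Num.conj}) T : Prop :=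
  [/\ linear T, forall x, T (T x) = T x & symmetric_op dot T].

(* [E] is the projection-valued measure with [A = \int t dE(t)]: with
   [mu S = <x, E(S) x>], the domain of [A] is [{x | \int t^2 dmu < oo}], and
   [<x, A x> = \int t dmu] there, which determines [A] by polarization. The
   functional calculus then gives [E S = 1_S(A)]. *)
Definition spectral_measure (dot : {dot H for Num.conj}) A
    (E : set R -> H -> H) : Prop :=
  [/\ forall S : set R, measurable S -> orthogonal_projection dot (E S),
      forall x, E setT x = x,
      forall S T : set R, measurable S -> measurable T ->
        forall x, E (S `&` T) x = E S (E T x) &
      forall x, exists mu : {measure set (measurableTypeR R) -> \bar R},
        [/\ forall S : set R, measurable S ->
              mu S = (complex.Re (dot x (E S x)))%:E,
            dom A x <-> (\int[mu]_t (t ^+ 2)%:E < +oo)%E &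
            dom A x ->
              (complex.Re (dot x (A x)))%:E = (\int[mu]_t t%:E)%E]].

End operators.

(* Main.v *)
Require Import Defs.
From HB Require Import structures.
From mathcomp Require Import all_boot all_order all_algebra.
From mathcomp Require Import sesquilinear complex.
From mathcomp Require Import all_classical all_reals all_analysis.
From mathcomp Require Import measurable_realfun.
From mathcomp Require Import ring lra.
Set Implicit Arguments.
Unset Strict Implicit.
Unset Printing Implicit Defensive.
Import Order.TTheory GRing.Theory Num.Theory.
Import numFieldNormedType.Exports.
Local Open Scope classical_set_scope.
Local Open Scope complex_scope.
Local Open Scope ring_scope.

(** Subtract [gamma] from both operators and write [S = A + C - gamma],
    [T = A + B - gamma], [D = B - C].  In both cases there are [b < d] such that
    [||D|| <= b] and [d] is at most the distance of [0] to the spectrum of [S], so that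
    [||S x|| >= d ||x||] and [||T x|| >= (d - b) ||x||]: both operators have a gap
    at [0].  Let [p] be the spectral projection of [S] for the negative half-line
    and [P] the one of [T].

    The heart of the proof is a dimension count ([spectral_count]).  Suppose that
    [H] is the direct sum of the range of [P] and the kernel of [p], and let [w] be
    a combination of eigenvectors of [S] with eigenvalues in [l, 0[.  Decompose
    [w = u + v] accordingly.  As [v] belongs to the upper spectral subspace of [S],
    it is orthogonal to [w] and [S w], hence
    [<u, S u> = <w, S w> + <v, S v> >= l (||w||^2 + ||v||^2) = l ||u||^2],
    and [<u, T u> >= <u, S u>] by the hypothesis on the range of [P].  If there are
    more independent vectors [w] than the rank of the spectral projection of [T]
    for [l, 0], then some [w <> 0] has [u] in the spectral subspace of [T] for
    ]-oo, l[, so that [<u, T u> < l ||u||^2], a contradiction.  For the eigenvalues,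
    the count is compared with the multiplicities in the two enumerations
    ([enumeration_le]).  For the essential spectrum, a finite rank for [T] on [l, 0]
    bounds the number of independent approximate eigenvectors of [S] in ]l, 0[,
    which makes the spectrum of [S] discrete there ([below_discrete],
    [lambda_infty_le]).

    Three facts support the count.
    - The direct sum: with [e = (d - b) / 2], the Davis-Kahan bound
      [||(1 - P) x|| <= b / (d + e) ||x||] for [x] in the range of [p] and its mirror
      image keep the lower subspace of each operator away from the upper subspace
      of the other ([davis_kahan], [angle_bound], [oblique_decomposition]).
    - The vector [u] lies in the domain when [w] does ([oblique_domain]).
    - The projection [p] is obtained from the sign of the bounded symmetric operator
      [S^-1], whose absolute value is the limit of an explicit iteration
      ([sign_splitting], [gap_splitting]).

    Throughout, [ip] is the real part of the inner product: complex subspaces are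
    orthogonal as soon as they are so for [ip], and statements about [ip] are
    linear over the reals. *)

(** * Real inner product and norm *)


Definition rdot (R : realType) (H : completeNormedModType R[i])
  (dot : {dot H for Num.conj}) (x y : H) : R := complex.Re (dot x y).

Definition vnorm (R : realType) (H : completeNormedModType R[i]) (x : H) : R :=
  complex.Re `|x|.

Section Basics.
Context {R : realType} {H : completeNormedModType R[i]}.
Variable (dot : {dot H for Num.conj}).
Hypothesis hdot : hilbert_dot dot.
Local Notation ip := (rdot dot).
Local Notation nm := (@vnorm R H).
Implicit Types (x y z : H) (a : R).

Lemma dotC x y : dot y x = Num.conj (dot x y).
Proof. by rewrite (hermC dot) /= expr0 mul1r. Qed.

Lemma dotZl (c : R[i]) x y : dot (c *: x) y = c * dot x y.
Proof. by rewrite linearZl_LR. Qed.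

Lemma dotZr (c : R[i]) x y : dot x (c *: y) = Num.conj c * dot x y.
Proof. by rewrite linearZr_LR. Qed.

Lemma dotNl x y : dot (- x) y = - dot x y.
Proof. by rewrite linearNl. Qed.

Lemma dotDl x y z : dot (x + y) z = dot x z + dot y z.
Proof. by rewrite linearDl. Qed.

Lemma dotDr x y z : dot z (x + y) = dot z x + dot z y.
Proof. by rewrite linearDr. Qed.

Lemma dotNr x y : dot x (- y) = - dot x y.
Proof. by rewrite linearNr. Qed.

Lemma ReN (u : R[i]) : complex.Re (- u) = - complex.Re u.
Proof. by case: u. Qed.

Lemma ReC_conj (z : R[i]) : complex.Re (Num.conj z) = complex.Re z.
Proof. by case: z. Qed.

Lemma ipC x y : ip x y = ip y x.
Proof. by rewrite /ip (dotC x y) ReC_conj. Qed.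

Lemma ReD (u v : R[i]) : complex.Re (u + v) = complex.Re u + complex.Re v.
Proof. by case: u; case: v. Qed.

Lemma ipDl x y z : ip (x + y) z = ip x z + ip y z.
Proof. by rewrite /ip dotDl ReD. Qed.

Lemma ipDr x y z : ip z (x + y) = ip z x + ip z y.
Proof. by rewrite ipC ipDl !(ipC z). Qed.

Lemma ipZl a x y : ip (a%:C *: x) y = a * ip x y.
Proof. rewrite /ip dotZl; case: (dot x y) => u v /=; ring. Qed.

Lemma ipZr a x y : ip x (a%:C *: y) = a * ip x y.
Proof. by rewrite ipC ipZl ipC. Qed.

Lemma ipNl x y : ip (- x) y = - ip x y.
Proof. by rewrite /ip dotNl ReN. Qed.

Lemma ipNr x y : ip x (- y) = - ip x y.
Proof. by rewrite ipC ipNl ipC. Qed.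

Lemma ip0l x : ip 0 x = 0.
Proof. by rewrite /ip linear0l. Qed.

Lemma ip0r x : ip x 0 = 0.
Proof. by rewrite ipC ip0l. Qed.

Lemma ipBl x y z : ip (x - y) z = ip x z - ip y z.
Proof. by rewrite ipDl ipNl. Qed.

Lemma ipBr x y z : ip z (x - y) = ip z x - ip z y.
Proof. by rewrite ipDr ipNr. Qed.

Lemma nmE x : `|x| = (nm x)%:C.
Proof. by rewrite /nm RRe_real // ger0_real. Qed.

Lemma nm_ge0 x : 0 <= nm x.
Proof. by have := normr_ge0 x; rewrite nmE lecR. Qed.

Lemma nm2 x : nm x ^+ 2 = ip x x.
Proof. by rewrite /ip hdot nmE -rmorphXn. Qed.

Lemma nm0_eq0 x : nm x = 0 -> x = 0.
Proof. by move=> h; apply/eqP; rewrite -normr_eq0 nmE h. Qed.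

Lemma nm0 : nm 0 = 0.
Proof. by rewrite /nm normr0. Qed.

Lemma nm_gt0 x : x != 0 -> 0 < nm x.
Proof.
move=> x0; rewrite lt_neqAle nm_ge0 andbT eq_sym.
by apply: contra x0 => /eqP /nm0_eq0 ->.
Qed.

Lemma nmD x y : nm (x + y) <= nm x + nm y.
Proof. by have := ler_normD x y; rewrite !nmE -rmorphD lecR. Qed.

Lemma nmZ a x : nm (a%:C *: x) = `|a| * nm x.
Proof.
rewrite {1}/nm normrZ nmE normc_def /= expr0n addr0 sqrtr_sqr /=; ring.
Qed.

Lemma nmN x : nm (- x) = nm x.
Proof. by rewrite /nm normrN. Qed.

Lemma nmB x y : nm (x - y) <= nm x + nm y.
Proof. by rewrite -(nmN y) nmD. Qed.

Lemma nmBC x y : nm (x - y) = nm (y - x).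
Proof. by rewrite /nm distrC. Qed.

Lemma nm_dist x y z : nm (x - z) <= nm (x - y) + nm (y - z).
Proof. by have := nmD (x - y) (y - z); rewrite addrA subrK. Qed.

Lemma ip_le x y : `|ip x y| <= nm x * nm y.
Proof.
have [->|y0] := eqVneq y 0; first by rewrite ip0r normr0 mulr_ge0 ?nm_ge0.
have n0 := nm_gt0 y0.
rewrite -(ler_pXn2r (n := 2)) ?nnegrE ?mulr_ge0 ?nm_ge0 //.
rewrite real_normK ?num_real // exprMn !nm2.
have := nm_ge0 ((ip y y)%:C *: x - (ip x y)%:C *: y).
have := sqr_ge0 (nm ((ip y y)%:C *: x - (ip x y)%:C *: y)).
rewrite nm2 !(ipBl, ipBr, ipZl, ipZr) (ipC y x) => h _.
have yy : 0 < ip y y by rewrite -nm2 exprn_gt0.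
rewrite -(ler_pM2l yy) -subr_ge0; apply: le_trans h _; rewrite le_eqVlt; apply/orP; left.
by apply/eqP; ring.
Qed.

Lemma ip_le_nm x y : ip x y <= nm x * nm y.
Proof. exact: le_trans (ler_norm _) (ip_le x y). Qed.

Lemma ip_ii x y : ip ('i *: x) ('i *: y) = ip x y.
Proof.
rewrite /ip dotZl dotZr.
by case: (dot x y) => u v /=; ring.
Qed.

Lemma ip_il x y : ip ('i *: x) y = - complex.Im (dot x y).
Proof. by rewrite /ip dotZl; case: (dot x y) => u v /=; ring. Qed.

Lemma dot_eq x y z t : ip x y = ip z t -> ip ('i *: x) y = ip ('i *: z) t ->
  dot x y = dot z t.
Proof.
rewrite !ip_il /ip; case: (dot x y) => u v; case: (dot z t) => u' v' /= -> /eqP.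
by rewrite eqr_opp => /eqP ->.
Qed.

Lemma ip_eq0 x : (forall y, ip x y = 0) -> x = 0.
Proof. by move=> h; apply: nm0_eq0; apply/eqP; rewrite -sqrf_eq0 nm2 h. Qed.

Lemma sqnmD x y : nm (x + y) ^+ 2 = nm x ^+ 2 + 2 * ip x y + nm y ^+ 2.
Proof. by rewrite !nm2 ipDl !ipDr (ipC y x); ring. Qed.

Lemma sqnmB x y : nm (x - y) ^+ 2 = nm x ^+ 2 - 2 * ip x y + nm y ^+ 2.
Proof. by rewrite sqnmD ipNr nmN; ring. Qed.

Lemma nm_le_sq x (c : R) : 0 <= c -> nm x ^+ 2 <= c ^+ 2 -> nm x <= c.
Proof. by move=> c0; rewrite ler_pXn2r // nnegrE ?nm_ge0. Qed.

End Basics.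

(** * Convergence and orthogonal projections *)

Definition tends (R : realType) (H : completeNormedModType R[i])
    (u : nat -> H) (l : H) : Prop :=
  forall e : R, 0 < e -> exists n, forall m, (n <= m)%N -> vnorm (u m - l) < e.

Definition lin_subspace (R : realType) (H : completeNormedModType R[i])
    (V : set H) : Prop :=
  V 0 /\ forall (a : R[i]) x y, V x -> V y -> V (a *: x + y).

Definition lim_closed (R : realType) (H : completeNormedModType R[i])
    (V : set H) : Prop :=
  forall u l, (forall n, V (u n)) -> tends u l -> V l.

Section Projections.
Context {R : realType} {H : completeNormedModType R[i]}.
Variable (dot : {dot H for Num.conj}).
Hypothesis hdot : hilbert_dot dot.
Local Notation ip := (rdot dot).
Local Notation nm := (@vnorm R H).
Implicit Types (x y z : H) (V : set H).

Lemma nm_lt (x : H) (e : R) : (`|x| < e%:C) = (nm x < e).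
Proof. by rewrite nmE ltcR. Qed.

Lemma tends_cauchy (u : nat -> H) :
  (forall e : R, 0 < e -> exists n, forall m, (n <= m)%N -> nm (u m - u n) < e) ->
  exists l, tends u l.
Proof.
move=> hu.
have cu : cauchy (u @ \oo).
  apply/cauchyP => e e0.
  have eE : e = (complex.Re e)%:C by rewrite RRe_real // gtr0_real.
  have e1 : 0 < complex.Re e by move: e0; rewrite {1}eE ltcR.
  have [n hn] := hu _ e1; exists (u n).
  exists n => // m /= nm'; rewrite -ball_normE /= distrC eE nm_lt; exact: hn.
have cvu : cvg (u @ \oo) by exact: cauchy_cvg.
exists (lim (u @ \oo)) => e e0.
have ec : 0 < e%:C :> R[i] by rewrite ltcR.
move/cvgrPdist_lt : cvu => /(_ _ ec)[n _ hn].
by exists n => m nm'; rewrite -nm_lt distrC; apply: hn.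
Qed.

Lemma tends_lip (u : nat -> H) l (f : H -> H) (M : R) :
  (forall x y, nm (f x - f y) <= M * nm (x - y)) ->
  tends u l -> tends (f \o u) (f l).
Proof.
move=> hf ul e e0.
have M0 : 0 < `|M| + 1 by rewrite ltr_wpDl.
have [n hn] := ul _ (divr_gt0 e0 M0); exists n => m nm'.
apply: le_lt_trans (hf _ _) _.
have := hn _ nm'; rewrite ltr_pdivlMr // mulrC; apply: le_lt_trans.
apply: ler_wpM2r; first exact: nm_ge0.
by rewrite (le_trans (ler_norm _)) // lerDl.
Qed.

Lemma tends_unique (u : nat -> H) l l' : tends u l -> tends u l' -> l = l'.
Proof.
move=> ul ul'; apply/eqP; rewrite -subr_eq0; apply/eqP; apply: (nm0_eq0).
apply/eqP; rewrite eq_le nm_ge0 andbT; apply/ler_addgt0Pr => e e0; rewrite add0r.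
have e2 : 0 < e / 2 by rewrite divr_gt0.
have [n hn] := ul _ e2; have [m hm] := ul' _ e2.
have h1 := hn (maxn n m) (leq_maxl _ _); have h2 := hm (maxn n m) (leq_maxr _ _).
have := nm_dist l (u (maxn n m)) l'; rewrite (nmBC l (u _)).
by move: h1 h2; lra.
Qed.

Lemma tends_sub (u : nat -> H) l (s : nat -> nat) :
  (forall n, (n <= s n)%N) -> tends u l -> tends (u \o s) l.
Proof.
move=> hs ul e e0; have [n hn] := ul _ e0; exists n => m nm'.
by apply: hn; apply: leq_trans nm' (hs m).
Qed.

Lemma tends_cst (l : H) : tends (fun=> l) l.
Proof. by move=> e e0; exists 0%N => m _; rewrite subrr nm0. Qed.

Lemma tends_D (u v : nat -> H) l m : tends u l -> tends v m ->
  tends (fun n => u n + v n) (l + m).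
Proof.
move=> ul vm e e0; have e2 : 0 < e / 2 by rewrite divr_gt0.
have [n hn] := ul _ e2; have [k hk] := vm _ e2; exists (maxn n k) => j.
rewrite geq_max => /andP[/hn h1 /hk h2].
have := nmD (u j - l) (v j - m); rewrite opprD addrACA; move: h1 h2; lra.
Qed.

Lemma tends_near (u : nat -> H) l (e : R) : tends u l -> 0 < e ->
  exists n, nm (u n - l) < e.
Proof. by move=> ul /ul[n hn]; exists n; apply: hn. Qed.

Lemma tends_ip (u v : nat -> H) l m : tends u l -> tends v m ->
  (forall n, ip (u n) (v n) = 0) -> ip l m = 0.
Proof.
move=> ul vm uv; apply/eqP; rewrite -normr_eq0 eq_le normr_ge0 andbT.
apply/ler_addgt0Pr => e e0; rewrite add0r.
pose K := nm l + nm m + 1.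
have K0 : 0 < K by rewrite /K; have := nm_ge0 l; have := nm_ge0 m; lra.
have d0 : 0 < Num.min 1 (e / K) by rewrite lt_min ltr01 divr_gt0.
have [n hn] := ul _ d0; have [k hk] := vm _ d0.
have := hn _ (leq_maxl n k); have := hk _ (leq_maxr n k).
set j := maxn n k; rewrite !lt_min => /andP[a1 a2] /andP[b1 b2].
have -> : ip l m = - ip (u j - l) (v j) - ip l (v j - m).
  by rewrite ipBl ipBr uv; ring.
apply: le_trans (ler_normB _ _) _; rewrite normrN.
have h1 := ip_le hdot (u j - l) (v j); have h2 := ip_le hdot l (v j - m).
have h3 : nm (v j) <= nm m + 1.
  by have := nmD (v j - m) m; rewrite subrK; lra.
have eK : e / K * K = e by rewrite divfK ?gt_eqF.
have : nm (u j - l) * nm (v j) <= e / K * (nm m + 1).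
  by apply: ler_pM => //; try exact: nm_ge0; exact: ltW.
have : nm l * nm (v j - m) <= nm l * (e / K).
  by apply: ler_wpM2l; [exact: nm_ge0|exact: ltW].
rewrite /K in eK *; move: eK; set q := e / _ => eK; move: h1 h2; nra.
Qed.

Lemma lin_subspaceD V x y : lin_subspace V -> V x -> V y -> V (x + y).
Proof. by case=> _ h Vx Vy; rewrite -[x]scale1r; apply: h. Qed.

Lemma lin_subspaceZ V (a : R[i]) x : lin_subspace V -> V x -> V (a *: x).
Proof. by case=> V0 h Vx; rewrite -[_ *: _]addr0; apply: h. Qed.

Lemma lin_subspaceB V x y : lin_subspace V -> V x -> V y -> V (x - y).
Proof. by move=> sV Vx Vy; rewrite addrC -scaleN1r; apply: sV.2. Qed.

Lemma lin_subspace_sum V (I : Type) (r : seq I) (P : pred I) (f : I -> H) :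
  lin_subspace V -> (forall i, P i -> V (f i)) -> V (\sum_(i <- r | P i) f i).
Proof.
move=> sV hf; elim/big_ind : _ => //; first exact: sV.1.
by move=> x y; apply: lin_subspaceD.
Qed.

(** A complex subspace orthogonal for the real inner product is orthogonal for
    the complex one, because it is stable under multiplication by [i]. *)
Lemma dot_eq0 V x : lin_subspace V -> (forall v, V v -> ip x v = 0) ->
  forall v, V v -> dot x v = 0.
Proof.
move=> sV h v Vv; rewrite -(linear0l dot v); apply: dot_eq.
  by rewrite h // ip0l.
rewrite scaler0 ip0l -(ip_ii dot) scalerA -expr2 sqrCi scaleN1r ipNl h ?oppr0 //.
exact: lin_subspaceZ.
Qed.

(** The parallelogram law makes every minimizing sequence of the distance a
    Cauchy sequence. *)
Lemma nearest_point V x : lin_subspace V -> lim_closed V ->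
  exists2 p, V p & forall v, V v -> ip (x - p) v = 0.
Proof.
move=> sV cV.
pose S := [set r | exists2 v, V v & r = nm (x - v)].
have S0 : S (nm (x - 0)) by exists 0 => //; exact: sV.1.
have hS : has_inf S.
  by split; [exists (nm (x - 0))|exists 0 => _ [v _ ->]; exact: nm_ge0].
pose D := inf S.
have lD v : V v -> D <= nm (x - v).
  by move=> Vv; apply: ge_inf; [exact: hS.2|exists v].
have D0 : 0 <= D.
  by apply: lb_le_inf; [exact: hS.1|move=> _ [v _ ->]; exact: nm_ge0].
have ex n : exists v, V v /\ nm (x - v) < D + n.+1%:R^-1.
  have n0 : 0 < n.+1%:R^-1 :> R by rewrite invr_gt0.
  have [_ [v Vv ->] lt] := inf_adherent n0 hS.
  by exists v.
have [u hu] := choice ex.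
have key n m : (n <= m)%N -> nm (u m - u n) ^+ 2 <= (8 * D + 4) * n.+1%:R^-1.
  move=> nm'; have [Vm hm] := hu m; have [Vn hn] := hu n.
  have mn : m.+1%:R^-1 <= n.+1%:R^-1 :> R by rewrite lef_pV2 ?posrE // ler_nat.
  have n0 : 0 < n.+1%:R^-1 :> R by rewrite invr_gt0.
  have n1 : n.+1%:R^-1 <= 1 :> R by rewrite invf_le1 // ler1n.
  have Vmid : V ((2^-1)%:C *: (u m + u n)).
    by apply: lin_subspaceZ => //; apply: lin_subspaceD.
  have hmid := lD _ Vmid.
  have par : nm (u m - u n) ^+ 2 = 2 * nm (x - u m) ^+ 2 + 2 * nm (x - u n) ^+ 2
      - 4 * nm (x - (2^-1)%:C *: (u m + u n)) ^+ 2.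
    rewrite !(nm2 hdot) !(ipDl, ipDr, ipNl, ipNr, ipZl, ipZr).
    by rewrite (ipC dot (u m) x) (ipC dot (u n) x) (ipC dot (u m) (u n)); field.
  rewrite par.
  have a1 : nm (x - u m) ^+ 2 <= (D + n.+1%:R^-1) ^+ 2.
    rewrite ler_pXn2r ?nnegrE ?nm_ge0 //; last exact: addr_ge0 D0 (ltW n0).
    by apply: ltW (lt_le_trans hm _); rewrite lerD2l.
  have a2 : nm (x - u n) ^+ 2 <= (D + n.+1%:R^-1) ^+ 2.
    by rewrite ler_pXn2r ?nnegrE ?nm_ge0 //; [exact: ltW|exact: addr_ge0 D0 (ltW n0)].
  have a3 : D ^+ 2 <= nm (x - (2^-1)%:C *: (u m + u n)) ^+ 2.
    by rewrite ler_pXn2r ?nnegrE ?nm_ge0.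
  move: a1 a2 a3 n0 n1; set t := n.+1%:R^-1; clear -D0; nra.
have [p up] : exists p, tends u p.
  apply: tends_cauchy => e e0.
  have K0 : 0 < 8 * D + 4 by lra.
  have [n _ hn] := near_infty_natSinv_lt (PosNum (divr_gt0 (exprn_gt0 2 e0) K0)).
  exists n => m nm'; have := key _ _ nm'; have := hn n (leqnn n); rewrite /=.
  rewrite ltr_pdivlMr // mulrC => h1 h2.
  rewrite -(ltr_pXn2r (n := 2)) ?nnegrE ?nm_ge0 //; last exact: ltW.
  exact: le_lt_trans h2 h1.
have Vp : V p by apply: cV up => n; case: (hu n).
have pD : nm (x - p) <= D.
  apply/ler_addgt0Pr => e e0; have e2 : 0 < e / 2 by rewrite divr_gt0.
  have [n _ hn] := near_infty_natSinv_lt (PosNum e2).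
  have [k hk] := up _ e2.
  have h1 := hn (maxn n k) (leq_maxl _ _); have h2 := hk _ (leq_maxr n k).
  have [_ h3] := hu (maxn n k).
  have h4 := nm_dist x (u (maxn n k)) p; rewrite /= in h1.
  by move: h1 h2 h3 h4; set t := _.+1%:R^-1; clear; lra.
exists p => // v Vv.
have [/nm0_eq0 -> | v0] := eqVneq (nm v) 0; first by rewrite ip0r.
have v1 : 0 < nm v ^+ 2 by rewrite exprn_gt0 // lt_neqAle eq_sym v0 nm_ge0.
pose t := ip (x - p) v / nm v ^+ 2.
have Vt : V (p + t%:C *: v) by apply: lin_subspaceD => //; apply: lin_subspaceZ.
have h := le_trans pD (lD _ Vt).
have : nm (x - p) ^+ 2 <= nm (x - (p + t%:C *: v)) ^+ 2.
  by rewrite ler_pXn2r ?nnegrE ?nm_ge0.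
rewrite opprD addrA (sqnmB hdot (x - p)) ipZr [nm (_ *: _) ^+ 2](nm2 hdot) ipZl ipZr -(nm2 hdot).
have tE : t * nm v ^+ 2 = ip (x - p) v by rewrite /t divfK ?gt_eqF.
move=> h2.
have : ip (x - p) v * t <= 0 by rewrite -tE in h2 *; nra.
rewrite /t mulrA pmulr_lle0 ?invr_gt0 // -expr2 => h3.
by apply/eqP; rewrite -sqrf_eq0 eq_le h3 sqr_ge0.
Qed.

Lemma projectionP V : lin_subspace V -> lim_closed V ->
  exists2 P, orthogonal_projection dot P & forall x, V x <-> P x = x.
Proof.
move=> sV cV.
have ex x : exists p, V p /\ forall v, V v -> dot (x - p) v = 0.
  have [p Vp hp] := nearest_point x sV cV.
  by exists p; split => //; apply: dot_eq0.
have [P hP] := choice ex.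
have uniq x p : V p -> (forall v, V v -> dot (x - p) v = 0) -> p = P x.
  move=> Vp hp; have [VP hPx] := hP x; apply/eqP; rewrite -subr_eq0; apply/eqP.
  apply: (nm0_eq0); apply/eqP; rewrite -sqrf_eq0 (nm2 hdot) /rdot.
  have VB : V (p - P x) by apply: lin_subspaceB.
  have -> : dot (p - P x) (p - P x) = dot (x - P x) (p - P x) - dot (x - p) (p - P x).
    rewrite -dotNl -dotDl; congr (dot _ _).
    by rewrite opprB [in RHS]addrC addrA subrK.
  by rewrite hp // hPx // subrr.
have fix_ x : V x -> P x = x.
  by move=> Vx; apply/esym/uniq => // v _; rewrite subrr linear0l.
exists P; last by move=> x; split; [exact: fix_|move=> <-; case: (hP x)].
split.
- move=> a x y; apply/esym/uniq; first by apply: sV.2; [case: (hP x)|case: (hP y)].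
  move=> v Vv; have -> : a *: x + y - (a *: P x + P y) = a *: (x - P x) + (y - P y).
    by rewrite scalerBr opprD addrACA.
  by rewrite dotDl dotZl (hP x).2 // (hP y).2 // mulr0 addr0.
- by move=> x; apply: fix_; case: (hP x).
- move=> x y; have [Vx hx] := hP x; have [Vy hy] := hP y.
  have -> : dot (P x) y = dot (P x) (P y).
    apply/eqP; rewrite -subr_eq0 (dotC dot y) (dotC dot (P y)) -rmorphB /=.
    by rewrite -dotNl -dotDl hy // rmorph0.
  by apply/eqP; rewrite -subr_eq0 -opprB -dotNl -dotDl hx // oppr0.
Qed.

End Projections.

(** * Square roots and sign of a symmetric contraction *)

Section Linear.
Context {R : realType} {H : completeNormedModType R[i]}.
Variables (f : H -> H).
Hypothesis lf : linear f.
Lemma linD x y : f (x + y) = f x + f y.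
Proof. by have := lf 1 x y; rewrite !scale1r. Qed.
Lemma lin0 : f 0 = 0.
Proof. by have := linD 0 0; rewrite addr0 => /eqP; rewrite -subr_eq0 opprD addrA subrr sub0r oppr_eq0 => /eqP. Qed.
Lemma linZ a x : f (a *: x) = a *: f x.
Proof. by have := lf a x 0; rewrite lin0 !addr0. Qed.
Lemma linN x : f (- x) = - f x.
Proof. by rewrite -scaleN1r linZ scaleN1r. Qed.
Lemma linB x y : f (x - y) = f x - f y.
Proof. by rewrite linD linN. Qed.
Lemma lin_sum (I : Type) (s : seq I) (P : pred I) (F : I -> H) :
  f (\sum_(i <- s | P i) F i) = \sum_(i <- s | P i) f (F i).
Proof. by elim/big_rec2: _ => [|i y1 y2 _ <-]; [exact: lin0|exact: linD]. Qed.
End Linear.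

Definition ip_sym (R : realType) (H : completeNormedModType R[i])
  (dot : {dot H for Num.conj}) (T : H -> H) := forall x y, rdot dot (T x) y = rdot dot x (T y).

Section Sign.
Context {R : realType} {H : completeNormedModType R[i]}.
Variable (dot : {dot H for Num.conj}).
Hypothesis hdot : hilbert_dot dot.
Local Notation ip := (rdot dot).
Local Notation nm := (@vnorm R H).
Implicit Types (x y z : H).

Lemma tends_Z (u : nat -> H) l (a : R[i]) : tends u l -> tends (fun n => a *: u n) (a *: l).
Proof.
apply: (@tends_lip R H u l (fun x => a *: x) (complex.Re `|a|)) => x y.
rewrite -scalerBr /vnorm normrZ nmE.
have -> : `|a| = (complex.Re `|a|)%:C by rewrite RRe_real // ger0_real.
by rewrite -rmorphM.
Qed.

Lemma tends_ip_lim (u : nat -> H) l y (e : R) : tends u l -> 0 < e ->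
  exists n, forall m, (n <= m)%N -> `|ip (u m) y - ip l y| < e.
Proof.
move=> ul e0; have K0 : 0 < nm y + 1 by rewrite ltr_wpDl ?nm_ge0.
have [n hn] := ul _ (divr_gt0 e0 K0); exists n => m /hn.
rewrite -ipBl ltr_pdivlMr //; apply: le_lt_trans.
apply: le_trans (ip_le hdot _ _) _; rewrite ler_wpM2l ?nm_ge0 // lerDl ler01 //.
Qed.

Lemma tends_ip_eq (u v : nat -> H) l m x y : tends u l -> tends v m ->
  (forall n, ip (u n) y = ip x (v n)) -> ip l y = ip x m.
Proof.
move=> ul vm uv; apply/eqP; rewrite -subr_eq0 -normr_le0.
apply/ler_addgt0Pr => e e0; rewrite add0r; have e2 : 0 < e / 2 by rewrite divr_gt0.
have [n hn] := tends_ip_lim y ul e2; have [k hk] := tends_ip_lim x vm e2.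
have h1 := hn _ (leq_maxl n k); have h2 := hk _ (leq_maxr n k).
rewrite ![ip _ x]ipC -uv in h2; rewrite distrC in h1.
apply: le_trans (ler_distD (ip (u (maxn n k)) y) _ _) _.
by move: h1 h2; lra.
Qed.

Lemma lin_lip (f : H -> H) (M : R) : linear f -> (forall x, nm (f x) <= M * nm x) ->
  forall x y, nm (f x - f y) <= M * nm (x - y).
Proof. by move=> lf h x y; rewrite -linB. Qed.

Lemma symmetric_opP (T : H -> H) : linear T -> symmetric_op dot T <-> ip_sym dot T.
Proof.
move=> lT; split=> h x y; first by rewrite /rdot h.
by apply: dot_eq; rewrite ?h // -linZ // h.
Qed.

Lemma proj_ker P x : orthogonal_projection dot P ->
  (forall v, P v = v -> ip x v = 0) -> P x = 0.
Proof.
case=> lP idP /(symmetric_opP lP) sP h; apply: nm0_eq0; apply/eqP.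
by rewrite -sqrf_eq0 (nm2 hdot) sP idP h.
Qed.

Lemma proj_orth P x y : orthogonal_projection dot P -> P x = x -> P y = 0 ->
  ip x y = 0.
Proof. by case=> lP _ /(symmetric_opP lP) sP xE yE; rewrite -xE sP yE ip0r. Qed.

(** A symmetric operator leaving a subspace invariant leaves its orthogonal
    complement invariant. *)
Lemma proj_commute P g : orthogonal_projection dot P -> linear g -> ip_sym dot g ->
  (forall x, P x = x -> P (g x) = g x) -> forall x, P (g x) = g (P x).
Proof.
move=> oP lg sg hg x; have [lP idP _] := oP.
have e : P (g (x - P x)) = 0.
  apply: (proj_ker oP) => v Vv; rewrite sg ipC; apply: (proj_orth oP).
    exact: hg.
  by rewrite linB // idP subrr.
have -> : g x = g (x - P x) + g (P x) by rewrite -linD // subrK.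
by rewrite (linD lP) e add0r hg.
Qed.

(** The iteration of [root_iter] below for the real number [1] in place of the
    operator; it majorizes the norms of the iterates and of their increments. *)
Fixpoint sqrt_bound (n : nat) : R :=
  if n is k.+1 then (1 + sqrt_bound k ^+ 2) / 2 else 0.

Lemma sqrt_bound01 n : 0 <= sqrt_bound n <= 1.
Proof. elim: n => [|n /andP[h1 h2]] /=; [by rewrite lexx ler01|apply/andP; split; nra]. Qed.

Lemma sqrt_bound_mono n m : (n <= m)%N -> sqrt_bound n <= sqrt_bound m.
Proof.
move=> /subnK <-; elim: (m - n)%N => [//|k IH]; apply: le_trans IH _.
by rewrite addSn /=; have := sqr_ge0 (1 - sqrt_bound (k + n)); nra.
Qed.

Section Root.
Variable r : H -> H.
Hypothesis lr : linear r.
Hypothesis sr : ip_sym dot r.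
Hypothesis cr : forall x, nm (r x) <= nm x.

Definition defect x := x - r (r x).

(** Iterates of [Y |-> (1 - r^2 + Y^2) / 2], whose fixed point [Y] satisfies
    [(1 - Y)^2 = r^2]. *)
Fixpoint root_iter (n : nat) (x : H) : H :=
  if n is k.+1 then (2^-1)%:C *: (defect x + root_iter k (root_iter k x)) else 0.

Lemma defect_lin : linear defect.
Proof.
move=> a x y; rewrite /defect (lr a x y) (lr a (r x)) scalerBr.
by rewrite opprD addrACA.
Qed.

Lemma defect_le x : nm (defect x) <= nm x.
Proof.
apply: nm_le_sq; first exact: nm_ge0.
rewrite (sqnmB hdot) -sr -(nm2 hdot).
have : nm (r (r x)) ^+ 2 <= nm (r x) ^+ 2 by rewrite ler_pXn2r ?nnegrE ?nm_ge0.
by have := sqr_ge0 (nm (r x)); lra.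
Qed.

Lemma root_lin n : linear (root_iter n).
Proof.
elim: n => [|n IH] a x y /=; first by rewrite scaler0 addr0.
rewrite (IH a x y) (IH a) (defect_lin a x y).
move: (defect x) (defect y) (root_iter n _) (root_iter n _) => u v p q.
by rewrite addrACA -(scalerDr a) (scalerDr _ (a *: _)) !scalerA mulrC.
Qed.

Lemma root_sym n : ip_sym dot (root_iter n).
Proof.
elim: n => [|n IH] x y /=; first by rewrite ip0l ip0r.
by rewrite ipZl ipZr !(ipDl, ipDr, ipNl, ipNr) -!IH -sr sr.
Qed.

Lemma root_commute (g : H -> H) n : linear g -> (forall x, g (r x) = r (g x)) ->
  forall x, g (root_iter n x) = root_iter n (g x).
Proof.
move=> lg hg; elim: n => [|n IH] x /=; first exact: lin0.
by rewrite linZ // linD // linB // !IH !hg.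
Qed.

Lemma root_commute2 n m x :
  root_iter n (root_iter m x) = root_iter m (root_iter n x).
Proof.
apply: root_commute; first exact: root_lin.
by move=> z; rewrite -root_commute.
Qed.

Lemma half_nm x : nm ((2^-1)%:C *: x) = nm x / 2.
Proof. by rewrite nmZ ger0_norm ?invr_ge0 // mulrC. Qed.

Lemma root_le n x : nm (root_iter n x) <= sqrt_bound n * nm x.
Proof.
elim: n x => [|n IH] x /=; first by rewrite nm0 mul0r.
rewrite half_nm mulrAC ler_wpM2r ?invr_ge0 // mulrDl mul1r.
apply: le_trans (nmD _ _) _; apply: lerD; first exact: defect_le.
apply: le_trans (IH _) _; rewrite expr2 -mulrA ler_wpM2l //.
by case/andP: (sqrt_bound01 n).
Qed.

Lemma root_le1 n x : nm (root_iter n x) <= nm x.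
Proof.
apply: le_trans (root_le n x) _; rewrite ler_piMl ?nm_ge0 //.
by case/andP: (sqrt_bound01 n).
Qed.

(** The iterates commute, so the difference of two successive squares factors
    as [(Y_(n+1) + Y_n) (Y_(n+1) - Y_n)]. *)
Lemma root_step n x :
  nm (root_iter n.+1 x - root_iter n x) <= (sqrt_bound n.+1 - sqrt_bound n) * nm x.
Proof.
elim: n x => [|n IH] x.
  rewrite /= subr0 addr0 half_nm expr0n /= addr0 subr0.
  by rewrite mul1r mulrC ler_wpM2l ?invr_ge0 // defect_le.
pose Y1 := root_iter n.+1; pose Y0 := root_iter n.
have E k z : root_iter k.+1 z =
  (2^-1)%:C *: (defect z + root_iter k (root_iter k z)) by [].
have -> : root_iter n.+2 x - root_iter n.+1 x =
    (2^-1)%:C *: (Y1 (Y1 x - Y0 x) + Y0 (Y1 x - Y0 x)).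
  rewrite (E n.+1) [in X in _ - X = _](E n) -scalerBr; congr (_ *: _).
  rewrite opprD addrACA subrr add0r.
  rewrite /Y1 /Y0 (linB (root_lin n.+1)) (linB (root_lin n)).
  by rewrite (root_commute2 n.+1 n) addrA subrK.
rewrite half_nm.
have h1 := root_le n.+1 (Y1 x - Y0 x); have h0 := root_le n (Y1 x - Y0 x).
have h := nmD (Y1 (Y1 x - Y0 x)) (Y0 (Y1 x - Y0 x)).
have hI := IH x; rewrite -/Y1 -/Y0 in h1 h0 hI.
have /andP[s0 _] := sqrt_bound01 n; have /andP[s1 _] := sqrt_bound01 n.+1.
have e2 : sqrt_bound n.+2 = (1 + sqrt_bound n.+1 ^+ 2) / 2 by [].
have e1 : 1 = 2 * sqrt_bound n.+1 - sqrt_bound n ^+ 2 by rewrite /=; field.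
rewrite e2; move: (sqrt_bound n.+1) (sqrt_bound n) s0 s1 h1 h0 hI e1 => b c.
move: h; set N := nm (Y1 x - Y0 x); set K := nm x => h c0 b0 h1 h0 hI e1.
have -> : (1 + b ^+ 2) / 2 - b = (b + c) * (b - c) / 2 by nra.
have : (b + c) * N <= (b + c) * ((b - c) * K) by rewrite ler_wpM2l // addr_ge0.
by move: h h1 h0; clear; nra.
Qed.

Lemma root_dist n m x : (n <= m)%N ->
  nm (root_iter m x - root_iter n x) <= (sqrt_bound m - sqrt_bound n) * nm x.
Proof.
move=> /subnK <-; elim: (m - n)%N => [|k IH]; first by rewrite !subrr nm0 mul0r.
rewrite addSn; apply: le_trans (nm_dist _ (root_iter (k + n) x) _) _.
by have := root_step (k + n) x; move: IH; set s := sqrt_bound _.+1; lra.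
Qed.

Lemma root_tends x : exists l, tends (root_iter^~ x) l.
Proof.
apply: tends_cauchy => e e0.
have K0 : 0 < nm x + 1 by rewrite ltr_wpDl ?nm_ge0.
pose S := range sqrt_bound.
have hS : has_sup S.
  split; first by exists (sqrt_bound 0), 0%N.
  by exists 1 => _ [n _ <-]; case/andP: (sqrt_bound01 n).
have [_ [n _ <-] hn] := sup_adherent (divr_gt0 e0 K0) hS.
exists n => m nm'; apply: le_lt_trans (root_dist x nm') _.
have hm : sqrt_bound m <= sup S by apply: ub_le_sup; [exact: hS.2|exists m].
have d0 : 0 <= sqrt_bound m - sqrt_bound n by rewrite subr_ge0 sqrt_bound_mono.
have d1 : sqrt_bound m - sqrt_bound n < e / (nm x + 1) by lra.
have := nm_ge0 x; move: d0 d1; rewrite ltr_pdivlMr //.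
by set d := _ - _; move: K0; set K := nm x => *; nra.
Qed.

(** The absolute value of [r] is [1 - Y] for the limit [Y] of the iterates, which
    exists because the increments are dominated by those of a bounded monotone
    sequence of reals. *)
Lemma abs_contraction : exists a : H -> H,
  [/\ linear a, ip_sym dot a, forall x, 0 <= ip x (a x),
      forall x, a (a x) = r (r x) &
      forall x, r (a x) = a (r x)].
Proof.
have [Y hY] := choice root_tends.
have lY : linear Y.
  move=> c x y; apply: (tends_unique (hY _)).
  have := tends_D (tends_Z c (hY x)) (hY y).
  by under eq_fun do rewrite -root_lin.
have sY : ip_sym dot Y.
  by move=> x y; apply: (tends_ip_eq (hY x) (hY y)) => n; apply: root_sym.
have Y1 x : nm (Y x) <= nm x.
  apply/ler_addgt0Pr => e e0; have [n hn] := tends_near (hY x) e0.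
  have := root_le1 n x; have := nmD (Y x - root_iter n x) (root_iter n x).
  by rewrite subrK nmBC; lra.
have rY x : r (Y x) = Y (r x).
  apply: (@tends_unique _ _ (root_iter^~ (r x))) (hY _).
  have r1 z : nm (r z) <= 1 * nm z by rewrite mul1r.
  have := tends_lip (lin_lip lr r1) (hY x); congr (tends _ _).
  by apply/funext => n /=; exact: root_commute.
have YY x : Y (Y x) = (2%:R)%:C *: Y x - defect x.
  have t1 : tends (fun n => root_iter n (root_iter n x)) (Y (Y x)).
    move=> e e0; have e2 : 0 < e / 2 by rewrite divr_gt0.
    have [n hn] := hY x _ e2; have [k hk] := hY (Y x) _ e2.
    exists (maxn n k) => j; rewrite geq_max => /andP[/hn h1 /hk h2].
    have := nm_dist (root_iter j (root_iter j x)) (root_iter j (Y x)) (Y (Y x)).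
    have := root_le1 j (root_iter j x - Y x); rewrite (linB (root_lin j)).
    by move: h1 h2; lra.
  apply: (tends_unique t1).
  have t2 := tends_D (tends_Z (2%:R)%:C (tends_sub (s := S) (@leqnSn) (hY x)))
               (tends_cst (- defect x)).
  move: t2; congr (tends _ _); apply/funext => n /=.
  rewrite scalerA -rmorphM /= mulfV ?pnatr_eq0 // scale1r addrAC subrr add0r //.
exists (fun x => x - Y x); split.
- by move=> c x y; rewrite lY scalerBr opprD addrACA.
- by move=> x y; rewrite ipBl ipBr sY.
- move=> x; rewrite ipBr -(nm2 hdot) subr_ge0; apply: le_trans (ip_le_nm hdot _ _) _.
  by rewrite expr2 ler_wpM2l ?nm_ge0.
- move=> x; rewrite (linB lY) YY /defect rmorph_nat scaler_nat mulr2n.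
  move: (Y x) (r (r x)) => u w.
  have -> : u - (u + u - (x - w)) = x - w - u.
    by rewrite opprB addrCA opprD (addrA u) subrr add0r.
  by rewrite opprB addrA subrK opprB addrC subrK.
- by move=> x; rewrite linB // rY.
Qed.

(** Splitting [H] along the sign of [r]: on the closed subspace where
    [r = |r|] the form of [r] is nonnegative, and [(|r| - r)(|r| + r) = 0]
    forces [r = - |r|] on its orthogonal complement. *)
Lemma sign_splitting : exists P : H -> H,
  [/\ orthogonal_projection dot P, forall x, P (r x) = r (P x),
      forall x, P x = x -> 0 <= ip x (r x) &
      forall x, P x = 0 -> ip x (r x) <= 0].
Proof.
have [a [la sa a0 aa ra]] := abs_contraction.
have na x : nm (a x) = nm (r x).
  apply/eqP; rewrite -(@eqrXn2 _ 2) ?nm_ge0 //.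
  by rewrite !(nm2 hdot) sa aa sr.
pose V := [set x | a x = r x].
have sV : lin_subspace V.
  split; first by rewrite /V /= (lin0 la) (lin0 lr).
  by move=> c x y; rewrite /V /= => xV yV; rewrite (la c) (lr c) xV yV.
have a1 x : nm (a x) <= 1 * nm x by rewrite na mul1r.
have r1 x : nm (r x) <= 1 * nm x by rewrite mul1r.
have cV : lim_closed V.
  move=> u l uV ul; apply: (tends_unique (tends_lip (lin_lip la a1) ul)).
  have := tends_lip (lin_lip lr r1) ul; congr (tends _ _).
  by apply/funext => n; rewrite /= uV.
have [P oP VP] := projectionP hdot sV cV.
exists P; split => //.
- apply: (proj_commute oP) => // x /VP xV; apply/VP.
  by rewrite /V /= -ra xV.
- by move=> x /VP xV; rewrite -xV.
- move=> x Px0; suff : a x + r x = 0.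
    by move/eqP; rewrite addr_eq0 => /eqP /(congr1 (ip x)); rewrite ipNr; have := a0 x; lra.
  have wV : V (a x + r x) by rewrite /V /= !linD // aa ra addrC.
  have rwV : V (r (a x + r x)) by rewrite /V /= -ra wV.
  have e0 : ip x (r (a x + r x)) = 0.
    by rewrite ipC; apply: (proj_orth oP) => //; apply/VP.
  apply: nm0_eq0; apply/eqP; rewrite -sqrf_eq0 (nm2 hdot) [ip _ _]ipDl sa sr.
  by rewrite (_ : a _ = r (a x + r x)) // e0 addr0.
Qed.

End Root.
End Sign.

(** * Self-adjoint operators and their resolvents *)

Definition reduces (R : realType) (H : completeNormedModType R[i])
    (P : H -> H) (A : unbounded_op H) : Prop :=
  forall x, dom A x -> dom A (P x) /\ A (P x) = P (A x).

Definition op_opp (R : realType) (H : completeNormedModType R[i])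
    (A : unbounded_op H) : unbounded_op H :=
  UnboundedOp (dom A) (fun x => - A x).

Section SelfAdjoint.
Context {R : realType} {H : completeNormedModType R[i]}.
Variable (dot : {dot H for Num.conj}).
Hypothesis hdot : hilbert_dot dot.
Local Notation ip := (rdot dot).
Local Notation nm := (@vnorm R H).
Implicit Types (x y z : H) (A : unbounded_op H).

Lemma nm_scale (a : R[i]) x : nm (a *: x) = complex.Re `|a| * nm x.
Proof.
rewrite /vnorm normrZ nmE.
have -> : `|a| = (complex.Re `|a|)%:C by rewrite RRe_real // ger0_real.
by rewrite -rmorphM.
Qed.

Lemma Re_norm_ge0 (a : R[i]) : 0 <= complex.Re `|a|.
Proof. by have := normr_ge0 a; rewrite lecE /= => /andP[]. Qed.

Lemma ip_ir x y : ip x ('i *: y) = - ip ('i *: x) y.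
Proof. by rewrite -(ip_ii dot x) scalerA -expr2 sqrCi scaleN1r ipNr. Qed.

Section OneOperator.
Variable A : unbounded_op H.
Hypothesis lA : linear_op A.

Lemma dom_sub : lin_subspace (dom A).
Proof. by case: lA. Qed.

Lemma op_linear a x y : dom A x -> dom A y -> A (a *: x + y) = a *: A x + A y.
Proof. by case: lA => _ _; apply. Qed.

Lemma op_add x y : dom A x -> dom A y -> A (x + y) = A x + A y.
Proof. by move=> dx dy; have := op_linear 1 dx dy; rewrite !scale1r. Qed.

Lemma op0 : A 0 = 0.
Proof.
have d0 := dom_sub.1; have := op_add d0 d0; rewrite addr0 => /eqP.
by rewrite -subr_eq0 opprD addrA subrr sub0r oppr_eq0 => /eqP.
Qed.

Lemma op_scale a x : dom A x -> A (a *: x) = a *: A x.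
Proof. by move=> dx; have := op_linear a dx dom_sub.1; rewrite op0 !addr0. Qed.

Lemma op_sub x y : dom A x -> dom A y -> A (x - y) = A x - A y.
Proof. by move=> dx dy; rewrite addrC -scaleN1r op_linear // scaleN1r addrC. Qed.

Lemma op_sum (I : Type) (s : seq I) (P : pred I) (F : I -> H) :
  (forall i, P i -> dom A (F i)) ->
  A (\sum_(i <- s | P i) F i) = \sum_(i <- s | P i) A (F i).
Proof.
move=> dF; suff [] : A (\sum_(i <- s | P i) F i) = \sum_(i <- s | P i) A (F i) /\
  dom A (\sum_(i <- s | P i) F i) by [].
elim/big_rec2 : _ => [|i y1 y2 Pi [E d]]; first by rewrite op0; split => //; exact: dom_sub.1.
by rewrite op_add ?E //; [split=> //; apply: lin_subspaceD dom_sub _ d|]; apply: dF.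
Qed.

End OneOperator.

Lemma dense_orth (V : set H) x : dense V -> (forall v, V v -> ip x v = 0) -> x = 0.
Proof.
move=> dV h; apply: nm0_eq0; apply/eqP; rewrite eq_le nm_ge0 andbT.
apply/ler_addgt0Pr => e e0; rewrite add0r.
have ec : 0 < e%:C :> R[i] by rewrite ltcR.
have [||y [xy Vy]] := dV (ball x e%:C); [exists x; exact: ballxx|exact: ball_open|].
move: xy; rewrite -ball_normE /= nm_lt => xy.
have : nm x ^+ 2 <= nm x * e.
  rewrite (nm2 hdot) -[leLHS]subr0 -(h _ Vy) -ipBr.
  by apply: le_trans (ip_le_nm hdot _ _) _; rewrite ler_wpM2l ?nm_ge0 // ltW.
by have := nm_ge0 x; nra.
Qed.

Section SA.
Variable A : unbounded_op H.
Hypothesis sA : self_adjoint dot A.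

Lemma sa_lin : linear_op A. Proof. by case: sA. Qed.

Lemma sa_sub : lin_subspace (dom A). Proof. exact: dom_sub sa_lin. Qed.

Lemma sa_dot x y : dom A x -> dom A y -> dot (A x) y = dot x (A y).
Proof. by move=> dx dy; case: sA => _ _ /(_ y (A y))[_]; apply. Qed.

Lemma sa_ip x y : dom A x -> dom A y -> ip (A x) y = ip x (A y).
Proof. by move=> dx dy; rewrite /rdot sa_dot. Qed.

Lemma sa_adjoint y z : (forall x, dom A x -> ip (A x) y = ip x z) ->
  dom A y /\ A y = z.
Proof.
move=> h; case: sA => _ _ /(_ y z)[+ _]; apply => x dx; apply: dot_eq; first exact: h.
by rewrite -(op_scale sa_lin) // h //; apply: lin_subspaceZ sa_sub _.
Qed.

Lemma sa_closed (u : nat -> H) x y : (forall n, dom A (u n)) -> tends u x ->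
  tends (A \o u) y -> dom A x /\ A x = y.
Proof.
move=> du ux uy; apply: sa_adjoint => v dv; rewrite ipC.
by apply: (tends_ip_eq hdot ux uy) => n; rewrite ipC -sa_ip // ipC.
Qed.

(** The adjoint relation of [A + T] at [(y, z)] is that of [A] at
    [(y, z - T y)]. *)
Lemma perturb_sa (T : H -> H) : linear T -> ip_sym dot T ->
  self_adjoint dot (perturb A T).
Proof.
move=> lT sT; have [[d0 dl] lin] := (sa_sub, op_linear sa_lin); have [_ dA _] := sA.
split; [split => //= |by []|].
  by move=> a x y dx dy; rewrite lin // lT scalerDr addrACA.
move=> y z; split => /= [h|[dy <-] x dx].
  have [dy Ay] : dom A y /\ A y = z - T y.
    apply: sa_adjoint => x dx; have := congr1 (@complex.Re R) (h x dx).
    rewrite -!/(rdot dot _ _) ipDl ipBr sT => <-; ring.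
  by rewrite Ay subrK.
by rewrite dotDl dotDr sa_dot // (symmetric_opP dot lT).2.
Qed.

Lemma op_opp_sa : self_adjoint dot (op_opp A).
Proof.
have [[d0 dl] lin] := (sa_sub, op_linear sa_lin); have [_ dA _] := sA.
split; [split => //= |by []|].
  by move=> a x y dx dy; rewrite lin // opprD scalerN.
move=> y z; split => /= [h|[dy <-] x dx].
  have [dy Ay] : dom A y /\ A y = - z.
    apply: sa_adjoint => x dx; have := congr1 (@complex.Re R) (h x dx).
    by rewrite -!/(rdot dot _ _) ipNl ipNr => <-; rewrite opprK.
  by rewrite Ay opprK.
by rewrite dotNl dotNr sa_dot.
Qed.

(** For symmetric [A] and [z = a + i b], the vectors [A x - a x] and [i b x] are
    orthogonal for [ip]. *)
Lemma nonreal_bound (z : R[i]) x : dom A x ->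
  `|complex.Im z| * nm x <= nm (A x - z *: x).
Proof.
move=> dx; case: z => a b /=.
have zE : (a +i* b) *: x = a%:C *: x + b%:C *: ('i *: x).
  rewrite scalerA -scalerDl; congr (_ *: _); apply/eqP.
  by rewrite eq_complex /=; apply/andP; split; apply/eqP; ring.
pose M := A x - a%:C *: x.
have i1 : ip (A x) ('i *: x) = 0.
  have : ip (A x) ('i *: x) = - ip (A x) ('i *: x).
    rewrite {1}ip_ir -(op_scale sa_lin) // sa_ip //; first by rewrite (ipC dot _ (A x)).
    exact: lin_subspaceZ sa_sub _.
  lra.
have i2 : ip x ('i *: x) = 0 by have := ip_ir x x; rewrite (ipC dot _ x); lra.
have -> : A x - (a +i* b) *: x = M - b%:C *: ('i *: x).
  by rewrite zE opprD addrA.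
rewrite -(ler_pXn2r (n := 2)) ?nnegrE ?mulr_ge0 ?nm_ge0 //.
have i3 : ip M ('i *: x) = 0 by rewrite /M ipBl ipZl i1 i2; ring.
rewrite (sqnmB hdot) ipZr i3 exprMn real_normK ?num_real //.
rewrite [X in _ <= _ + X](nm2 hdot) ipZl ipZr ip_ii -(nm2 hdot).
by rewrite /M; have := sqr_ge0 (nm (A x - a%:C *: x)); lra.
Qed.

(** If [A - z] is bounded below then its range is closed; the orthogonal
    complement of the range is the kernel of [A - z^*]. *)
Lemma sa_surj (z : R[i]) (c : R) : 0 < c ->
  (forall x, dom A x -> c * nm x <= nm (A x - z *: x)) ->
  (forall x, dom A x -> A x = Num.conj z *: x -> x = 0) ->
  forall y, exists x, dom A x /\ A x - z *: x = y.
Proof.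
move=> c0 hc hk y.
pose V := [set y | exists x, dom A x /\ A x - z *: x = y].
have sV : lin_subspace V.
  split; first by exists 0; rewrite (op0 sa_lin) scaler0 subr0; split=> //; exact: sa_sub.1.
  move=> a _ _ [u [du <-]] [v [dv <-]]; exists (a *: u + v); split; first exact: sa_sub.2.
  by rewrite (op_linear sa_lin) // !scalerDr scalerN opprD addrACA !scalerA (mulrC z).
have cV : lim_closed V.
  move=> u l uV ul; have [x hx] := choice uV.
  have [p xp] : exists p, tends x p.
    apply: tends_cauchy => e e0; have e2 : 0 < c * (e / 2) by rewrite mulr_gt0 // divr_gt0.
    have [n hn] := ul _ e2; exists n => m nm'.
    have h1 := hn _ nm'; have h2 := hn _ (leqnn n).
    have [[dm Em] [dn En]] := (hx m, hx n).
    have := hc _ (lin_subspaceB sa_sub dm dn).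
    rewrite (op_sub sa_lin) // scalerBr.
    have -> : A (x m) - A (x n) - (z *: x m - z *: x n) = u m - u n.
      by rewrite -Em -En !opprD !opprK addrACA.
    have := nm_dist (u m) l (u n); rewrite (nmBC l) => h3 h4.
    by rewrite -(ltr_pM2l c0); move: h1 h2 h3 h4; lra.
  have xp' := tends_D ul (tends_Z z xp).
  have [dp Ap] : dom A p /\ A p = l + z *: p.
    apply: (sa_closed (u := x)) xp _ => [n|]; first by case: (hx n).
    move: xp'; congr (tends _ _); apply/funext => n /=.
    by case: (hx n) => _ <-; rewrite subrK.
  by exists p; rewrite Ap addrK.
have [P oP VP] := projectionP hdot sV cV.
suff w0 : y - P y = 0.
  by have /VP : P y = y; [apply/esym/eqP; rewrite -subr_eq0 w0|].
have [lP idP _] := oP.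
have wV v : V v -> dot (y - P y) v = 0.
  apply: dot_eq0 => // {}v /VP Vv; rewrite ipC; apply: (proj_orth oP) => //.
  by rewrite linB // idP subrr.
have [dw Aw] : dom A (y - P y) /\ A (y - P y) = Num.conj z *: (y - P y).
  apply: sa_adjoint => x dx; rewrite /rdot; congr complex.Re.
  have h : dot (A x - z *: x) (y - P y) = 0.
    by rewrite dotC wV ?rmorph0 //; exists x.
  apply/eqP; rewrite -subr_eq0 dotZr conjCK -dotZl -dotNl -dotDl.
  by rewrite h.
exact: hk dw Aw.
Qed.

Lemma sa_resolvent (z : R[i]) (c : R) : 0 < c ->
  (forall x, dom A x -> c * nm x <= nm (A x - z *: x)) ->
  (forall x, dom A x -> A x = Num.conj z *: x -> x = 0) ->
  resolvent_set A z.
Proof.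
move=> c0 hc hk; have [S hS] := choice (sa_surj c0 hc hk).
have inj x y : dom A x -> dom A y -> A x - z *: x = A y - z *: y -> x = y.
  move=> dx dy E; apply/eqP; rewrite -subr_eq0; apply/eqP/nm0_eq0/eqP.
  rewrite eq_le nm_ge0 andbT -(pmulr_rle0 _ c0).
  apply: le_trans (hc _ (lin_subspaceB sa_sub dx dy)) _.
  rewrite (op_sub sa_lin) // scalerBr.
  have -> : A x - A y - (z *: x - z *: y) = (A x - z *: x) - (A y - z *: y).
    by rewrite !opprD !opprK addrACA.
  by rewrite E subrr nm0.
have lS : linear S.
  move=> a x y; have [[dx Ex] [dy Ey]] := (hS x, hS y); have [dxy Exy] := hS (a *: x + y).
  apply: inj => //; first exact: sa_sub.2.
  rewrite Exy (op_linear sa_lin) // !scalerDr opprD addrACA Ey; congr (_ + _).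
  by rewrite -{1}Ex scalerBr !scalerA mulrC.
pose S' : {linear H -> H} := HB.pack S (GRing.isLinear.Build _ _ _ _ S lS).
exists S'; split => /=.
- exists c^-1 => x; have [dx Ex] := hS x.
  have := hc _ dx; rewrite Ex !nmE -rmorphM lecR mulrC -ler_pdivlMr // mulrC.
  by [].
- by move=> x dx; have [d E] := hS (A x - z *: x); apply: inj.
- by [].
Qed.

Lemma real_resolvent (s : R) (c : R) : 0 < c ->
  (forall x, dom A x -> c * nm x <= nm (A x - s%:C *: x)) ->
  resolvent_set A s%:C.
Proof.
move=> c0 hc; apply: (sa_resolvent c0 hc) => x dx.
have -> : Num.conj s%:C = s%:C by apply/eqP; rewrite eq_complex /= oppr0 !eqxx.
move=> E; apply: nm0_eq0; apply/eqP; rewrite eq_le nm_ge0 andbT.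
by rewrite -(pmulr_rle0 _ c0); apply: le_trans (hc _ dx) _; rewrite E subrr nm0.
Qed.

Lemma nonreal_kernel (z : R[i]) x : complex.Im z != 0 -> dom A x ->
  A x = z *: x -> x = 0.
Proof.
move=> z0 dx E; apply: nm0_eq0; apply/eqP; rewrite eq_le nm_ge0 andbT.
have := nonreal_bound z dx; rewrite E subrr nm0 pmulr_rle0 // normr_gt0 //.
Qed.

Lemma nonreal_resolvent (z : R[i]) : complex.Im z != 0 -> resolvent_set A z.
Proof.
move=> z0; apply: (@sa_resolvent z `|complex.Im z|); first by rewrite normr_gt0.
  exact: nonreal_bound.
move=> x; apply: nonreal_kernel; case: z z0 => a b /=; by rewrite oppr_eq0.
Qed.

Lemma resolvent_bound (z : R[i]) : resolvent_set A z ->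
  exists2 c : R, 0 < c & forall x, dom A x -> c * nm x <= nm (A x - z *: x).
Proof.
case=> S [[M hM] h1 _].
have M0 : 0 < `|M| + 1 by rewrite ltr_wpDl.
exists (`|M| + 1)^-1; first by rewrite invr_gt0.
move=> x dx; rewrite -{1}(h1 x dx) mulrC ler_pdivrMr // mulrC.
have := hM (A x - z *: x); rewrite !nmE -rmorphM lecR => /le_trans; apply.
by rewrite ler_wpM2r ?nm_ge0 // (le_trans (ler_norm _)) // lerDl.
Qed.

End SA.
End SelfAdjoint.

(** * Spectral splitting at a gap *)

Section Gap.
Context {R : realType} {H : completeNormedModType R[i]}.
Variable (dot : {dot H for Num.conj}).
Hypothesis hdot : hilbert_dot dot.
Local Notation ip := (rdot dot).
Local Notation nm := (@vnorm R H).
Implicit Types (x y z : H) (A : unbounded_op H).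

(** The infimum of the bounds is itself a bound, so an argument that improves
    every bound applies to it. *)
Lemma best_bound (V : set H) (f : H -> H) (M : R) : 0 <= M ->
  (forall x, V x -> nm (f x) <= M * nm x) ->
  exists k : R, [/\ 0 <= k, forall x, V x -> nm (f x) <= k * nm x &
    forall k' : R, 0 <= k' -> (forall x, V x -> nm (f x) <= k' * nm x) -> k <= k'].
Proof.
move=> M0 hM.
pose S := [set k : R | 0 <= k /\ forall x, V x -> nm (f x) <= k * nm x].
have SM : S M by [].
have hS : has_inf S by split; [exists M|exists 0 => k []].
exists (inf S); split.
- by apply: lb_le_inf; [exists M|move=> k []].
- move=> x Vx; apply/ler_addgt0Pr => e e0.
  have K0 : 0 < nm x + 1 by rewrite ltr_wpDl ?nm_ge0.
  have [k [_ hk] lt] := inf_adherent (divr_gt0 e0 K0) hS.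
  have := hk _ Vx.
  have eE : e / (nm x + 1) * (nm x + 1) = e by rewrite divfK ?gt_eqF.
  have q0 : 0 <= e / (nm x + 1) by rewrite ltW // divr_gt0.
  move: lt eE q0; set q := e / _ => lt eE q0 h.
  by have := nm_ge0 x; nra.
- by move=> k' k0 hk; apply: ge_inf; [exact: hS.2|].
Qed.

(** This is [M^2 <= m M], obtained by evaluating the nonnegative form at
    [x - M x / m]. *)
Lemma pos_form_sq (V : set H) (M : H -> H) (m : R) : 0 < m -> lin_subspace V ->
  (forall (a : R[i]) x y, V x -> V y -> M (a *: x + y) = a *: M x + M y) ->
  (forall x y, V x -> V y -> ip (M x) y = ip x (M y)) ->
  (forall x, V x -> V (M x)) ->
  (forall x, V x -> 0 <= ip x (M x)) ->
  (forall x, V x -> ip x (M x) <= m * nm x ^+ 2) ->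
  forall x, V x -> nm (M x) ^+ 2 <= m * ip x (M x).
Proof.
move=> m0 sV lM sM VM M0 Mm x Vx.
pose t := (- m^-1)%:C : R[i].
have Vy : V (t *: M x + x) by apply: sV.2 => //; exact: VM.
have := M0 _ Vy; rewrite (lM _ _ _ (VM _ Vx) Vx) /t !(ipDl, ipDr, ipZl, ipZr).
rewrite -(sM _ _ Vx (VM _ Vx)) -!(nm2 hdot) => h.
have := Mm _ (VM _ Vx); move=> h2.
have tm : m^-1 * m = 1 by rewrite mulVf ?gt_eqF.
have i0 : 0 < m^-1 by rewrite invr_gt0.
move: h h2; rewrite -(sM _ _ (VM _ Vx) (VM _ Vx)) (ipC dot (M (M x))).
set q := ip (M x) _; set p := ip x _; set n := nm (M x) ^+ 2 => h h2.
have h3 : m^-1 * q <= n by rewrite mulrC ler_pdivrMr // mulrC.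
have h4 : m^-1 * (m^-1 * q) <= m^-1 * n by rewrite ler_wpM2l // ltW.
have h5 : m^-1 * n <= p by move: h h4; lra.
by rewrite mulrC -ler_pdivrMr // mulrC.
Qed.

Lemma everywhere_sa (T : H -> H) : linear T -> ip_sym dot T ->
  self_adjoint dot (UnboundedOp setT T).
Proof.
move=> lT sT; split; [split=> //= a x y _ _; exact: lT| |].
  by move=> O [x Ox] _; exists x.
move=> y z; split => /= [h|[_ <-] x _]; last by rewrite (symmetric_opP dot lT).2.
split => //; apply/eqP; rewrite -subr_eq0; apply/eqP/(ip_eq0 hdot) => x.
rewrite ipC ipBr -sT.
by have := congr1 (@complex.Re R) (h x I); rewrite -!/(rdot dot _ _) => ->; rewrite subrr.
Qed.

Section Split.
Variable A : unbounded_op H.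
Hypothesis sA : self_adjoint dot A.
Variable d : R.
Hypothesis d0 : 0 < d.

(** The inverse [r] of [A] is symmetric, and if [rho] is its norm then
    [rho^2 - r^2 = rho^2 (1 - r/rho)(1 + r/rho)] is not bounded below, so that
    one of [1/rho], [-1/rho] lies in the spectrum of [A]. *)
Lemma gap_bound : resolvent_set A 0 ->
  (forall s : R, spectrum A s%:C -> d <= `|s|) ->
  forall x, dom A x -> d * nm x <= nm (A x).
Proof.
move=> [r [[M hM] rA Ar]] hd.
have {hM} bM x : setT x -> nm (r x) <= `|M| * nm x.
  move=> _; have := hM x; rewrite !nmE -rmorphM lecR => /le_trans; apply.
  by rewrite ler_wpM2r ?nm_ge0 // ler_norm.
have {}rA x : dom A x -> r (A x) = x by move=> /rA; rewrite scale0r subr0.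
have {Ar} [dr Ar] : (forall x, dom A (r x)) /\ forall x, A (r x) = x.
  by split=> x; case: (Ar x) => // _; rewrite scale0r subr0.
have [rho [rho0 hrho best]] := best_bound (normr_ge0 M) bM.
suff rd : rho * d <= 1.
  move=> x dx; have h := hrho (A x) I; rewrite (rA x dx) in h.
  have d1 := ltW d0; apply: le_trans (ler_wpM2l d1 h) _.
  by rewrite mulrA (mulrC d) ler_piMl ?nm_ge0.
rewrite leNgt; apply/negP => rd.
have {}rho0 : 0 < rho by rewrite -(pmulr_lgt0 _ d0); exact: lt_trans ltr01 rd.
pose a : R := rho^-1.
have a0 : 0 < a by rewrite invr_gt0.
have ar : a * rho = 1 by rewrite mulVf ?gt_eqF.
have ad : a < d by rewrite -(ltr_pM2l rho0) mulrC ar.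
have res (s : R) : `|s| = a -> resolvent_set A s%:C.
  move=> sa; apply: contrapT => h; have := hd s h; rewrite sa; lra.
have [c1 c10 hc1] := resolvent_bound (res a (gtr0_norm a0)).
have [c2 c20 hc2] : exists2 c : R, 0 < c & forall x, dom A x -> c * nm x <= nm (A x - (- a)%:C *: x).
  by apply: resolvent_bound; apply: res; rewrite normrN gtr0_norm.
pose c : R := Num.min c1 c2.
have c0 : 0 < c by rewrite lt_min c10 c20.
have k1 y : c * nm (r y) <= nm (y - a%:C *: r y).
  have := hc1 _ (dr y); rewrite Ar; apply: le_trans.
  by rewrite ler_wpM2r ?nm_ge0 // ge_min lexx.
have k2 y : c * nm (r y) <= nm (y + a%:C *: r y).
  have := hc2 _ (dr y); rewrite Ar rmorphN scaleNr opprK; apply: le_trans.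
  by rewrite ler_wpM2r ?nm_ge0 // ge_min lexx orbT.
have key y : c ^+ 2 * nm (r (r y)) <= nm (y - (a ^+ 2)%:C *: r (r y)).
  have h1 := k1 (y + a%:C *: r y); have h2 := k2 (r y).
  rewrite linearD linearZ /= in h1.
  have E : y + a%:C *: r y - a%:C *: (r y + a%:C *: r (r y)) = y - (a ^+ 2)%:C *: r (r y).
    by rewrite scalerDr opprD addrA addrK scalerA -rmorphM expr2.
  by rewrite E in h1; apply: le_trans h1; rewrite expr2 -mulrA ler_wpM2l // ltW.
have sr x y : ip (r x) y = ip x (r y) by rewrite -[y in LHS]Ar -sa_ip ?Ar.
(* The ratio [t] of [||r y||^2] to [rho^2 ||y||^2] satisfies [k t^2 <= 1 - t],
   so that [t] is at most [th < 1]. *)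
pose k : R := (c ^+ 2) ^+ 2 * (rho ^+ 2) ^+ 2.
have k0 : 0 < k by rewrite mulr_gt0 ?exprn_gt0.
pose th : R := Num.max (2^-1) (1 - k / 4).
have th0 : 0 < th by rewrite lt_max invr_gt0 ltr0n.
have th1 : th < 1 by rewrite gt_max; apply/andP; split; lra.
have sq y : nm (r y) ^+ 2 <= rho ^+ 2 * th * nm y ^+ 2.
  have [->|y0] := eqVneq y 0; first by rewrite linear0 nm0 expr0n /= mulr0.
  have n0 : 0 < nm y ^+ 2 by rewrite exprn_gt0 // nm_gt0.
  have h1 : (c ^+ 2 * nm (r (r y))) ^+ 2 <= nm (y - (a ^+ 2)%:C *: r (r y)) ^+ 2.
    by rewrite ler_pXn2r ?nnegrE ?nm_ge0 // mulr_ge0 ?nm_ge0 // sqr_ge0.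
  rewrite (sqnmB hdot) ipZr -sr -(nm2 hdot) nmZ ger0_norm ?sqr_ge0 // in h1.
  have h2 : nm (r (r y)) ^+ 2 <= (rho * nm (r y)) ^+ 2.
    have hr := hrho (r y) I; rewrite ler_pXn2r ?nnegrE ?nm_ge0 //.
    by rewrite mulr_ge0 ?nm_ge0 // ltW.
  have h3 : (nm (r y) ^+ 2) ^+ 2 <= (nm y * nm (r (r y))) ^+ 2.
    rewrite ler_pXn2r ?nnegrE ?mulr_ge0 ?nm_ge0 ?sqr_ge0 //.
    by rewrite [leLHS](nm2 hdot) sr ip_le_nm.
  pose t : R := a ^+ 2 * nm (r y) ^+ 2 / nm y ^+ 2.
  have tE : nm (r y) ^+ 2 = rho ^+ 2 * t * nm y ^+ 2.
    have ar2 : rho ^+ 2 * a ^+ 2 = 1 by rewrite -exprMn mulrC ar expr1n.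
    by rewrite /t -(mulrA (rho ^+ 2)) divfK ?gt_eqF // mulrA ar2 mul1r.
  rewrite tE -(mulrA (rho ^+ 2) t) -(mulrA (rho ^+ 2) th); apply: ler_wpM2l; first exact: sqr_ge0.
  apply: ler_wpM2r; first exact: sqr_ge0.
  have t0 : 0 <= t by apply: divr_ge0; [apply: mulr_ge0|]; exact: sqr_ge0.
  have main : k * t ^+ 2 <= 1 - t.
    have ar2 : a ^+ 2 * rho ^+ 2 = 1 by rewrite -exprMn ar expr1n.
    clearbody t; move: h1 h2 h3.
    rewrite (exprMn 2 (c ^+ 2)) (exprMn 2 (a ^+ 2)) (exprMn 2 rho) (exprMn 2 (nm y)) tE /k.
    move: (nm (r (r y)) ^+ 2) (nm y ^+ 2) n0 (c ^+ 2) (a ^+ 2) (rho ^+ 2) ar2 (sqr_ge0 a) (sqr_ge0 c).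
    clear => v n n0 C a2 Q aq1 a2p C0 h1 h2 h3.
    have h4 : a2 ^+ 2 * v <= t * n.
      have : a2 ^+ 2 * v <= a2 ^+ 2 * (Q * (Q * t * n)) by apply: ler_wpM2l => //; exact: sqr_ge0.
      by rewrite (_ : a2 ^+ 2 * (Q * (Q * t * n)) = (a2 * Q) ^+ 2 * (t * n)); [rewrite aq1 expr1n mul1r|ring].
    have h5 : C ^+ 2 * v <= n - t * n.
      have E : a2 * (Q * t * n) = t * n by rewrite !mulrA aq1 mul1r.
      by rewrite E in h1; lra.
    have h6 : C ^+ 2 * (Q ^+ 2 * t ^+ 2 * n ^+ 2) <= C ^+ 2 * (n * v) by apply: ler_wpM2l; [exact: sqr_ge0|lra].
    have h7 : n * (C ^+ 2 * v) <= n * (n - t * n) by apply: ler_wpM2l => //; exact: ltW.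
    rewrite -(ler_pM2l n0) -(ler_pM2l n0); move: h6 h7; nra.
  rewrite le_max; have [t2|t2] := leP t 2^-1; [by []|apply/orP; right].
  have : k * (1 / 4) <= k * t ^+ 2 by rewrite ler_wpM2l ?ltW //; nra.
  lra.
have lt : rho * Num.sqrt th < rho.
  rewrite -[ltRHS]mulr1 ltr_pM2l // -sqrtr1 ltr_sqrt //.
suff : rho <= rho * Num.sqrt th by lra.
apply: best => [|x _]; first by rewrite mulr_ge0 ?sqrtr_ge0 ?ltW.
apply: nm_le_sq; first by rewrite !mulr_ge0 ?sqrtr_ge0 ?nm_ge0 ?ltW.
by rewrite !exprMn sqr_sqrtr ?sq // ltW.
Qed.

Hypothesis gap : forall x, dom A x -> d * nm x <= nm (A x).

Lemma inverse_exists : exists r : H -> H,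
  [/\ linear r, ip_sym dot r, forall x, dom A (r x),
      forall x, A (r x) = x & forall x, dom A x -> r (A x) = x].
Proof.
have h0 x : dom A x -> d * nm x <= nm (A x - 0%:C *: x) by rewrite scale0r subr0; exact: gap.
have [r [_ rA Ar]] := real_resolvent hdot sA d0 h0.
have dr x : dom A (r x) by case: (Ar x).
have {}Ar x : A (r x) = x by case: (Ar x) => _; rewrite scale0r subr0.
exists r; split => //.
- by move=> a x y; rewrite linearP.
- by move=> x y; rewrite -[y in LHS]Ar -(sa_ip sA) ?Ar.
- by move=> x dx; have := rA x dx; rewrite scale0r subr0.
Qed.

(** The sign splitting of the inverse of [A]; the gap comes from
    [r^2 <= |r| / d] for the inverse [r]. *)
Lemma gap_splitting : exists P : H -> H,
  [/\ orthogonal_projection dot P, reduces P A,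
      forall x, dom A x -> P x = x -> d * nm x ^+ 2 <= ip x (A x) &
      forall x, dom A x -> P x = 0 -> ip x (A x) <= - (d * nm x ^+ 2)].
Proof.
have [r [lr sr dr Ar rA]] := inverse_exists.
pose q x := d%:C *: r x.
have lq : linear q.
  by move=> a x y; rewrite /q lr scalerDr !scalerA mulrC.
have sq : ip_sym dot q by move=> x y; rewrite /q ipZl ipZr sr.
have cq x : nm (q x) <= nm x.
  by rewrite /q nmZ gtr0_norm //; have := gap (dr x); rewrite Ar.
have [P [oP Pq posP negP]] := sign_splitting hdot lq sq cq.
have [lP idP _] := oP.
have Pr x : P (r x) = r (P x).
  have := Pq x; rewrite /q linZ // => /(congr1 (fun v => (d^-1)%:C *: v)).
  by rewrite !scalerA -rmorphM mulVf ?gt_eqF // !scale1r.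
have red : reduces P A.
  by move=> x dx; rewrite -{1 2}(rA x dx) Pr Ar; split=> //; exact: dr.
have form x : nm (q x) <= nm x -> ip x (q x) <= 1 * nm x ^+ 2.
  move=> h; rewrite mul1r; apply: le_trans (ip_le_nm hdot _ _) _.
  by rewrite expr2 ler_wpM2l ?nm_ge0.
have main (s : R) (V : set H) : s ^+ 2 = 1 -> lin_subspace V -> (forall x, V x -> V (r x)) ->
    (forall x, V x -> 0 <= s * ip x (q x)) ->
    forall x, V x -> d * nm (r x) ^+ 2 <= s * ip x (r x).
  move=> s2 sV Vr Vpos x Vx.
  have s1 : `|s| = 1 by apply/eqP; rewrite -sqrp_eq1 ?normr_ge0 // real_normK ?num_real // s2.
  have : nm (s%:C *: q x) ^+ 2 <= 1 * ip x (s%:C *: q x).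
    apply: (@pos_form_sq V (fun x => s%:C *: q x) 1 ltr01 sV _ _ _ _ _ x Vx).
    - by move=> a u v _ _; rewrite (lq a u v) scalerDr !scalerA (mulrC a).
    - by move=> u v _ _; rewrite ipZl ipZr sq.
    - by move=> u Vu; do 2! apply: lin_subspaceZ => //; exact: Vr.
    - by move=> u Vu; rewrite ipZr; exact: Vpos.
    - move=> u Vu; rewrite mul1r; apply: le_trans (ip_le_nm hdot _ _) _.
      by rewrite nmZ s1 mul1r expr2 ler_wpM2l ?nm_ge0.
  rewrite nmZ s1 !mul1r ipZr /q nmZ gtr0_norm // ipZr exprMn => h.
  by rewrite -(ler_pM2l d0); move: h; set p := ip x _; set n := nm _ ^+ 2; lra.
have VP : lin_subspace [set x | P x = x].
  by split => /= [|a x y xE yE]; [exact: lin0|rewrite lP xE yE].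
have VK : lin_subspace [set x | P x = 0].
  by split => /= [|a x y xE yE]; [exact: lin0|rewrite lP xE yE scaler0 addr0].
exists P; split => // x dx Px.
- have := main 1 _ (expr1n _ _) VP _ _ (A x).
  rewrite /= rA // mul1r (ipC dot (A x)); apply.
  + by move=> y yE; rewrite Pr yE.
  + by move=> y /posP; rewrite mul1r.
  + by have [_ <-] := red _ dx; rewrite Px.
- have s2 : (-1 : R) ^+ 2 = 1 by rewrite sqrrN expr1n.
  have := main (-1) _ s2 VK _ _ (A x).
  rewrite /= rA // mulN1r (ipC dot (A x)) => h; rewrite lerNr; apply: h.
  + by move=> y yE; rewrite Pr yE (lin0 lr).
  + by move=> y /negP; rewrite mulN1r oppr_ge0.
  + by have [_ <-] := red _ dx; rewrite Px (op0 (sa_lin sA)).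
Qed.

End Split.
End Gap.

(** * A pair of operators with a common gap *)

Section Pair.
Context {R : realType} {H : completeNormedModType R[i]}.
Variable (dot : {dot H for Num.conj}).
Hypothesis hdot : hilbert_dot dot.
Local Notation ip := (rdot dot).
Local Notation nm := (@vnorm R H).
Implicit Types (x y z : H) (A : unbounded_op H).

Lemma proj_pyth P x : orthogonal_projection dot P ->
  nm x ^+ 2 = nm (P x) ^+ 2 + nm (x - P x) ^+ 2.
Proof.
move=> oP; have [lP idP _] := oP.
have E : x = P x + (x - P x) by rewrite addrC subrK.
have E0 : ip (P x) (x - P x) = 0.
  by apply: (proj_orth oP (idP x)); rewrite linB // idP subrr.
by rewrite {1}E (sqnmD hdot) E0 mulr0 addr0.
Qed.

Lemma proj_le P x : orthogonal_projection dot P -> nm (P x) <= nm x.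
Proof.
move=> oP; apply: nm_le_sq; first exact: nm_ge0.
by rewrite (proj_pyth x oP) lerDl sqr_ge0.
Qed.

Lemma proj_compl0 P x : orthogonal_projection dot P -> P (x - P x) = 0.
Proof. by case=> lP idP _; rewrite linB // idP subrr. Qed.

Lemma proj_ip P x y : orthogonal_projection dot P -> ip (P x) y = ip x (P y).
Proof. by case=> lP _ /(symmetric_opP dot lP). Qed.

Lemma proj_ran_sub P : orthogonal_projection dot P -> lin_subspace [set x | P x = x].
Proof. by case=> lP _ _; split => /= [|a x y xE yE]; [exact: lin0|rewrite lP xE yE]. Qed.

Lemma ip_ext x y : (forall z, ip x z = ip y z) -> x = y.
Proof.
by move=> h; apply/eqP; rewrite -subr_eq0; apply/eqP/(ip_eq0 hdot) => z; rewrite ipBl h subrr.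
Qed.

Variables S T : unbounded_op H.
Variable D : H -> H.
Hypothesis sS : self_adjoint dot S.
Hypothesis sT : self_adjoint dot T.
Hypothesis lD : linear D.
Hypothesis domTS : dom T = dom S.
Hypothesis TE : forall x, dom S x -> T x = S x + D x.
Variables b d : R.
Hypothesis b0 : 0 <= b.
Hypothesis bD : forall x, nm (D x) <= b * nm x.
Hypothesis d0 : 0 < d.
Variable p : H -> H.
Hypothesis op : orthogonal_projection dot p.
Hypothesis redp : reduces p S.

Section Angle.
Hypothesis gapS : forall x, dom S x -> d * nm x <= nm (S x).
Hypothesis negp : forall x, dom S x -> p x = x -> ip x (S x) <= - (d * nm x ^+ 2).

(** [S - n p] is bounded below because [S] is negative on the range of [p]. *)
Lemma shifted_solve (n : R) x : 0 < n -> p x = x ->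
  exists a, [/\ dom S a, p a = a, n%:C *: a - S a = n%:C *: x
                & (n + d) * nm a <= n * nm x].
Proof.
move=> n0 px; have [lp idp _] := op.
have lN : linear (fun x => (- n)%:C *: p x).
  by move=> a u v; rewrite lp scalerDr !scalerA (mulrC a).
have sN : ip_sym dot (fun x => (- n)%:C *: p x).
  by move=> u v; rewrite ipZl ipZr (proj_ip _ _ op).
have sS' := perturb_sa sS lN sN.
have low v : dom S v -> d * nm v <= nm (S v + (- n)%:C *: p v - 0%:C *: v).
  move=> dv; rewrite scale0r subr0.
  have [dpv Spv] := redp dv.
  have dqv := lin_subspaceB (sa_sub sS) dv dpv.
  have h1 := gapS dpv; have h2 := gapS dqv; have h3 := negp dpv (idp v).
  rewrite -(ler_pXn2r (n := 2)) ?nnegrE ?nm_ge0 //; last by rewrite mulr_ge0 ?nm_ge0 // ltW.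
  set w := S v + _.
  have pw : p w = S (p v) + (- n)%:C *: p v by rewrite linD // linZ // idp Spv.
  have qw : w - p w = S (v - p v).
    by rewrite pw (op_sub (sa_lin sS)) // /w opprD addrACA subrr addr0.
  rewrite (proj_pyth w op) qw pw exprMn (proj_pyth v op) mulrDr; apply: lerD; last first.
    by rewrite -exprMn ler_pXn2r ?nnegrE ?mulr_ge0 ?nm_ge0 // ltW.
  have h4 : d ^+ 2 * nm (p v) ^+ 2 <= nm (S (p v)) ^+ 2.
    by rewrite -exprMn ler_pXn2r ?nnegrE ?mulr_ge0 ?nm_ge0 // ltW.
  apply: le_trans h4 _; rewrite (sqnmD hdot) ipZr (ipC dot (S _)).
  have h5 : 0 <= d * nm (p v) ^+ 2 by rewrite mulr_ge0 ?sqr_ge0 // ltW.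
  have h6 : 0 <= nm ((- n)%:C *: p v) ^+ 2 by exact: sqr_ge0.
  have h7 : 0 <= - n * ip (p v) (S (p v)) by move: h3 h5; nra.
  lra.
have [r [_ _ Ar]] := real_resolvent hdot sS' d0 low.
have [/= da] := Ar ((- n)%:C *: x); set a := r _ in da *.
rewrite scale0r subr0 => E.
have [dpa Spa] := redp da.
have dqa := lin_subspaceB (sa_sub sS) da dpa.
have pa : p a = a.
  apply/esym/eqP; rewrite -subr_eq0; apply/eqP/nm0_eq0/eqP.
  rewrite eq_le nm_ge0 andbT -(pmulr_rle0 _ d0); apply: le_trans (gapS dqa) _.
  rewrite (op_sub (sa_lin sS)) // Spa.
  have := congr1 p E; rewrite (linD lp) !(linZ lp) idp px -E => /eqP.
  by rewrite (inj_eq (addIr _)) => /eqP ->; rewrite subrr nm0.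
have E2 : n%:C *: a - S a = n%:C *: x.
  move/(congr1 (fun v => - v)) : E; rewrite pa opprD rmorphN !scaleNr !opprK => <-.
  by rewrite addrC.
exists a; split => //.
have h1 := negp da pa.
have h2 : ip a (n%:C *: a - S a) <= n * (nm a * nm x).
  by rewrite E2 ipZr; apply: ler_wpM2l; [exact: ltW|exact: ip_le_nm].
rewrite ipBr ipZr -(nm2 hdot) in h2.
have [a0|a0] := eqVneq (nm a) 0.
  by rewrite a0 mulr0 mulr_ge0 ?nm_ge0 // ltW.
have a1 : 0 < nm a by rewrite lt_neqAle eq_sym a0 nm_ge0.
by rewrite -(ler_pM2l a1); move: h1 h2; lra.
Qed.

(** The operator [X = q p] solves [T X - X S = q D p].  Writing this as
    [X (n - S) = (n - T) X + q D p] with [n] above the spectrum of [T] on the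
    range of [q], the norms of [(n - S)^-1] and [n - T] are at most
    [1 / (n + d)] and [n - delta], which bounds [X]. *)
Lemma davis_kahan (q : H -> H) (delta n : R) :
  orthogonal_projection dot q -> reduces q T ->
  0 < delta -> delta < n -> (forall x, q x = x -> dom T x) ->
  (forall x, q x = x -> delta * nm x ^+ 2 <= ip x (T x) <= n * nm x ^+ 2) ->
  forall x, p x = x -> (d + delta) * nm (q x) <= b * nm x.
Proof.
move=> oq redq e0 en domq formq.
have n0 : 0 < n by exact: lt_trans en.
have [lq idq _] := oq.
have bq x : p x = x -> nm (q x) <= 1 * nm x by move=> _; rewrite mul1r proj_le.
have [k [k0 hk best]] := best_bound ler01 bq.
have shrink y : q y = y -> nm (n%:C *: y - T y) <= (n - delta) * nm y.
  move=> qy; have m0 : 0 < n - delta by rewrite subr_gt0.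
  have fm u : q u = u -> 0 <= ip u (n%:C *: u - T u) <= (n - delta) * nm u ^+ 2.
    by move=> /formq /andP[h1 h2]; rewrite ipBr ipZr -(nm2 hdot); apply/andP; split; lra.
  apply: nm_le_sq; first by rewrite mulr_ge0 ?nm_ge0 // ltW.
  have : nm (n%:C *: y - T y) ^+ 2 <= (n - delta) * ip y (n%:C *: y - T y).
    apply: (@pos_form_sq _ _ _ hdot [set u | q u = u] (fun u => n%:C *: u - T u) (n - delta)) => //=.
    - exact: proj_ran_sub.
    - move=> a u v qu qv; rewrite (op_linear (sa_lin sT)); [|exact: domq|exact: domq].
      by rewrite !scalerDr scalerN opprD addrACA !scalerA (mulrC a).
    - move=> u v qu qv; rewrite ipBl ipBr ipZl ipZr (sa_ip sT) //; exact: domq.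
    - by move=> u qu; rewrite linB // linZ // -(redq _ (domq _ qu)).2 !qu.
    - by move=> u /fm /andP[].
    - by move=> u /fm /andP[].
  move=> /le_trans; apply; rewrite exprMn [(n - delta) ^+ 2]expr2 -mulrA.
  by rewrite ler_wpM2l ?(ltW m0) //; case/andP: (fm _ qy).
(* With the bound [k] on the right of the equation for [X], this is a new bound. *)
have step x : p x = x -> nm (q x) <= ((n - delta) * k + b) / (n + d) * nm x.
  move=> px; have [a [da pa Ea ba]] := shifted_solve n0 px.
  have da' : dom T a by rewrite domTS.
  have [dqa Tqa] := redq _ da'.
  have E : n%:C *: q x = (n%:C *: q a - T (q a)) + q (D a).
    rewrite -linZ // -Ea linB // linZ // Tqa TE // linD //.
    by rewrite opprD addrA subrK.
  have h1 := shrink _ (idq a).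
  have h2 := hk _ pa.
  have h3 : nm (q (D a)) <= b * nm a by apply: le_trans (proj_le _ oq) (bD a).
  have h4 : n * nm (q x) <= nm (n%:C *: q a - T (q a)) + nm (q (D a)).
    by rewrite -{1}(gtr0_norm n0) -nmZ E nmD.
  have h5 : (n - delta) * nm (q a) <= (n - delta) * (k * nm a).
    by rewrite ler_wpM2l // subr_ge0 ltW.
  have nd0 : 0 < n + d by rewrite addr_gt0.
  rewrite mulrAC ler_pdivlMr // mulrC.
  have K0 : 0 <= (n - delta) * k + b by rewrite addr_ge0 // mulr_ge0 // subr_ge0 ltW.
  have h6 : ((n - delta) * k + b) * ((n + d) * nm a) <= ((n - delta) * k + b) * (n * nm x).
    by rewrite ler_wpM2l.
  have h7 : n * nm (q x) <= ((n - delta) * k + b) * nm a by move: h1 h3 h4 h5; lra.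
  have h8 : (n + d) * (n * nm (q x)) <= (n + d) * (((n - delta) * k + b) * nm a).
    by rewrite ler_wpM2l // ltW.
  rewrite -(ler_pM2l n0); move: h6 h8; lra.
have nd0 : 0 < n + d by rewrite addr_gt0.
have kb : k * (d + delta) <= b.
  have : k <= ((n - delta) * k + b) / (n + d).
    apply: best step; rewrite divr_ge0 ?(ltW nd0) // addr_ge0 // mulr_ge0 // subr_ge0 ltW //.
  rewrite ler_pdivlMr //; lra.
move=> x /hk h; have := nm_ge0 x; move: kb h; move: (nm x) (nm (q x)) => X Y kb h X0.
have : (d + delta) * Y <= (d + delta) * (k * X) by rewrite ler_wpM2l // addr_ge0 ?ltW.
have : (k * (d + delta)) * X <= b * X by rewrite ler_wpM2r.
lra.
Qed.

End Angle.

Variable P : H -> H.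
Hypothesis oP : orthogonal_projection dot P.
Hypothesis redP : reduces P T.
Variable c : R.
Hypothesis c0 : 0 <= c.
Hypothesis c1 : c < 1.
Hypothesis angle : forall x, p x = x -> nm (x - P x) <= c * nm x.
Hypothesis angle' : forall x, p x = 0 -> nm (P x) <= c * nm x.

Let c2 : 0 < 1 - c ^+ 2.
Proof. by rewrite subr_gt0 expr_lt1. Qed.

(** The compression of [P] to the range of [p] is bounded below, hence invertible;
    [u] is the image under [P] of the preimage of [p y]. *)
Lemma oblique_decomposition y : exists2 u, P u = u & p (y - u) = 0.
Proof.
have [[lP idP _] [lp idp _]] := (oP, op).
pose K x := p (P (p x)) + (x - p x).
have lK : linear K.
  move=> a u v; rewrite /K lp lP lp scalerDr [RHS]addrACA; congr (_ + _).
  by rewrite scalerBr opprD addrACA.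
have sK : ip_sym dot K.
  move=> u v; rewrite /K ipDl ipDr ipBl ipBr !(proj_ip _ _ op) (proj_ip _ _ oP).
  by rewrite (proj_ip _ _ op).
have low x : setT x -> (1 - c ^+ 2) * nm x <= nm (K x - 0%:C *: x).
  move=> _; rewrite scale0r subr0.
  have [-> | x0] := eqVneq (nm x) 0; first by rewrite mulr0 nm_ge0.
  have x1 : 0 < nm x by rewrite lt_neqAle eq_sym x0 nm_ge0.
  rewrite -(ler_pM2l x1); apply: le_trans (ip_le_nm hdot _ _).
  rewrite /K ipDr -(proj_ip _ _ op) -{1}(idP (p x)) -(proj_ip _ _ oP) -(nm2 hdot).
  have -> : ip x (x - p x) = nm (x - p x) ^+ 2.
    rewrite (nm2 hdot) ipBl [ip (p x) _](proj_orth op) ?subr0 //.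
    exact: proj_compl0.
  have h1 := proj_pyth x op; have h2 := proj_pyth (p x) oP.
  have h3 : nm (p x - P (p x)) ^+ 2 <= c ^+ 2 * nm (p x) ^+ 2.
    rewrite -exprMn ler_pXn2r ?nnegrE ?mulr_ge0 ?nm_ge0 //; exact: angle.
  have h4 := sqr_ge0 (nm (x - p x)); have h5 := sqr_ge0 c.
  have h6 : 0 <= c ^+ 2 * nm (x - p x) ^+ 2 by rewrite mulr_ge0.
  rewrite mulrCA -expr2 h1; lra.
have [r [_ _ Ar]] := real_resolvent hdot (everywhere_sa hdot lK sK) c2 low.
have [_ /=] := Ar (p y); set x := r _; rewrite scale0r subr0 => E.
exists (P (p x)) => //.
have := congr1 p E; rewrite /K linD // !idp (proj_compl0 _ op) addr0 => E'.
by rewrite linB // E' subrr.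
Qed.

(** The bound [angle'] is transposed: [||u - p u||^2 = <u, P (u - p u)>]. *)
Lemma oblique_bound u : P u = u -> (1 - c ^+ 2) * nm u ^+ 2 <= nm (p u) ^+ 2.
Proof.
move=> Pu; have h1 := proj_pyth u op.
have h2 : nm (u - p u) <= c * nm u.
  have [-> | v0] := eqVneq (nm (u - p u)) 0; first by rewrite mulr_ge0 ?nm_ge0.
  have v1 : 0 < nm (u - p u) by rewrite lt_neqAle eq_sym v0 nm_ge0.
  have E : nm (u - p u) ^+ 2 = ip u (P (u - p u)).
    rewrite -(proj_ip _ _ oP) Pu (nm2 hdot) ipBl [ip (p u) _](proj_orth op) ?subr0 //.
      by case: op.
    exact: proj_compl0.
  rewrite -(ler_pM2l v1) -expr2 E; apply: le_trans (ip_le_nm hdot _ _) _.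
  rewrite mulrC mulrA mulrC (mulrC _ c).
  rewrite mulrC; apply: ler_wpM2r; first exact: nm_ge0.
  by apply: angle'; exact: proj_compl0.
have : nm (u - p u) ^+ 2 <= (c * nm u) ^+ 2.
  by rewrite ler_pXn2r ?nnegrE ?mulr_ge0 ?nm_ge0.
rewrite exprMn; lra.
Qed.

Lemma oblique_norm_bound u : P u = u -> (1 - c ^+ 2) * nm u <= nm (p u).
Proof.
move=> /oblique_bound h; have k0 := ltW c2.
rewrite -(ler_pXn2r (n := 2)) ?nnegrE ?mulr_ge0 ?nm_ge0 //; apply: le_trans h.
rewrite exprMn; apply: ler_wpM2r; first exact: sqr_ge0.
by rewrite expr2 ler_piMl // lerBlDr lerDl sqr_ge0.
Qed.

Lemma imaginary_solve (A : unbounded_op H) (t : R) y : self_adjoint dot A -> t != 0 ->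
  exists x, dom A x /\ A x - (t *i) *: x = y.
Proof.
move=> sA t0; apply: (sa_surj hdot sA (c := `|t|)); first by rewrite normr_gt0.
  by move=> x dx; have := nonreal_bound hdot sA (t *i) dx.
move=> x; apply: (nonreal_kernel hdot sA) => /=.
by rewrite oppr_eq0.
Qed.

(** Let [L] act as [T] on the range of [P] and as [S] on the kernel of [p].
    On the sum of these two pieces of the domain, [L] is [S] plus the bounded
    operator [D] composed with the oblique projection.  Both have the points
    [i t] with [t] large in their resolvent sets, hence the same domain. *)
Lemma oblique_domain y u : dom S y -> P u = u -> p (y - u) = 0 -> dom S u.
Proof.
move=> dy Pu pv; have [[lP idP _] [lp idp _]] := (oP, op).
(* [b / (1 - c^2)] bounds the norm of [D] composed with the oblique projection. *)
have t0 : 0 < b / (1 - c ^+ 2) + 1 by rewrite ltr_wpDl // divr_ge0 // ltW.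
set t := _ + 1 in t0.
have tn : t != 0 by rewrite gt_eqF.
have In : complex.Im (t *i) != 0 by [].
have [u' Pu' pv'] := oblique_decomposition (S y - (t *i) *: y + D u).
set z0 := S y - _ + _ in pv'.
have [u0 [du0 E1]] := imaginary_solve u' sT tn.
have [v0 [dv0 E2]] := imaginary_solve (z0 - u') sS tn.
have Pu0 : P u0 = u0.
  have [dPu0 TPu0] := redP du0.
  have dq := lin_subspaceB (sa_sub sT) du0 dPu0.
  apply/esym/eqP; rewrite -subr_eq0; apply/eqP.
  apply: (nonreal_kernel hdot sT In dq).
  have := congr1 P E1; rewrite (linB lP) (linZ lP) Pu' -TPu0 -E1.
  rewrite (op_sub (sa_lin sT)) // scalerBr => h; apply/eqP; rewrite -subr_eq0; apply/eqP.
  have : T u0 - (t *i) *: u0 - (T (P u0) - (t *i) *: P u0) = 0 by rewrite h subrr.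
  by rewrite !opprD !opprK addrACA.
have pv0 : p v0 = 0.
  have [dpv0 Spv0] := redp dv0.
  apply: (nonreal_kernel hdot sS In dpv0).
  by have := congr1 p E2; rewrite (linB lp) (linZ lp) pv' -Spv0 => /eqP; rewrite subr_eq0 => /eqP.
have du0S : dom S u0 by rewrite -domTS.
have d1 := lin_subspaceB (sa_sub sS) dy du0S.
have d2 := lin_subspaceB (sa_sub sS) d1 dv0.
pose e := y - u0 - v0.
have eE : S e - (t *i) *: e = - D (u - u0).
  rewrite /e (op_sub (sa_lin sS)) // (op_sub (sa_lin sS)) // !scalerBr (linB lD).
  have -> : S u0 = T u0 - D u0 by rewrite TE // addrK.
  have -> : S v0 = z0 - u' + (t *i) *: v0 by rewrite -E2 subrK.
  have -> : T u0 = u' + (t *i) *: u0 by rewrite -E1 subrK.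
  rewrite /z0; move: ((t *i) *: y) ((t *i) *: u0) ((t *i) *: v0) (D u) (D u0) (S y).
  by move=> a1 a2 a3 f1 f2 s; apply: ip_ext => v; rewrite !(ipDl, ipNl); ring.
have h1 := nonreal_bound hdot sS (t *i) d2; rewrite -/e eE nmN /= in h1.
have h2 := bD (u - u0).
have Puu : P (u - u0) = u - u0 by rewrite (linB lP) Pu Pu0.
have h3 := oblique_norm_bound Puu.
have pe : p (u - u0) = p e.
  move: pv; rewrite /e !(linB lp) pv0 subr0 => /eqP; rewrite subr_eq0 => /eqP ->.
  by [].
have h4 := proj_le e op; rewrite pe in h3.
have z1 : nm (u - u0) = 0.
  rewrite (gtr0_norm t0) in h1.
  have E : b / (1 - c ^+ 2) * (1 - c ^+ 2) = b by rewrite divfK // gt_eqF.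
  have q0 : 0 <= b / (1 - c ^+ 2) by rewrite divr_ge0 // ltW.
  have h5 : b / (1 - c ^+ 2) * ((1 - c ^+ 2) * nm (u - u0)) <= b / (1 - c ^+ 2) * nm e.
    by rewrite ler_wpM2l // (le_trans h3).
  rewrite mulrA E in h5.
  have h6 : nm e <= 0 by move: h1 h2 h5; rewrite /t; lra.
  have h7 : (1 - c ^+ 2) * nm (u - u0) <= 0 by apply: le_trans h3 _; apply: le_trans h4 h6.
  by apply/eqP; rewrite eq_le nm_ge0 andbT -(pmulr_rle0 _ c2).
by move/nm0_eq0/eqP: z1; rewrite subr_eq0 => /eqP ->.
Qed.

Hypothesis signP : forall x, P x = x -> 0 <= ip x (D x).
Hypothesis posp : forall x, dom S x -> p x = 0 -> 0 <= ip x (S x).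

(** Subtracting from a vector of the lower spectral part of [S] its component
    [u] in the range of [P] leaves a vector of the upper part, so that the form
    of [S] at [u] is not lower than it was; the sign of [D] carries this over to [T]. *)
Lemma spectral_count (G : H -> H) (l : R) k (e : 'I_k -> H) m (w : 'I_m -> H) :
  linear G -> (forall x, exists a : 'I_k -> R[i], G x = \sum_(i < k) a i *: e i) ->
  l <= 0 ->
  (forall u, dom T u -> P u = u -> G u = 0 -> u != 0 -> ip u (T u) < l * nm u ^+ 2) ->
  free_family w ->
  (forall a : 'I_m -> R[i], let y := \sum_(i < m) a i *: w i in
    [/\ dom S y, p y = y & l * nm y ^+ 2 <= ip y (S y)]) ->
  (m <= k)%N.
Proof.
move=> lG spG l0 negT fw hw; rewrite leqNgt; apply/negP => km.
have [[lP idP _] [lp idp _]] := (oP, op).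
have exU i : exists u, P u = u /\ p (w i - u) = 0.
  by have [u ? ?] := oblique_decomposition (w i); exists u.
have [U hU] := choice exU.
have [M hM] := choice (fun i => spG (U i)).
pose MX := \matrix_(i < m, j < k) M i j.
(* More rows than columns: some combination of the [U i] is killed by [G]. *)
have kM : kermx MX != 0.
  rewrite -mxrank_eq0 mxrank_ker subn_eq0 -ltnNge.
  by apply: leq_ltn_trans (rank_leq_col _) km.
have /rowV0Pn[r /sub_kermxP rM r0] := kM.
pose y := \sum_(i < m) r 0 i *: w i.
pose u := \sum_(i < m) r 0 i *: U i.
have [dy py ly] := hw (fun i => r 0 i); rewrite -/y in dy py ly.
have Pu : P u = u.
  by rewrite /u (lin_sum lP); apply: eq_bigr => i _; rewrite (linZ lP) (hU i).1.
have Gu : G u = 0.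
  rewrite /u (lin_sum lG); under eq_bigr do rewrite (linZ lG) hM scaler_sumr.
  rewrite exchange_big /= big1 // => j _.
  under eq_bigr do rewrite scalerA; rewrite -scaler_suml.
  have := congr1 (fun X : 'rV_k => X 0 j) rM; rewrite !mxE.
  by under eq_bigr do rewrite mxE; move=> ->; rewrite scale0r.
have pv : p (y - u) = 0.
  rewrite /y /u -sumrB (lin_sum lp) big1 // => i _.
  by rewrite -scalerBr (linZ lp) (hU i).2 scaler0.
have du := oblique_domain dy Pu pv.
have dv := lin_subspaceB (sa_sub sS) dy du.
have u0 : u != 0.
  apply/eqP => u0; move: pv; rewrite u0 subr0 py => y0.
  case/eqP: r0; apply/rowP => i; rewrite mxE.
  exact: (fw (fun i => r 0 i) y0).
have du' : dom T u by rewrite domTS.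
have h1 := negT _ du' Pu Gu u0.
rewrite TE // ipDr in h1; have h2 := signP Pu; have h3 := posp dv pv.
have E1 : nm u ^+ 2 = nm y ^+ 2 + nm (y - u) ^+ 2.
  have uE : u = y - (y - u) by rewrite opprB addrC subrK.
  by rewrite {1}uE (sqnmB hdot) (proj_orth op py pv) mulr0 subr0.
have Sy : p (S y) = S y by rewrite -(redp dy).2 py.
have E2 : ip u (S u) = ip y (S y) + ip (y - u) (S (y - u)).
  have uE : u = y - (y - u) by rewrite opprB addrC subrK.
  have o1 : ip (y - u) (S y) = 0 by rewrite ipC; exact: (proj_orth op Sy pv).
  have o2 : ip y (S (y - u)) = 0 by rewrite -(sa_ip sS) // ipC.
  rewrite {1 2}uE (op_sub (sa_lin sS) dy dv) ipBl !ipBr o1 o2; ring.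
have h4 : l * nm (y - u) ^+ 2 <= 0 by rewrite mulr_le0_ge0 // sqr_ge0.
by move: h1; rewrite E1 E2; lra.
Qed.

End Pair.

(** * Spectrum below a finite counting bound *)

Section Dimension.
Context {R : realType} {H : completeNormedModType R[i]}.
Implicit Types (V : set H).

Lemma free_extend n (v : 'I_n -> H) x : free_family v ->
  (forall c : 'I_n -> R[i], x != \sum_(i < n) c i *: v i) ->
  free_family (fun i : 'I_n.+1 => oapp v x (unlift ord_max i)).
Proof.
move=> fv hx c; rewrite big_ord_recr /= unlift_none /=.
under eq_bigr do rewrite -[widen_ord _ _]/(widen_ord (leqnSn n) _).
have E (i : 'I_n) : unlift ord_max (widen_ord (leqnSn n) i) = Some i.
  have -> : widen_ord (leqnSn n) i = lift ord_max i.
    by apply: val_inj; rewrite /= /bump leqNgt ltn_ord.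
  by rewrite liftK.
under eq_bigr do rewrite E /=.
move=> h.
have cn0 : c ord_max = 0.
  apply/eqP/negPn/negP => cn; have := hx (fun i => - (c ord_max)^-1 * c (widen_ord (leqnSn n) i)).
  case/eqP; have {}h : c ord_max *: x = - \sum_(i < n) c (widen_ord (leqnSn n) i) *: v i.
    by apply/eqP; rewrite -addr_eq0 addrC h.
  rewrite -[LHS](scalerK cn) h scalerN -scaleNr scaler_sumr.
  by apply: eq_bigr => i _; rewrite scalerA.
rewrite cn0 scale0r addr0 in h; have c0 := fv _ h.
move=> i; case: (unliftP ord_max i) => [j ->|->//].
rewrite -(c0 j); congr c; apply: val_inj => /=.
by rewrite /bump leqNgt ltn_ord.
Qed.

(** A family of maximal length among the independent ones is a basis. *)
Lemma bounded_has_dim V k :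
  (forall n (v : 'I_n -> H), free_family v -> (forall i, V (v i)) -> (n <= k)%N) ->
  exists n, has_dim V n.
Proof.
move=> hk.
pose Q n := `[< exists v : 'I_n -> H, free_family v /\ forall i, V (v i) >].
have Q0 : exists n, Q n.
  by exists 0%N; apply/asboolP; exists (fun=> 0); split=> [c _ []|[]].
have Qk n : Q n -> (n <= k)%N by move/asboolP => [v [fv vV]]; exact: hk fv vV.
case: (ex_maxnP Q0 Qk) => n /asboolP[v [fv vV]] max.
exists n, v; split => // x Vx; apply: contrapT => hx.
have fx : free_family (fun i : 'I_n.+1 => oapp v x (unlift ord_max i)).
  apply: free_extend => // c; apply/eqP => xE; apply: hx; by exists c.
have : Q n.+1.
  apply/asboolP; exists (fun i : 'I_n.+1 => oapp v x (unlift ord_max i)); split => // i.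
  by case: (unlift ord_max i) => [j|] //=; exact: vV.
by move/max; rewrite ltnn.
Qed.

End Dimension.

Section Weyl.
Context {R : realType} {H : completeNormedModType R[i]}.
Variable (dot : {dot H for Num.conj}).
Hypothesis hdot : hilbert_dot dot.
Local Notation ip := (rdot dot).
Local Notation nm := (@vnorm R H).
Implicit Types (x y z : H).
Variable S : unbounded_op H.
Hypothesis sS : self_adjoint dot S.

Definition bounded_below (s : R) (V : set H) : Prop :=
  exists2 c : R, 0 < c & forall x, dom S x -> V x -> c * nm x <= nm (S x - s%:C *: x).

Lemma shift_lin (s : R) (a : R[i]) x y : dom S x -> dom S y ->
  S (a *: x + y) - s%:C *: (a *: x + y) = a *: (S x - s%:C *: x) + (S y - s%:C *: y).
Proof.
move=> dx dy; rewrite (op_linear (sa_lin sS)) // scalerDr opprD addrACA scalerBr.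
by rewrite !scalerA (mulrC a).
Qed.

Lemma lim_closed_orth (V : set H) w : lim_closed V ->
  lim_closed [set x | V x /\ dot x w = 0].
Proof.
move=> cV u l hu ul; split; first by apply: (cV u) => // n; case: (hu n).
have h z : (forall n, ip (u n) z = 0) -> ip l z = 0.
  by move=> uz; apply: (tends_ip hdot ul (tends_cst z)).
rewrite -(linear0l dot w); apply: dot_eq.
  by rewrite ip0l; apply: h => n; rewrite /rdot; case: (hu n) => _ ->.
rewrite scaler0 ip0l -[LHS]opprK -ip_ir h ?oppr0 // => n.
by rewrite ip_ir /rdot dotZl; case: (hu n) => _ ->; rewrite mulr0 oppr0.
Qed.

(** Passing to the orthogonal complement of one vector cannot make an
    injective [S - s] bounded below: otherwise the range over the smaller space
    is closed and misses the image of the removed direction. *)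
Lemma bounded_below_codim1 (s : R) (V : set H) w :
  lin_subspace V -> lim_closed V ->
  (forall x, dom S x -> S x = s%:C *: x -> x = 0) ->
  bounded_below s [set x | V x /\ dot x w = 0] -> bounded_below s V.
Proof.
move=> sV cV inj [c c0 hc].
have [triv|] := pselect (forall x, dom S x -> V x -> dot x w = 0).
  by exists c => // x dx Vx; apply: hc => //; split=> //; exact: triv.
move=> /existsNP[a0] /not_implyP[da0] /not_implyP[Va0] /eqP a0w.
pose a := (dot a0 w)^-1 *: a0.
have da : dom S a by exact: lin_subspaceZ (sa_sub sS) da0.
have Va : V a by exact: lin_subspaceZ.
have aw : dot a w = 1 by rewrite dotZl mulVf.
clearbody a.
pose F x := S x - s%:C *: x.
have FE (t : R[i]) x y : dom S x -> dom S y -> F (t *: x + y) = t *: F x + F y.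
  exact: shift_lin.
have FD x y : dom S x -> dom S y -> F (x + y) = F x + F y.
  by move=> dx dy; have := FE 1 _ _ dx dy; rewrite !scale1r.
have FB x y : dom S x -> dom S y -> F (x - y) = F x - F y.
  by move=> dx dy; rewrite addrC -scaleN1r FE // scaleN1r addrC.
have [e e0 he] : exists2 e : R, 0 < e &
    forall m, dom S m -> V m -> dot m w = 0 -> e <= nm (F (a + m)).
  apply: contrapT => hno.
  have ex (n : nat) : exists m, [/\ dom S m, V m, dot m w = 0 & nm (F (a + m)) < n.+1%:R^-1].
    apply: contrapT => hm; apply: hno; exists n.+1%:R^-1; first by rewrite invr_gt0.
    by move=> m dm Vm mw; rewrite leNgt; apply/negP => lt; apply: hm; exists m.
  have [m hm] := choice ex.
  have small (e : R) : 0 < e -> exists n, forall k, (n <= k)%N -> nm (F (a + m k)) < e.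
    move=> e0; have [n _ hn] := near_infty_natSinv_lt (PosNum e0).
    exists n => k nk; have [_ _ _ lt] := hm k; apply: lt_trans lt _; exact: hn.
  have Fm : tends (F \o m) (- F a).
    move=> e /small[n hn]; exists n => k /hn.
    have [dm _ _ _] := hm k.
    by rewrite FD // opprK /= addrC.
  have [q mq] : exists q, tends m q.
    apply: tends_cauchy => e e0; have e2 : 0 < c * (e / 2) by rewrite mulr_gt0 // divr_gt0.
    have [n hn] := Fm _ e2; exists n => k nk.
    have h1 := hn _ nk; have h2 := hn _ (leqnn n).
    have [[dk Vk wk _] [dn Vn wn _]] := (hm k, hm n).
    have dkn := lin_subspaceB (sa_sub sS) dk dn.
    have := hc _ dkn; rewrite -/(F _) FB // => /(_ _) h3.
    have {}h3 : c * nm (m k - m n) <= nm (F (m k) - F (m n)).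
      apply: h3; split; first exact: lin_subspaceB.
      by rewrite dotDl dotNl wk wn subr0.
    have := nm_dist (F (m k)) (- F a) (F (m n)); rewrite (nmBC (- F a)) => h4.
    by rewrite -(ltr_pM2l c0); move: h1 h2 h3 h4 => /=; lra.
  have [dq Sq] : dom S q /\ S q = - F a + s%:C *: q.
    apply: (sa_closed hdot sS (u := m) _ mq) => [n|]; first by case: (hm n).
    have := tends_D Fm (tends_Z s%:C mq); congr (tends _ _); apply/funext => n /=.
    by rewrite /F subrK.
  have [Vq qw] : V q /\ dot q w = 0.
    by apply: (@lim_closed_orth V w cV m q _ mq) => n; case: (hm n).
  have Faq : F (a + q) = 0 by rewrite FD // [F q]/F Sq addrK subrr.
  have aq : a + q = 0.
    apply: inj; first exact: lin_subspaceD (sa_sub sS) da dq.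
    by apply/eqP; rewrite -subr_eq0 -/(F _) Faq.
  have := congr1 (fun v => dot v w) aq; rewrite /= dotDl aw qw addr0 linear0l.
  by move/eqP; rewrite oner_eq0.
pose K : R := nm a / e + (1 + nm (F a) / e) / c.
have K0 : 0 < K.
  apply: ltr_wpDl; first by rewrite divr_ge0 ?nm_ge0 // ltW.
  by rewrite divr_gt0 // ltr_wpDr // divr_ge0 ?nm_ge0 // ltW.
exists K^-1; first by rewrite invr_gt0.
move=> x dx Vx; rewrite mulrC ler_pdivrMr // -/(F x).
pose t := dot x w.
have dta : dom S (t *: a) by apply: lin_subspaceZ (sa_sub sS) da.
have Vta : V (t *: a) by apply: lin_subspaceZ.
have dx' := lin_subspaceB (sa_sub sS) dx dta.
have Vx' := lin_subspaceB sV Vx Vta.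
have x'w : dot (x - t *: a) w = 0 by rewrite dotDl dotNl dotZl aw mulr1 subrr.
pose T : R := complex.Re `|t|.
have T0 : 0 <= T by exact: Re_norm_ge0.
have h1 : T * e <= nm (F x).
  have [t0|t0] := eqVneq t 0; first by rewrite /T t0 normr0 mul0r nm_ge0.
  have d1 : dom S (t^-1 *: (x - t *: a)) by apply: lin_subspaceZ (sa_sub sS) dx'.
  have V1 : V (t^-1 *: (x - t *: a)) by exact: lin_subspaceZ.
  have xE : x = t *: (a + t^-1 *: (x - t *: a)).
    by rewrite scalerDr scalerA divff // scale1r addrC subrK.
  have d2 := lin_subspaceD (sa_sub sS) da d1.
  have Fx : F x = t *: F (a + t^-1 *: (x - t *: a)).
    have := FE t _ _ d2 (sa_sub sS).1; rewrite addr0 -xE => ->.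
    by rewrite {2}/F (op0 (sa_lin sS)) scaler0 subr0 addr0.
  rewrite Fx nm_scale; apply: ler_wpM2l => //; apply: he => //.
  by rewrite dotZl x'w mulr0.
have h2 : c * nm (x - t *: a) <= nm (F x) + T * nm (F a).
  have := hc _ dx'; rewrite -/(F _) => /(_ (conj Vx' x'w)) /le_trans; apply.
  have FtA : F (t *: a) = t *: F a.
    have := FE t _ _ da (sa_sub sS).1; rewrite addr0 => ->.
    by rewrite {2}/F (op0 (sa_lin sS)) scaler0 subr0 addr0.
  by rewrite FB // FtA -nm_scale nmB.
have h3 : nm x <= T * nm a + nm (x - t *: a).
  by rewrite /T -nm_scale; have := nmD (t *: a) (x - t *: a); rewrite addrC subrK.
set X := nm (F x) in h1 h2 *; rewrite /K mulrDr.
have h4 : T <= X / e by rewrite ler_pdivlMr.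
apply: le_trans h3 _; apply: lerD.
  by rewrite mulrA mulrAC; apply: ler_wpM2r => //; exact: nm_ge0.
rewrite mulrA ler_pdivlMr // mulrC; apply: le_trans h2 _.
by rewrite mulrDr mulr1 lerD2l mulrA mulrAC; apply: ler_wpM2r => //; exact: nm_ge0.
Qed.

End Weyl.

Section Discrete.
Context {R : realType} {H : completeNormedModType R[i]}.
Variable (dot : {dot H for Num.conj}).
Hypothesis hdot : hilbert_dot dot.
Local Notation ip := (rdot dot).
Local Notation nm := (@vnorm R H).
Implicit Types (x y z : H).
Variable S : unbounded_op H.
Hypothesis sS : self_adjoint dot S.

Lemma eigen_orth x y (s t : R) : dom S x -> dom S y -> S x = s%:C *: x -> S y = t%:C *: y ->
  s != t -> dot x y = 0.
Proof.
move=> dx dy Ex Ey st; have := sa_dot sS dx dy; rewrite Ex Ey dotZl dotZr.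
have -> : Num.conj t%:C = t%:C by apply/eqP; rewrite eq_complex /= oppr0 !eqxx.
move/eqP; rewrite -subr_eq0 -mulrBl mulf_eq0 -rmorphB /= => /orP[|/eqP//].
by rewrite eq_complex /= eqxx andbT subr_eq0 (negPf st).
Qed.

(** Eigenvectors of different eigenvalues are orthogonal, so that the form of
    [S - l] on their span is the square of the norm of
    [\sum_i (t_i - l)^(1/2) a_i w_i]. *)
Lemma eigen_form m (w : 'I_m -> H) (t : 'I_m -> R) (l : R) (a : 'I_m -> R[i]) y :
  (forall i, dom S (w i)) -> (forall i, S (w i) = (t i)%:C *: w i) ->
  (forall i, l <= t i) ->
  y = \sum_(i < m) a i *: w i -> l * nm y ^+ 2 <= ip y (S y).
Proof.
move=> dw Ew lt yE.
pose z i := a i *: w i.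
have dz i : dom S (z i) by exact: lin_subspaceZ (sa_sub sS) (dw i).
have Ez i : S (z i) = (t i)%:C *: z i.
  by rewrite (op_scale (sa_lin sS)) // Ew !scalerA mulrC.
have Sy : S y = \sum_i (t i)%:C *: z i.
  rewrite yE (op_sum (sa_lin sS)); last by move=> i _; exact: dz.
  by apply: eq_bigr => i _; exact: Ez.
pose q i := Num.sqrt (t i - l).
have ipsl (F : 'I_m -> H) v : ip (\sum_i F i) v = \sum_i ip (F i) v.
  by elim/big_rec2 : _ => [|i ? ? _ <-]; [rewrite ip0l|rewrite ipDl].
have ipsr (F : 'I_m -> H) v : ip v (\sum_i F i) = \sum_i ip v (F i).
  by rewrite ipC ipsl; apply: eq_bigr => i _; rewrite ipC.
have : 0 <= nm (\sum_i (q i)%:C *: z i) ^+ 2 by exact: sqr_ge0.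
suff -> : nm (\sum_i (q i)%:C *: z i) ^+ 2 = ip y (S y) - l * nm y ^+ 2 by rewrite subr_ge0.
rewrite !(nm2 hdot) Sy yE !ipsl mulr_sumr -sumrB; apply: eq_bigr => i _.
rewrite !ipsr mulr_sumr -sumrB; apply: eq_bigr => j _.
rewrite ipZl !ipZr -/(z i) -/(z j).
have [tij|tij] := eqVneq (t i) (t j).
  rewrite /q tij mulrA -expr2 sqr_sqrtr ?mulrBl //.
  by rewrite subr_ge0.
by rewrite /rdot (eigen_orth (dz i) (dz j) (Ez i) (Ez j) tij) /= !mulr0 subr0.
Qed.

Lemma orthogonal_free m (w : 'I_m -> H) : (forall i, w i != 0) ->
  (forall i j, i != j -> dot (w i) (w j) = 0) -> free_family w.
Proof.
move=> w0 ow c h i.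
have : dot (\sum_(j < m) c j *: w j) (w i) = c i * dot (w i) (w i).
  have E : dot (\sum_(j < m) c j *: w j) (w i) = \sum_(j < m) c j * dot (w j) (w i).
    elim/big_rec2 : _ => [|j ? ? _ <-]; first by rewrite linear0l.
    by rewrite dotDl dotZl.
  rewrite E (bigD1 i) //= big1 ?addr0 // => j ji.
  by rewrite ow ?mulr0.
rewrite h linear0l => /esym/eqP; rewrite mulf_eq0 => /orP[/eqP//|].
by rewrite hdot sqrf_eq0 normr_eq0 (negPf (w0 i)).
Qed.

Variable p : H -> H.
Hypothesis op : orthogonal_projection dot p.
Hypothesis redp : reduces p S.
Variables g l : R.
Hypothesis posp : forall x, dom S x -> p x = 0 -> g * nm x ^+ 2 <= ip x (S x).
Variable k : nat.
Hypothesis hcount : forall m (w : 'I_m -> H), free_family w ->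
  (forall a : 'I_m -> R[i], let y := \sum_(i < m) a i *: w i in
    [/\ dom S y, p y = y & l * nm y ^+ 2 <= ip y (S y)]) -> (m <= k)%N.

(** The recursion removes one direction at a time, as in [bounded_below_codim1]. *)
Fixpoint orth_space (w : nat -> H) (n : nat) : set H :=
  if n is j.+1 then [set x | orth_space w j x /\ dot x (w j) = 0]
  else [set x | p x = x].

Lemma orth_space_sub w n : lin_subspace (orth_space w n).
Proof.
elim: n => [|n IH]; first exact: (proj_ran_sub op).
split => /= [|a x y [Vx xw] [Vy yw]]; first by split; [exact: IH.1|rewrite linear0l].
by split; [exact: IH.2|rewrite dotDl dotZl xw yw mulr0 addr0].
Qed.

Lemma orth_space_closed w n : lim_closed (orth_space w n).
Proof.
elim: n => [|n IH] /=; last exact: lim_closed_orth.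
move=> u x ux xl; have [lp _ _] := op.
have bp y : nm (p y) <= 1 * nm y by rewrite mul1r (proj_le hdot y op).
apply: (tends_unique (tends_lip (lin_lip lp bp) xl)).
by move: (xl); congr (tends _ _); apply/funext => j /=; rewrite ux.
Qed.

Lemma orth_spaceP w n x : orth_space w n x ->
  p x = x /\ forall i, (i < n)%N -> dot x (w i) = 0.
Proof.
elim: n => [|n IH] /=; first by move=> xE; split.
case=> /IH[xE h] xw; split => // i; rewrite ltnS leq_eqVlt => /orP[/eqP->//|].
exact: h.
Qed.

Lemma orth_space_unbounded (s : R) w n :
  (forall x, dom S x -> S x = s%:C *: x -> x = 0) ->
  ~ bounded_below S s [set x | p x = x] -> ~ bounded_below S s (orth_space w n).
Proof.
move=> inj nb; elim: n => [|n IH] // h; apply: IH.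
exact: (@bounded_below_codim1 _ _ _ hdot _ sS s _ (w n) (orth_space_sub w n) (@orth_space_closed w n) inj h).
Qed.

(** Each new vector is found in the orthogonal complement of the previous ones,
    where [S - s] is still not bounded below. *)
Lemma approximate_eigenfamily (s e : R) n : 0 < e ->
  (forall x, dom S x -> S x = s%:C *: x -> x = 0) ->
  ~ bounded_below S s [set x | p x = x] ->
  exists w : nat -> H,
    (forall i, (i < n)%N ->
      [/\ dom S (w i), p (w i) = w i, nm (w i) = 1 & nm (S (w i) - s%:C *: w i) <= e]) /\
    (forall i j, (i < j < n)%N -> dot (w j) (w i) = 0).
Proof.
move=> e0 inj nb; elim: n => [|n [w [hw ow]]].
  by exists (fun=> 0); split => // i j /andP[].
have nbn := orth_space_unbounded (w := w) (n := n) inj nb.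
have [x [dx Vx lt]] : exists x, [/\ dom S x, orth_space w n x & nm (S x - s%:C *: x) < e * nm x].
  apply: contrapT => hno; apply: nbn; exists e => // x dx Vx.
  by rewrite leNgt; apply/negP => lt; apply: hno; exists x.
have x0 : 0 < nm x.
  by rewrite -(pmulr_rgt0 _ e0); apply: le_lt_trans lt; exact: nm_ge0.
have [px xw] := orth_spaceP Vx.
pose v := (nm x)^-1%:C *: x.
exists (fun i => if i == n then v else w i); split.
  move=> i; case: eqVneq => [-> _|ni]; last first.
    by rewrite ltnS leq_eqVlt (negPf ni) => /hw.
  have [lp _ _] := op.
  split; first exact: lin_subspaceZ (sa_sub sS) dx.
  - by rewrite /v (linZ lp) px.
  - by rewrite /v nmZ gtr0_norm ?invr_gt0 // mulVf ?gt_eqF.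
  - have -> : S v - s%:C *: v = (nm x)^-1%:C *: (S x - s%:C *: x).
      by rewrite /v (op_scale (sa_lin sS)) // scalerBr !scalerA (mulrC s%:C).
    by rewrite nmZ gtr0_norm ?invr_gt0 // mulrC ler_pdivrMr // ltW.
move=> i j /andP[ij jn]; rewrite ltnS in jn.
have ni : i != n by rewrite neq_ltn (leq_trans ij jn).
rewrite (negPf ni); case: eqVneq => [jE|nj].
  by rewrite /v dotZl xw ?mulr0 // -jE.
by apply: ow; rewrite ij ltn_neqAle nj.
Qed.

(** An orthonormal family of [k + 1] approximate eigenvectors with errors
    [(s - l) / (k + 1)] would span a space on which the form of [S] is at least
    [l], against the counting bound. *)
Lemma below_bounded (s : R) : l < s -> s < g ->
  (forall x, dom S x -> S x = s%:C *: x -> x = 0) ->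
  exists2 c : R, 0 < c & forall x, dom S x -> c * nm x <= nm (S x - s%:C *: x).
Proof.
move=> ls sg inj.
have [lp idp _] := op.
have [c c0 hc] : bounded_below S s [set x | p x = x].
  apply: contrapT => nb.
  pose e : R := (s - l) / k.+1%:R.
  have e0 : 0 < e by rewrite divr_gt0 // subr_gt0.
  have [w [hw ow]] := approximate_eigenfamily k.+1 e0 inj nb.
  have ow' (i j : 'I_k.+1) : i != j -> dot (w i) (w j) = 0.
    move=> ij; have : (i : nat) != j by apply: contra ij => /eqP/val_inj ->.
    rewrite neq_ltn => /orP[lt|lt]; last by apply: ow; rewrite lt ltn_ord.
    by rewrite dotC ow ?rmorph0 // lt ltn_ord.
  have fw : free_family (fun i : 'I_k.+1 => w i).
    apply: orthogonal_free => // i; have [_ _ n1 _] := hw i (ltn_ord i).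
    by apply/eqP => w0; move: n1; rewrite w0 nm0 => /eqP; rewrite eq_sym oner_eq0.
  suff : (k.+1 <= k)%N by rewrite ltnn.
  apply: (hcount fw) => a y.
  have dw (i : 'I_k.+1) : dom S (w i) by case: (hw i (ltn_ord i)).
  have daw (i : 'I_k.+1) : dom S (a i *: w i) by exact: lin_subspaceZ (sa_sub sS) (dw i).
  have dy : dom S y by apply: lin_subspace_sum; [exact: sa_sub sS|move=> i _].
  split => //.
    rewrite /y (lin_sum lp); apply: eq_bigr => i _.
    by rewrite (linZ lp); have [_ -> _ _] := hw i (ltn_ord i).
  have ai (i : 'I_k.+1) : complex.Re `|a i| <= nm y.
    have E : dot y (w i) = a i.
      have -> : dot y (w i) = \sum_(j < k.+1) a j * dot (w j) (w i).
        rewrite /y; elim/big_rec2 : _ => [|j ? ? _ <-]; first by rewrite linear0l.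
        by rewrite dotDl dotZl.
      rewrite (bigD1 i) //= big1 ?addr0 => [|j ji]; last by rewrite ow' ?mulr0.
      by rewrite hdot nmE; have [_ _ -> _] := hw i (ltn_ord i); rewrite expr1n mulr1.
    have [_ pwi n1 _] := hw i (ltn_ord i).
    have T0 := Re_norm_ge0 (a i).
    have [->|T1] := eqVneq (complex.Re `|a i|) 0; first exact: nm_ge0.
    have T2 : 0 < complex.Re `|a i| by rewrite lt_neqAle eq_sym T1.
    have := ip_le_nm hdot y (a i *: w i).
    rewrite nm_scale n1 mulr1 /rdot dotZr E mulrC -normCK.
    have -> : `|a i| = (complex.Re `|a i|)%:C by rewrite RRe_real // ger0_real.
    by rewrite -rmorphXn /= expr2 ler_pM2r.
  have Sy : S y - s%:C *: y = \sum_(i < k.+1) a i *: (S (w i) - s%:C *: w i).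
    rewrite /y (op_sum (sa_lin sS)) // scaler_sumr -sumrB; apply: eq_bigr => i _.
    by rewrite (op_scale (sa_lin sS)) // scalerBr !scalerA (mulrC s%:C).
  have small : nm (S y - s%:C *: y) <= (s - l) * nm y.
    rewrite Sy.
    have tri (I : finType) (F : I -> H) : nm (\sum_i F i) <= \sum_i nm (F i).
      elim/big_rec2 : _ => [|i u v _ h]; first by rewrite nm0.
      by apply: le_trans (nmD _ _) _; rewrite lerD2l.
    apply: le_trans (tri _ _) _.
    apply: (@le_trans _ _ (\sum_(i < k.+1) nm y * e)).
      apply: ler_sum => i _; rewrite nm_scale.
      have [_ _ _ he] := hw i (ltn_ord i).
      by apply: ler_pM => //; [exact: Re_norm_ge0|exact: nm_ge0].
    rewrite sumr_const card_ord -mulr_natr -mulrA divfK ?pnatr_eq0 // mulrC //.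
  have h1 := ip_le hdot y (S y - s%:C *: y).
  have : - (nm y * nm (S y - s%:C *: y)) <= ip y (S y - s%:C *: y) by rewrite lerNl; apply: le_trans h1; rewrite -normrN ler_norm.
  rewrite ipBr ipZr -(nm2 hdot).
  have := ler_wpM2l (nm_ge0 y) small; lra.
have gs : 0 < g - s by rewrite subr_gt0.
pose m : R := Num.min c (g - s).
have m0 : 0 < m by rewrite lt_min c0 gs.
exists m => // x dx; have [dpx Spx] := redp dx.
have dqx := lin_subspaceB (sa_sub sS) dx dpx.
have h1 : m * nm (p x) <= nm (S (p x) - s%:C *: p x).
  apply: le_trans (hc _ dpx (idp x)); rewrite ler_wpM2r ?nm_ge0 // ge_min lexx //.
have h2 : m * nm (x - p x) <= nm (S (x - p x) - s%:C *: (x - p x)).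
  have [->|z0] := eqVneq (nm (x - p x)) 0; first by rewrite mulr0 nm_ge0.
  have z1 : 0 < nm (x - p x) by rewrite lt_neqAle eq_sym z0 nm_ge0.
  rewrite -(ler_pM2l z1); apply: le_trans (ip_le_nm hdot _ _).
  rewrite ipBr ipZr -(nm2 hdot).
  have h3 := posp dqx (proj_compl0 x op).
  have h4 : m * nm (x - p x) ^+ 2 <= (g - s) * nm (x - p x) ^+ 2.
    by rewrite ler_wpM2r ?sqr_ge0 // ge_min lexx orbT.
  by rewrite mulrCA -expr2; lra.
pose F := S x - s%:C *: x.
have pF : p F = S (p x) - s%:C *: p x by rewrite /F (linB lp) (linZ lp) Spx.
have qF : F - p F = S (x - p x) - s%:C *: (x - p x).
  by rewrite pF (op_sub (sa_lin sS)) // scalerBr /F !opprD !opprK addrACA.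
rewrite -(ler_pXn2r (n := 2)) ?nnegrE ?nm_ge0 //; last by rewrite mulr_ge0 ?nm_ge0 // ltW.
rewrite -/F (proj_pyth hdot F op) qF pF exprMn (proj_pyth hdot x op) mulrDr -!(exprMn 2 m).
by apply: lerD; rewrite ler_pXn2r ?nnegrE ?mulr_ge0 ?nm_ge0 // ltW.
Qed.

(** The component of an eigenvector in the kernel of [p] is an eigenvector for an
    eigenvalue below [g], while the form of [S] there is at least [g]. *)
Lemma eigen_low (s : R) x : s < g -> dom S x -> S x = s%:C *: x -> p x = x.
Proof.
move=> sg dx Ex; have [dpx Spx] := redp dx; have [lp idp _] := op.
have dqx := lin_subspaceB (sa_sub sS) dx dpx.
apply/esym/eqP; rewrite -subr_eq0; apply/eqP/nm0_eq0/eqP; rewrite -sqrf_eq0.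
have := posp dqx (proj_compl0 x op).
rewrite (op_sub (sa_lin sS)) // Spx Ex (linZ lp) -scalerBr ipZr -(nm2 hdot) => h.
rewrite eq_le sqr_ge0 andbT -subr_le0 subr0.
have gs : 0 < g - s by rewrite subr_gt0.
by rewrite -(pmulr_rle0 _ gs); lra.
Qed.

Lemma eigen_count m (w : 'I_m -> H) (t : 'I_m -> R) :
  (forall i, dom S (w i)) -> (forall i, S (w i) = (t i)%:C *: w i) ->
  (forall i, l <= t i < g) -> free_family w -> (m <= k)%N.
Proof.
move=> dw Ew lt fw; apply: (hcount fw) => a y; have [lp _ _] := op.
split.
- apply: lin_subspace_sum; first exact: sa_sub sS.
  by move=> i _; exact: lin_subspaceZ (sa_sub sS) (dw i).
- rewrite /y (lin_sum lp); apply: eq_bigr => i _; rewrite (linZ lp).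
  by rewrite (eigen_low _ (dw i) (Ew i)) //; case/andP: (lt i).
- by apply: (eigen_form dw Ew) => // i; case/andP: (lt i).
Qed.

(** Otherwise there would be eigenvalues coming strictly closer and closer to
    [s], hence infinitely many distinct ones. *)
Lemma below_isolated (s : R) : l < s -> s < g -> exists2 e : R, 0 < e &
  forall t : R, 0 < `|t - s| < e -> ~ is_eigenvalue S t%:C.
Proof.
move=> ls sg; apply: contrapT => hno.
pose e0 : R := Num.min (s - l) (g - s).
have e00 : 0 < e0 by rewrite lt_min !subr_gt0 ls sg.
have ex (e : R) : exists t : R, 0 < e -> [/\ 0 < `|t - s|, `|t - s| < e & is_eigenvalue S t%:C].
  have [he|he] := ltP 0 e; last by exists 0.
  apply: contrapT => h; apply: hno; exists e => // t /andP[t1 t2] et.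
  by apply: h; exists t.
have [f hf] := choice ex.
pose t n := iter n (fun u => f `|u - s|) (f e0).
have tP n : [/\ 0 < `|t n - s|, `|t n - s| < e0 & is_eigenvalue S (t n)%:C].
  elim: n => [|n [h1 h2 _]]; first exact: hf.
  by have [h3 h4 h5] := hf _ h1; split => //; exact: lt_trans h4 h2.
have tS n : `|t n.+1 - s| < `|t n - s| by have [h1 _ _] := tP n; have [] := hf _ h1.
have tlt i j : (i < j)%N -> `|t j - s| < `|t i - s|.
  elim: j => // j IH; rewrite ltnS leq_eqVlt => /orP[/eqP->//|/IH].
  exact: lt_trans.
have ex2 n : exists x, [/\ dom S x, S x = (t n)%:C *: x & x != 0].
  by have [_ _ [x [dx Ex] x0]] := tP n; exists x.
have [x hx] := choice ex2.
suff : (k.+1 <= k)%N by rewrite ltnn.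
apply: (@eigen_count _ (fun i : 'I_k.+1 => x i) (fun i => t i)).
- by move=> i; case: (hx i).
- by move=> i; case: (hx i).
- move=> i; have [_ + _] := tP i; rewrite lt_min => /andP[h1 h2].
  have := ler_norm (t i - s); have := ler_norm (s - t i); rewrite distrC.
  by move=> h3 h4; apply/andP; split; lra.
apply: orthogonal_free => [i|i j ij]; first by case: (hx i).
have [[d1 E1 _] [d2 E2 _]] := (hx i, hx j).
apply: (eigen_orth d1 d2 E1 E2).
have : (i : nat) != j by apply: contra ij => /eqP/val_inj ->.
by rewrite neq_ltn => /orP[/tlt|/tlt] h; apply/eqP => tE; move: h; rewrite tE ltxx.
Qed.

Lemma below_discrete (s : R) : l < s -> s < g ->
  spectrum S s%:C -> discrete_spectrum S s%:C.
Proof.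
move=> ls sg spec.
have resol (t : R) : l < t -> t < g -> ~ is_eigenvalue S t%:C -> resolvent_set S t%:C.
  move=> lt tg ne; have [|c c0 hc] := below_bounded lt tg; last exact: real_resolvent c0 hc.
  by move=> x dx Ex; apply: contrapT => /eqP x0; apply: ne; exists x.
split.
- split; first exact: mem_set.
  have [e e0 he] := below_isolated ls sg.
  pose r : R := Num.min e (Num.min (s - l) (g - s)).
  have r0 : 0 < r by rewrite !lt_min e0 !subr_gt0 ls sg.
  have rC : 0 < r%:C :> R[i] by rewrite ltcR.
  exists (ball (s%:C : R[i]^o) r%:C); first exact: nbhsx_ballx.
  apply/seteqP; split => [z [/= bz sz]|_ ->]; last by split => //; exact: ballxx.
  have [z0|z0] := eqVneq (complex.Im z) 0; last first.
    by case: sz; exact: (nonreal_resolvent hdot sS).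
  have zE : z = (complex.Re z)%:C by case: z z0 {bz sz} => a b /= ->.
  move: bz sz; rewrite zE -ball_normE /= -rmorphB /=.
  move: (complex.Re z) => t; rewrite normc_def /= expr0n addr0 sqrtr_sqr ltcR => h sz.
  apply/eqP/negPn/negP => tE.
  move: h; rewrite !lt_min => /andP[h1 /andP[h2 h3]].
  have ts : 0 < `|t - s|.
    by rewrite normr_gt0 subr_eq0; apply: contra tE => /eqP ->.
  apply: sz; apply: resol.
  + by have := ler_norm (s - t); lra.
  + by have := ler_norm (t - s); rewrite distrC; lra.
  + by apply: he; rewrite ts distrC.
- by apply: contrapT => ne; exact: spec (resol _ ls sg ne).
- apply: (@bounded_has_dim _ _ _ k) => n v fv vV.
  apply: (@eigen_count _ v (fun=> s)) => // [i|i|i]; try by case: (vV i).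
  by rewrite ltW.
Qed.

End Discrete.

(** * Consequences of the spectral measure *)

Section RealMeasure.
Context {R : realType}.
Local Notation TR := (measurableTypeR R).
Variable mu : {measure set TR -> \bar R}.
Hypothesis mufin : (mu setT < +oo)%E.

Lemma measurable_sq : measurable_fun [set: TR] (EFin \o (fun t : TR => (t : R) ^+ 2)).
Proof. by apply/measurable_EFinP; apply: measurable_funX. Qed.

Lemma mu_fin (J : set TR) : measurable J -> (mu J < +oo)%E.
Proof. by move=> mJ; apply: le_lt_trans mufin; apply: le_measure; rewrite ?inE. Qed.

Lemma integrable_id : (\int[mu]_t (t ^+ 2)%:E < +oo)%E ->
  mu.-integrable setT (fun t : TR => (t : R)%:E : \bar R).
Proof.
move=> h.
have isq : mu.-integrable setT (fun t : TR => ((t : R) ^+ 2)%:E : \bar R).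
  apply/integrableP; split; first exact: measurable_sq.
  by under eq_integral do rewrite /= ger0_norm ?sqr_ge0 //.
have i1 : mu.-integrable setT (EFin \o cst (1 : R) : TR -> \bar R).
  apply/integrableP; split; first exact/measurable_EFinP.
  under eq_integral do rewrite /= normr1.
  by rewrite integral_cst // mul1e.
have i2 := integrableD measurableT isq i1.
apply: (le_integrable measurableT _ _ i2); first exact/measurable_EFinP.
move=> t _ /=; rewrite lee_fin [leRHS]ger0_norm ?addr_ge0 ?sqr_ge0 //.
by rewrite -(real_normK (num_real t)); have := sqr_ge0 (1 - `|t|); have := normr_ge0 t; nra.
Qed.

Lemma integral_le_cst (J : set TR) (a : R) : measurable J -> mu (~` J) = 0%E ->
  (forall t, J t -> t <= a) -> mu.-integrable setT (fun t : TR => (t : R)%:E : \bar R) ->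
  (\int[mu]_t (t : R)%:E <= a%:E * mu setT)%E.
Proof.
move=> mJ J0 Ja it.
rewrite (negligible_integral (measurableC mJ)) // setDE setCK setTI.
have muJ : mu setT = mu J.
  rewrite -(setUv J) measureU //; [|exact: measurableC|exact: setICr].
  by rewrite -[RHS]adde0; congr (_ + _)%E; exact: J0.
rewrite muJ -integral_cst //; apply: le_integral => //.
- by apply: integrableS it.
- apply/integrableP; split; first exact: measurable_cst.
  under eq_integral do rewrite /= .
  by rewrite integral_cst // lte_mul_pinfty // mu_fin.
- by move=> t; rewrite inE lee_fin => /Ja.
Qed.

Lemma integral_ge_cst (J : set TR) (a : R) : measurable J -> mu (~` J) = 0%E ->
  (forall t, J t -> a <= t) -> mu.-integrable setT (fun t : TR => (t : R)%:E : \bar R) ->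
  (a%:E * mu setT <= \int[mu]_t (t : R)%:E)%E.
Proof.
move=> mJ J0 Ja it.
rewrite (negligible_integral (measurableC mJ)) // setDE setCK setTI.
have muJ : mu setT = mu J.
  rewrite -(setUv J) measureU //; [|exact: measurableC|exact: setICr].
  by rewrite -[RHS]adde0; congr (_ + _)%E; exact: J0.
rewrite muJ -integral_cst //; apply: le_integral => //.
- apply/integrableP; split; first exact: measurable_cst.
  under eq_integral do rewrite /= .
  by rewrite integral_cst // lte_mul_pinfty // mu_fin.
- by apply: integrableS it.
- by move=> t; rewrite inE lee_fin => /Ja.
Qed.

Lemma sq_integral_fin (J : set TR) (a : R) : measurable J -> mu (~` J) = 0%E ->
  (forall t : R, J t -> `|t| <= a) -> (\int[mu]_t (t ^+ 2)%:E < +oo)%E.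
Proof.
move=> mJ J0 Ja.
rewrite (ge0_negligible_integral (measurableC mJ)) //; last 2 first.
  exact: measurable_sq.
  by move=> t _; rewrite lee_fin sqr_ge0.
rewrite setDE setCK setTI.
apply: (@le_lt_trans _ _ (\int[mu]_(t in J) (cst (a ^+ 2)%:E) t)%E).
  apply: ge0_le_integral => //=.
  - by move=> t _; rewrite lee_fin sqr_ge0.
  - by apply: measurable_funTS; exact: measurable_sq.
  - by move=> t Jt; rewrite lee_fin -(real_normK (num_real t)) ler_pXn2r ?nnegrE ?Ja // (le_trans _ (Ja _ Jt)).
by rewrite integral_cst // lte_mul_pinfty ?lee_fin ?sqr_ge0 // mu_fin.
Qed.

End RealMeasure.

Section Spectral.
Context {R : realType} {H : completeNormedModType R[i]}.
Variable (dot : {dot H for Num.conj}).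
Hypothesis hdot : hilbert_dot dot.
Local Notation ip := (rdot dot).
Local Notation nm := (@vnorm R H).
Implicit Types (x y z : H) (J K : set R).
Variables (T : unbounded_op H) (E : set R -> H -> H).
Hypothesis sT : self_adjoint dot T.
Hypothesis hE : spectral_measure dot T E.

Lemma E_proj J : measurable J -> orthogonal_projection dot (E J).
Proof. by case: hE => + _ _ _; apply. Qed.

Lemma E_lin J : measurable J -> linear (E J).
Proof. by move=> /E_proj[]. Qed.

Lemma E_idem J x : measurable J -> E J (E J x) = E J x.
Proof. by move=> /E_proj[_ + _]; apply. Qed.

Lemma E_setI J K x : measurable J -> measurable K -> E (J `&` K) x = E J (E K x).
Proof. by case: hE => _ _ + _ mJ mK; apply. Qed.

Lemma E_commute J K x : measurable J -> measurable K -> E J (E K x) = E K (E J x).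
Proof. by move=> mJ mK; rewrite -!E_setI // setIC. Qed.

Lemma E_ip J x : measurable J -> ip x (E J x) = nm (E J x) ^+ 2.
Proof.
move=> mJ; rewrite (nm2 hdot) (proj_ip _ _ (E_proj mJ)) E_idem //.
Qed.

Lemma spectral_mu x : exists mu : {measure set (measurableTypeR R) -> \bar R},
  [/\ forall J, measurable J -> mu J = (nm (E J x) ^+ 2)%:E,
      dom T x <-> (\int[mu]_t (t ^+ 2)%:E < +oo)%E &
      dom T x -> (ip x (T x))%:E = (\int[mu]_t t%:E)%E].
Proof.
have [mu [h1 h2 h3]] : exists mu : {measure set (measurableTypeR R) -> \bar R},
    [/\ forall J, measurable J -> mu J = (ip x (E J x))%:E,
        dom T x <-> (\int[mu]_t (t ^+ 2)%:E < +oo)%E &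
        dom T x -> (ip x (T x))%:E = (\int[mu]_t t%:E)%E].
  by case: hE => _ _ _ /(_ x).
by exists mu; split => // J mJ; rewrite h1 // E_ip.
Qed.

Lemma E_set0 x : E set0 x = 0.
Proof.
have [mu [h1 _ _]] := spectral_mu x; have := h1 _ measurable0.
by rewrite measure0 => -[/esym/eqP]; rewrite sqrf_eq0 => /eqP/nm0_eq0.
Qed.

Lemma E_setT x : E setT x = x. Proof. by case: hE. Qed.

(** Additivity of the measure of [x] gives
    [||x||^2 = ||E J x||^2 + ||E (~` J) x||^2]; as [E (~` J)] kills [E J x], it does
    not decrease the norm of [x - E J x], hence fixes that vector. *)
Lemma E_compl J x : measurable J -> E (~` J) x = x - E J x.
Proof.
move=> mJ; have mC := measurableC mJ.
have [mu [h1 _ _]] := spectral_mu x.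
have : mu setT = (mu J + mu (~` J))%E.
  by rewrite -[X in mu X](setUv J) measureU //; exact: setICr.
rewrite !h1 // -EFinD E_setT => -[h].
have p1 := proj_pyth hdot x (E_proj mJ).
have e1 : E (~` J) (x - E J x) = E (~` J) x.
  by rewrite (linB (E_lin mC)) -E_setI // setICl E_set0 subr0.
have p2 := proj_pyth hdot (x - E J x) (E_proj mC).
rewrite e1 in p2.
have : nm (x - E J x - E (~` J) x) ^+ 2 = 0 by lra.
by move=> /eqP; rewrite sqrf_eq0 => /eqP/nm0_eq0/eqP; rewrite subr_eq0 => /eqP.
Qed.

Lemma E_sub J K x : measurable J -> measurable K -> J `<=` K -> E K (E J x) = E J x.
Proof. by move=> mJ mK JK; rewrite -E_setI // setIidr. Qed.

Lemma E_subl J K x : measurable J -> measurable K -> J `<=` K -> E J (E K x) = E J x.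
Proof. by move=> mJ mK JK; rewrite -E_setI // setIidl. Qed.

Lemma E_sub_null J K x : measurable J -> measurable K -> J `<=` K -> E K x = 0 -> E J x = 0.
Proof. by move=> mJ mK JK xK; rewrite -(E_subl x mJ mK JK) xK (lin0 (E_lin mJ)). Qed.

Lemma E_setU J K x : measurable J -> measurable K ->
  E (J `|` K) x = E J x + E K (E (~` J) x).
Proof.
move=> mJ mK; have mJK := measurableU _ _ mJ mK; have mC := measurableC mJ.
have xE : x = E J x + E (~` J) x by rewrite E_compl // addrC subrK.
rewrite {1}xE (linD (E_lin mJK)) (E_sub x mJ mJK); last exact: subsetUl.
by congr (_ + _); rewrite -!E_setI // setIUl setICr set0U.
Qed.

(** The measure of [x] is the sum of the measures of its two components, so the
    integrals of [t^2] and [t] split. *)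
Lemma E_integrals J x : measurable J -> dom T x ->
  dom T (E J x) /\
  (dom T (E (~` J) x) ->
   ip x (T x) = ip (E J x) (T (E J x)) + ip (E (~` J) x) (T (E (~` J) x))).
Proof.
move=> mJ dx; have mC := measurableC mJ.
have [mu [h1 h2 h3]] := spectral_mu x.
have [m1 [k1 k2 k3]] := spectral_mu (E J x).
have [m2 [l1 l2 l3]] := spectral_mu (E (~` J) x).
have fin (m : {measure set (measurableTypeR R) -> \bar R}) y :
    (forall K, measurable K -> m K = (nm (E K y) ^+ 2)%:E) -> (m setT < +oo)%E.
  by move=> ->; rewrite ?ltry.
have add K : measurable K -> measure_add m1 m2 K = mu K.
  move=> mK; rewrite measure_addE h1 // k1 // l1 // -EFinD; congr EFin.
  rewrite (E_commute _ mK mJ) (E_commute _ mK mC) E_compl //.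
  by rewrite [RHS](proj_pyth hdot _ (E_proj mJ)).
have sq : (\int[mu]_t (t ^+ 2)%:E = \int[m1]_t (t ^+ 2)%:E + \int[m2]_t (t ^+ 2)%:E)%E.
  rewrite -ge0_integral_measure_add //; last 2 first.
    by move=> t _; rewrite lee_fin sqr_ge0.
    exact: measurable_sq.
  by apply: eq_measure_integral => K mK _; exact/esym/add.
have pos (m : {measure set (measurableTypeR R) -> \bar R}) : (0 <= \int[m]_t (t ^+ 2)%:E)%E.
  by apply: integral_ge0 => t _; rewrite lee_fin sqr_ge0.
have dJ : dom T (E J x).
  apply/k2; have /h2 := dx; rewrite sq; apply: le_lt_trans.
  by rewrite leeDl.
split => // dC; apply: EFin_inj; rewrite EFinD h3 // k3 // l3 //.
rewrite -integral_measure_add //.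
- by apply: eq_measure_integral => K mK _; exact/esym/add.
- by apply: (integrable_id (fin _ _ k1)); apply/k2.
- by apply: (integrable_id (fin _ _ l1)); apply/l2.
Qed.

Lemma E_dom J x : measurable J -> dom T x -> dom T (E J x).
Proof. by move=> mJ dx; case: (E_integrals mJ dx). Qed.

(** The spectral integral of [x] is the sum of those of [E J x] and of its
    complement, so the mixed terms of the form of [T] vanish; by polarization
    [T] does not mix the two ranges. *)
Lemma E_reduces J : measurable J -> reduces (E J) T.
Proof.
have cross K a b : measurable K -> dom T a -> dom T b ->
    ip (E K a) (T (E (~` K) b)) = 0.
  move=> mK da db; have mC := measurableC mK.
  have [dKa dCb] := (E_dom mK da, E_dom mC db).
  have dx := lin_subspaceD (sa_sub sT) dKa dCb.
  have [_ /(_ (E_dom mC dx))] := E_integrals mK dx.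
  have -> : E K (E K a + E (~` K) b) = E K a.
    by rewrite (linD (E_lin mK)) E_idem // -E_setI // setICr E_set0 addr0.
  have -> : E (~` K) (E K a + E (~` K) b) = E (~` K) b.
    by rewrite (linD (E_lin mC)) E_idem // -E_setI // setICl E_set0 add0r.
  rewrite (op_add (sa_lin sT)) // ipDl !ipDr.
  rewrite (ipC dot (E (~` K) b) (T (E K a))) (sa_ip sT) //; lra.
have off K b : measurable K -> dom T b -> E K (T (E (~` K) b)) = 0.
  move=> mK db; case: (sT) => _ dT _; apply: (dense_orth hdot dT) => a da.
  by rewrite ipC -(proj_ip _ _ (E_proj mK)); apply: cross.
move=> mJ x dx; have mC := measurableC mJ; have dJ := E_dom mJ dx; split => //.
have o1 := off _ _ mJ dx; have o2 := off _ _ mC dx.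
rewrite setCK in o2; rewrite E_compl // in o2; move/eqP: o2; rewrite subr_eq0 => /eqP ->.
have xE : x = E J x + E (~` J) x by rewrite E_compl // addrC subrK.
rewrite {2}xE (op_add (sa_lin sT)) //; last exact: E_dom.
by rewrite (linD (E_lin mJ)) o1 addr0.
Qed.

Lemma mu_compl J x (mu : {measure set (measurableTypeR R) -> \bar R}) :
  (forall K, measurable K -> mu K = (nm (E K x) ^+ 2)%:E) ->
  measurable J -> E J x = x -> mu (~` J) = 0%E.
Proof.
move=> h mJ xJ; rewrite h; last exact: measurableC.
by rewrite E_compl // xJ subrr nm0 expr0n.
Qed.

Lemma E_le J a x : measurable J -> (forall t, J t -> t <= a) -> dom T x -> E J x = x ->
  ip x (T x) <= a * nm x ^+ 2.
Proof.
move=> mJ Ja dx xJ; have [mu [h1 h2 h3]] := spectral_mu x.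
have fin : (mu setT < +oo)%E by rewrite h1 ?ltry.
rewrite -lee_fin h3 //; have := integral_le_cst fin mJ (mu_compl h1 mJ xJ) Ja.
rewrite h1 // E_setT EFinM; apply; apply: integrable_id => //; exact/h2.
Qed.

Lemma E_ge J a x : measurable J -> (forall t, J t -> a <= t) -> dom T x -> E J x = x ->
  a * nm x ^+ 2 <= ip x (T x).
Proof.
move=> mJ Ja dx xJ; have [mu [h1 h2 h3]] := spectral_mu x.
have fin : (mu setT < +oo)%E by rewrite h1 ?ltry.
rewrite -lee_fin h3 //; have := integral_ge_cst fin mJ (mu_compl h1 mJ xJ) Ja.
rewrite h1 // E_setT EFinM; apply; apply: integrable_id => //; exact/h2.
Qed.

Lemma E_bounded_dom J a x : measurable J -> (forall t, J t -> `|t| <= a) -> E J x = x ->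
  dom T x.
Proof.
move=> mJ Ja xJ; have [mu [h1 h2 h3]] := spectral_mu x.
have fin : (mu setT < +oo)%E by rewrite h1 ?ltry.
by apply/h2; exact: (sq_integral_fin fin mJ (mu_compl h1 mJ xJ) Ja).
Qed.

Lemma E_null_union (F : nat -> set R) x : (forall n, measurable (F n)) ->
  (forall n, E (F n) x = 0) -> E (\bigcup_n F n) x = 0.
Proof.
move=> mF F0; have [mu [h1 _ _]] := spectral_mu x.
have mU : measurable (\bigcup_n F n) by exact: bigcupT_measurable.
have : mu.-negligible (\bigcup_n F n).
  apply: negligible_bigcup => n; exists (F n); split => //; first exact: mF.
  by have := h1 _ (mF n); rewrite F0 nm0 expr0n /= => h; exact: h.
move=> /(negligibleP mu mU) h.
have [/eqP] : (nm (E (\bigcup_n F n) x) ^+ 2)%:E = 0%E by exact: etrans (esym (h1 _ mU)) h.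
by rewrite sqrf_eq0 => /eqP/nm0_eq0.
Qed.

Lemma E_approx J x (e : R) : measurable J -> 0 < e -> exists n, forall m, (n <= m)%N ->
  nm (E J x - E (J `&` `[- m%:R, m%:R]) x) < e.
Proof.
move=> mJ e0; have [mu [h1 _ _]] := spectral_mu x.
pose F n := J `&` `[- (n%:R : R), n%:R]%classic.
have mF n : measurable (F n) by apply: measurableI.
have FU : \bigcup_n F n = J.
  apply/seteqP; split => [t [n _ []]//|t Jt].
  have [n tn] : exists n : nat, `|t| <= n%:R.
    by exists (Num.bound `|t|); apply: ltW; apply: archi_boundP.
  by exists n => //; split => //; rewrite /= in_itv /= -ler_norml.
have cv : mu \o F @ \oo --> mu (\bigcup_n F n).
  apply: nondecreasing_cvg_mu => //; first by rewrite FU.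
  move=> n m nm'; apply/subsetPset => t [Jt /=]; rewrite in_itv /= => /andP[t1 t2].
  have nmR : (n%:R : R) <= m%:R by rewrite ler_nat.
  split => //; rewrite /= in_itv /=; apply/andP; split; lra.
have cv2 : (fun n => nm (E (F n) x) ^+ 2) @ \oo --> nm (E J x) ^+ 2.
  have cv' : mu \o F @ \oo --> (nm (E J x) ^+ 2)%:E by rewrite FU (h1 _ mJ) in cv.
  have /fine_cvgP[_] := cv'.
  have -> // : fine \o (mu \o F) = (fun n => nm (E (F n) x) ^+ 2).
  by apply/funext => n /=; rewrite (h1 _ (mF n)).
have e2 : 0 < e ^+ 2 by rewrite exprn_gt0.
move/cvgrPdist_lt : cv2 => /(_ _ e2)[n _ hn]; exists n => m /hn /= h.
have JF : F m `<=` J by move=> t [].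
have p1 := proj_pyth hdot (E J x) (E_proj (mF m)).
rewrite E_subl // in p1.
rewrite -(ltr_pXn2r (n := 2)) ?nnegrE ?nm_ge0 ?ltW //.
apply: le_lt_trans h; rewrite p1 addrAC subrr add0r; exact: ler_norm.
Qed.

End Spectral.

(** Covering a segment by finitely many of the intervals supplied at its
    points, in the form of an induction on the right end point. *)
Lemma segment_cover (R : realType) (a b : R) (Phi : set R -> Prop) : a <= b ->
  (forall J K : set R, measurable J -> measurable K -> J `<=` K -> Phi K -> Phi J) ->
  (forall J K : set R, measurable J -> measurable K -> Phi J -> Phi K -> Phi (J `|` K)) ->
  (forall q, a <= q <= b -> exists2 e : R, 0 < e & Phi `]q - e, q + e[%classic) ->
  Phi `[a, b]%classic.
Proof.
move=> ab sub union loc.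
pose S := [set t : R | a <= t <= b /\ Phi `[a, t]%classic].
have Sa : S a.
  split; first by rewrite lexx.
  have [|e e0 he] := loc a; first by rewrite lexx.
  apply: sub he => // t /=; rewrite !in_itv /= => /andP[h1 h2].
  by apply/andP; split; lra.
have hS : has_sup S by split; [exists a|exists b => t [/andP[]]].
pose s := sup S.
have as_ : a <= s by apply: ub_le_sup => //; exact: hS.2.
have sb : s <= b by apply: ge_sup; [exists a|move=> t [/andP[]]].
have [|e e0 he] := loc s; first by rewrite as_.
have [t [/andP[at_ tb] Pt] st] := sup_adherent e0 hS.
pose s' : R := Num.min b (s + e / 2).
have s'1 : s' <= s + e / 2 by rewrite ge_min lexx orbT.
have s'b : s' <= b by rewrite ge_min lexx.
have Ss' : S s'.
  split; first by rewrite s'b andbT le_min ab; have := e0; lra.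
  apply: sub (union _ _ _ _ Pt he) => //; first exact: measurableU.
  move=> u /=; rewrite !in_itv /= => /andP[u1 u2].
  by have [ut|ut] := leP u t; [left; rewrite u1|right; rewrite -/s in st *; apply/andP; split; lra].
have bs' : b <= s'.
  have : s' <= s by apply: ub_le_sup => //; exact: hS.2.
  by rewrite /s'; case: (leP b (s + e / 2)) => // h1; rewrite gerDl leNgt divr_gt0 //.
have sE : s' = b by apply/eqP; rewrite eq_le s'b bs'.
by case: Ss' => _; rewrite sE.
Qed.

Section Support.
Context {R : realType} {H : completeNormedModType R[i]}.
Variable (dot : {dot H for Num.conj}).
Hypothesis hdot : hilbert_dot dot.
Local Notation ip := (rdot dot).
Local Notation nm := (@vnorm R H).
Implicit Types (x y z : H) (J K : set R).
Variables (T : unbounded_op H) (E : set R -> H -> H).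
Hypothesis sT : self_adjoint dot T.
Hypothesis hE : spectral_measure dot T E.

Let V J := [set x | E J x = x].

(** Instance of [pos_form_sq] for [T - a], whose form is between [0] and [m] on the
    range of [E J]. *)
Lemma E_shift_sq J (a m : R) x : measurable J -> 0 < m ->
  (forall t, J t -> a <= t <= a + m) -> E J x = x ->
  nm (T x - a%:C *: x) ^+ 2 <= m * ip x (T x - a%:C *: x).
Proof.
move=> mJ m0 Jam xJ.
have dV y : E J y = y -> dom T y.
  apply: (E_bounded_dom hdot hE mJ (a := `|a| + m)) => t /Jam /andP[h1 h2].
  by rewrite ler_norml; have := ler_norm a; have := ler_norm (- a); rewrite normrN => h3 h4; apply/andP; split; lra.
have oJ := E_proj hE mJ; have [lJ iJ _] := oJ.
apply: (@pos_form_sq _ _ _ hdot (V J) (fun y => T y - a%:C *: y) m m0) => //.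
- exact: (proj_ran_sub oJ).
- by move=> c u v /dV du /dV dv; exact: (shift_lin sT).
- by move=> u v /dV du /dV dv; rewrite ipBl ipBr ipZl ipZr (sa_ip sT).
- move=> u uV; rewrite /V /= (linB lJ) (linZ lJ) -(E_reduces hdot sT hE mJ (dV _ uV)).2.
  by rewrite !uV.
- move=> u uV; rewrite ipBr ipZr -(nm2 hdot) subr_ge0.
  by apply: (E_ge hdot hE mJ _ (dV _ uV) uV) => t /Jam /andP[].
- move=> u uV; rewrite ipBr ipZr -(nm2 hdot) lerBlDr -mulrDl addrC.
  by apply: (E_le hdot hE mJ _ (dV _ uV) uV) => t /Jam /andP[].
Qed.

Lemma E_point (q : R) x : E [set q] x = x -> eigen_space T q%:C x.
Proof.
move=> xq; have mq : measurable [set q] by exact: measurable_set1.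
have dx : dom T x.
  by apply: (E_bounded_dom hdot hE mq (a := `|q|)) xq => t ->.
split => //.
have h1 : nm (T x - q%:C *: x) ^+ 2 <= 1 * ip x (T x - q%:C *: x).
  by apply: (E_shift_sq mq) xq => // t ->; rewrite lexx lerDl ler01.
have h2 : ip x (T x) <= q * nm x ^+ 2.
  by apply: (E_le hdot hE mq _ dx xq) => t ->.
rewrite ipBr ipZr -(nm2 hdot) in h1.
have : nm (T x - q%:C *: x) ^+ 2 <= 0 by lra.
rewrite le_eqVlt ltNge sqr_ge0 orbF sqrf_eq0 => /eqP/nm0_eq0/eqP.
by rewrite subr_eq0 => /eqP.
Qed.

(** Near [q] the operator [T - q] is smaller than its lower bound [c], so the
    range of the spectral projection is trivial. *)
Lemma E_resolvent_local (q c : R) x : 0 < c ->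
  (forall x, dom T x -> c * nm x <= nm (T x - q%:C *: x)) ->
  E `[q - c / 4, q + c / 4]%classic x = 0.
Proof.
move=> c0 hc; pose J := `[q - c / 4, q + c / 4]%classic.
have mJ : measurable J by exact: measurable_itv.
pose y := E J x; have yJ : E J y = y by rewrite (E_idem hE).
have Jam t : J t -> q - c / 4 <= t <= q - c / 4 + c / 2.
  by rewrite /J /= in_itv /= => /andP[h1 h2]; apply/andP; split; lra.
have dy : dom T y.
  apply: (E_bounded_dom hdot hE mJ (a := `|q| + c)) yJ => t /Jam /andP[h1 h2].
  by rewrite ler_norml; have := ler_norm q; have := ler_norm (- q); rewrite normrN => h3 h4; apply/andP; split; lra.
have c2 : 0 < c / 2 by rewrite divr_gt0.
have h := E_shift_sq mJ c2 Jam yJ.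
have hle := E_le hdot hE mJ (a := q + c / 4) _ dy yJ.
set w := T y - _ in h.
have h2 : ip y w <= c / 2 * nm y ^+ 2.
  rewrite /w ipBr ipZr -(nm2 hdot); have : ip y (T y) <= (q + c / 4) * nm y ^+ 2.
    by apply: hle => t /Jam /andP[]; lra.
  lra.
have h3 : nm w <= c / 2 * nm y.
  apply: nm_le_sq; first by rewrite mulr_ge0 ?nm_ge0 // ltW.
  apply: le_trans h _; have := ler_wpM2l (ltW c2) h2; lra.
have h4 : T y - q%:C *: y = w - (c / 4)%:C *: y.
  by rewrite /w rmorphB /= scalerBl opprB addrA addrAC addrK.
have := hc _ dy; rewrite h4 => h5.
have h6 := nmB w ((c / 4)%:C *: y).
rewrite nmZ gtr0_norm in h6; last by rewrite divr_gt0.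
apply: nm0_eq0; apply/eqP; rewrite eq_le nm_ge0 andbT.
have h7 : c * nm y <= 3 / 4 * (c * nm y) by lra.
by rewrite -(pmulr_rle0 _ c0); lra.
Qed.

Lemma E_resolvent_segment (a b : R) x : a <= b ->
  (forall q, a <= q <= b -> resolvent_set T q%:C) -> E `[a, b]%classic x = 0.
Proof.
move=> ab res; apply: (@segment_cover R a b (fun J => E J x = 0) ab).
- by move=> J K mJ mK JK; exact: (E_sub_null hE mJ mK JK).
- move=> J K mJ mK xJ xK; rewrite (E_setU hdot hE) // xJ add0r.
  by rewrite (E_compl hdot hE) // xJ subr0.
move=> q /res /resolvent_bound[c c0 hc]; exists (c / 4); first by rewrite divr_gt0.
have := E_resolvent_local x c0 hc; apply: (E_sub_null hE) => //.
by move=> t /=; rewrite !in_itv /= => /andP[h1 h2]; rewrite !ltW.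
Qed.

Lemma E_resolvent_open (a b : R) x :
  (forall q, a < q < b -> resolvent_set T q%:C) -> E `]a, b[%classic x = 0.
Proof.
move=> res.
pose F (n : nat) := `[a + n.+1%:R^-1, b - n.+1%:R^-1]%classic.
have F0 n : E (F n) x = 0.
  have n0 : 0 < n.+1%:R^-1 :> R by rewrite invr_gt0.
  have [ab|ab] := leP (a + n.+1%:R^-1) (b - n.+1%:R^-1).
    apply: E_resolvent_segment => // q /andP[h1 h2]; apply: res.
    by move: n0 h1 h2; set i := _^-1 => *; apply/andP; split; lra.
  have -> : F n = set0; last exact: (E_set0 hdot hE).
  rewrite -subset0 => t; rewrite /F /= in_itv /= => /andP[h1 h2].
  by move: ab; rewrite ltNge (le_trans h1 h2).
have mF n : measurable (F n) by exact: measurable_itv.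
have := E_null_union hdot hE mF F0.
apply: (E_sub_null hE) => //; first exact: bigcupT_measurable.
move=> t /=; rewrite in_itv /= => /andP[h1 h2].
have m0 : 0 < Num.min (t - a) (b - t) by rewrite lt_min !subr_gt0 h1.
have [n _ hn] := near_infty_natSinv_lt (PosNum m0).
have := hn n (leqnn n); rewrite /= lt_min => /andP[k1 k2].
exists n => //; rewrite /F /= in_itv /=; move: k1 k2; set i := _^-1 => *.
by apply/andP; split; lra.
Qed.

(** The list [s] of eigenvalues does not depend on [x], so that the range of
    [E J] is finite-dimensional when their multiplicities are finite. *)
Definition eigen_decomposed (Ev : R -> Prop) J :=
  exists s : seq R, (forall q, q \in s -> Ev q) /\
  forall x, exists zs : seq H,
    (forall z, z \in zs -> exists2 q, q \in s & eigen_space T q%:C z) /\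
    E J x = \sum_(z <- zs) z.

Lemma E_eigen J q x : measurable J -> eigen_space T q%:C x -> eigen_space T q%:C (E J x).
Proof.
move=> mJ [dx Ex]; have [dJ EJ] := E_reduces hdot sT hE mJ dx.
by split => //; rewrite EJ Ex (linZ (E_lin hE mJ)).
Qed.

Lemma isolated_interval (q : R) : isolated (spectrum T : set R[i]^o) q%:C ->
  exists2 e : R, 0 < e & forall t : R, 0 < `|t - q| < e -> resolvent_set T t%:C.
Proof.
case=> _ [U /nbhs_ballP[e /= e0 eU] UE].
have eE : e = (complex.Re e)%:C by rewrite RRe_real // gtr0_real.
exists (complex.Re e); first by move: e0; rewrite {1}eE ltcR.
move=> t /andP[t0 te]; apply: contrapT => nt.
have : (U `&` spectrum T) t%:C.
  split => //; apply: eU; rewrite -ball_normE /= -rmorphB /= eE.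
  by rewrite normc_def /= expr0n addr0 sqrtr_sqr ltcR distrC.
rewrite UE /= => -[tq]; by move: t0; rewrite tq subrr normr0 ltxx.
Qed.

(** By compactness finitely many intervals around points of the segment suffice,
    each of them containing at most one point of the spectrum. *)
Lemma finite_decomposition (a b : R) : a <= b ->
  (forall q, a <= q <= b -> resolvent_set T q%:C \/ (q < b /\ discrete_spectrum T q%:C)) ->
  eigen_decomposed (fun q => a <= q < b /\ discrete_spectrum T q%:C) `[a, b]%classic.
Proof.
move=> ab hres; apply: (@segment_cover R a b _ ab).
- move=> J K mJ mK JK [s [sE hs]]; exists s; split => // x.
  have [zs [hz Ez]] := hs x; exists (map (E J) zs); split.
    move=> _ /mapP[z /hz[q qs zq] ->]; exists q => //; exact: E_eigen.
  by rewrite -(E_subl hE x mJ mK JK) Ez (lin_sum (E_lin hE mJ)) big_map.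
- move=> J K mJ mK [s [sE hs]] [s' [sE' hs']]; exists (s ++ s'); split.
    by move=> q; rewrite mem_cat => /orP[/sE|/sE'].
  move=> x; have [zs [hz Ez]] := hs x; have [zs' [hz' Ez']] := hs' (E (~` J) x).
  exists (zs ++ zs'); split; last by rewrite (E_setU hdot hE) // Ez Ez' big_cat.
  move=> z; rewrite mem_cat => /orP[/hz|/hz'] [q qs zq]; exists q => //.
    by rewrite mem_cat qs.
  by rewrite mem_cat qs orbT.
move=> q qab; have [res|[qb dis]] := hres q qab.
  have [c c0 hc] := resolvent_bound res; exists (c / 4); first by rewrite divr_gt0.
  exists [::]; split => // x; exists [::]; split => //; rewrite big_nil.
  have := E_resolvent_local x c0 hc; apply: (E_sub_null hE) => //.
  by move=> t /=; rewrite !in_itv /= => /andP[h1 h2]; rewrite !ltW.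
have [iso _ _] := dis; have [e e0 he] := isolated_interval iso.
exists e => //; exists [:: q]; split.
  by move=> _ /[!inE] /eqP ->; split => //; case/andP: qab => ->.
move=> x; exists [:: E [set q] x].
have mq : measurable [set q] by exact: measurable_set1.
split.
  move=> _ /[!inE] /eqP ->; exists q; first by rewrite inE.
  by apply: E_point; rewrite (E_idem hE).
rewrite big_seq1.
have -> : `]q - e, q + e[%classic = [set q] `|` (`]q - e, q[ `|` `]q, q + e[)%classic.
  apply/seteqP; split => t /=; rewrite !in_itv /=.
    move=> /andP[h1 h2]; have [tq|tq|->] := ltgtP t q; last by left.
      by right; left; rewrite h1.
    by right; right; rewrite h2.
  by case=> [->|[]/andP[h1 h2]]; apply/andP; split; lra.
rewrite (E_setU hdot hE) //; last exact: measurableU.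
rewrite [X in _ + X](_ : _ = 0) ?addr0 // (E_setU hdot hE) //.
rewrite !E_resolvent_open ?addr0 // => t /andP[h1 h2]; apply: he.
  by rewrite gtr0_norm ?subr_gt0 //; apply/andP; split; lra.
by rewrite distrC gtr0_norm ?subr_gt0 //; apply/andP; split; lra.
Qed.

End Support.

(** * Eigenvalue enumerations and spans *)

Section Spans.
Context {R : realType} {H : completeNormedModType R[i]}.
Implicit Types (V : set H).

Definition in_span k (e : 'I_k -> H) : set H :=
  [set x | exists c : 'I_k -> R[i], x = \sum_(i < k) c i *: e i].

Lemma in_span_sub k (e : 'I_k -> H) : lin_subspace (in_span e).
Proof.
split; first by exists (fun=> 0); rewrite big1 // => i _; rewrite scale0r.
move=> a _ _ [c ->] [c' ->]; exists (fun i => a * c i + c' i).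
rewrite scaler_sumr -big_split; apply: eq_bigr => i _ /=.
by rewrite scalerDl scalerA.
Qed.

Lemma in_span_gen k (e : 'I_k -> H) i : in_span e (e i).
Proof.
exists (fun j => (j == i)%:R); rewrite (bigD1 i) //= eqxx scale1r big1 ?addr0 //.
by move=> j /negPf ->; rewrite scale0r.
Qed.

Lemma finite_span (I : eqType) (s : seq I) (V : I -> set H) :
  (forall i, i \in s -> exists n, has_dim (V i) n) ->
  exists k (e : 'I_k -> H), forall i x, i \in s -> V i x -> in_span e x.
Proof.
elim: s => [|j s IH] hs; first by exists 0%N, (fun=> 0).
have [|k [e he]] := IH; first by move=> i si; apply: hs; rewrite inE si orbT.
have [n [v [_ _ hv]]] := hs j (mem_head _ _).
pose f (i : 'I_(k + n)) := match fintype.split i with inl a => e a | inr b => v b end.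
have fl i : f (lshift n i) = e i by rewrite /f (unsplitK (inl i)).
have fr i : f (rshift k i) = v i by rewrite /f (unsplitK (inr i)).
exists (k + n)%N, f => i x; rewrite inE => /orP[/eqP -> Vx|si Vx].
  have [c ->] := hv _ Vx; apply: lin_subspace_sum; first exact: in_span_sub.
  by move=> a _; apply: lin_subspaceZ; [exact: in_span_sub|rewrite -fr; exact: in_span_gen].
have [c ->] := he _ _ si Vx; apply: lin_subspace_sum; first exact: in_span_sub.
by move=> a _; apply: lin_subspaceZ; [exact: in_span_sub|rewrite -fl; exact: in_span_gen].
Qed.

Lemma has_dim_nat V m : has_dim V m -> exists v : nat -> H,
  [/\ forall c : nat -> R[i], \sum_(i < m) c i *: v i = 0 -> forall i, (i < m)%N -> c i = 0,
      forall i, (i < m)%N -> V (v i) &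
      forall x, V x -> exists c : nat -> R[i], x = \sum_(i < m) c i *: v i].
Proof.
case=> v [fv vV hv]; pose v' (i : nat) := oapp v 0 (insub i).
have v'E (i : 'I_m) : v' i = v i by rewrite /v' valK.
exists v'; split.
- move=> c h i im; have h' : \sum_(i < m) c i *: v i = 0.
    by apply: etrans h; apply: eq_bigr => j _; rewrite v'E.
  exact: (fv (fun i : 'I_m => c i) h' (Ordinal im)).
- by move=> i im; have -> : v' i = v (Ordinal im) := v'E (Ordinal im).
- move=> x /hv[c ->]; exists (fun i => oapp c 0 (insub i)).
  by apply: eq_bigr => i _; rewrite v'E valK.
Qed.

End Spans.

Section Enumeration.
Context {R : realType} {H : completeNormedModType R[i]}.
Variable A : unbounded_op H.
Variables (g : R) (lam : nat -> \bar R).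
Hypothesis hlam : eigenvalue_enumeration A g lam.

Lemma enumeration_ge k : (lambda_infty A g <= lam k)%E.
Proof. by case: hlam => _ /(_ k)[->//|[l [h _ _ ->]]] _; exact: ltW. Qed.

(** Bases and bijections are chosen for all eigenvalues at once, so that the basis
    vectors can be distributed over the indices of the enumeration. *)
Lemma enumeration_basis : exists (m : R -> nat) (v : R -> nat -> H) (f : R -> nat -> nat),
  forall q : R, (lambda_infty A g < q%:E)%E -> q < g ->
  [/\ forall c : nat -> R[i], \sum_(i < m q) c i *: v q i = 0 ->
        forall i, (i < m q)%N -> c i = 0,
      forall i, (i < m q)%N -> eigen_space A q%:C (v q i),
      forall x, eigen_space A q%:C x ->
        exists c : nat -> R[i], x = \sum_(i < m q) c i *: v q i &
      set_bij [set j | lam j = q%:E] `I_(m q) (f q)].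
Proof.
have [_ _ mult] := hlam.
have ex (q : R) : exists mvf : nat * (nat -> H) * (nat -> nat),
  (lambda_infty A g < q%:E)%E -> q < g ->
  [/\ forall c : nat -> R[i], \sum_(i < mvf.1.1) c i *: mvf.1.2 i = 0 ->
        forall i, (i < mvf.1.1)%N -> c i = 0,
      forall i, (i < mvf.1.1)%N -> eigen_space A q%:C (mvf.1.2 i),
      forall x, eigen_space A q%:C x ->
        exists c : nat -> R[i], x = \sum_(i < mvf.1.1) c i *: mvf.1.2 i &
      set_bij [set j | lam j = q%:E] `I_(mvf.1.1) mvf.2].
  have [h1|h1] := pselect ((lambda_infty A g < q%:E)%E /\ q < g); last first.
    by exists (0%N, fun=> 0, id) => a b; case: h1.
  case: h1 => h1 h2; have [m dm /card_set_bijP[f bf]] := mult q h1 h2.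
  have [v [v1 v2 v3]] := has_dim_nat dm.
  by exists (m, v, f).
have [F hF] := choice ex.
by exists (fun q => (F q).1.1), (fun q => (F q).1.2), (fun q => (F q).2).
Qed.

(** An eigenvalue that is at least [l] occurs only among the first [k] entries, as
    the enumeration is non-increasing; there are as many occurrences as basis
    vectors of the eigenspace. *)
Lemma enumeration_span (l : R) k : (lam k < l%:E)%E ->
  exists e : 'I_k -> H, forall q x, l <= q < g -> eigen_space A q%:C x -> in_span e x.
Proof.
move=> kl; have [homo _ _] := hlam; have [m [v [f hf]]] := enumeration_basis.
pose e (j : 'I_k) : H := v (fine (lam j)) (f (fine (lam j)) j).
exists e => q x /andP[lq qg] Vx.
have iq : (lambda_infty A g < q%:E)%E.
  by apply: le_lt_trans (enumeration_ge k) (lt_le_trans kl _); rewrite lee_fin.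
have [_ _ hspan [_ _ surj]] := hf q iq qg.
have [c ->] := hspan x Vx; apply: lin_subspace_sum; first exact: in_span_sub.
move=> i _; apply: lin_subspaceZ; first exact: in_span_sub.
have [j /= jq ji] := surj i (ltn_ord i).
have jk : (j < k)%N.
  rewrite ltnNge; apply/negP => /homo; rewrite jq => h.
  have : (q%:E < l%:E)%E by exact: le_lt_trans h kl.
  by rewrite lte_fin ltNge lq.
have := in_span_gen e (Ordinal jk); rewrite /e /= jq /= ji; exact.
Qed.

Variable dot : {dot H for Num.conj}.
Hypothesis hdot : hilbert_dot dot.
Hypothesis sA : self_adjoint dot A.

(** The entries up to [k] are eigenvalues between [l] and [g].  In a vanishing
    combination the part belonging to one eigenvalue vanishes by orthogonality,
    and within it distinct indices carry distinct basis vectors. *)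
Lemma enumeration_free (l : R) k : lam k = l%:E -> (lambda_infty A g < l%:E)%E ->
  exists (w : 'I_k.+1 -> H) (t : 'I_k.+1 -> R),
    [/\ forall i, dom A (w i), forall i, A (w i) = (t i)%:C *: w i,
        forall i, l <= t i < g & free_family w].
Proof.
move=> kl il; have [homo vals _] := hlam; have [m [v [f hf]]] := enumeration_basis.
pose t (i : 'I_k.+1) : R := fine (lam i).
have tP (i : 'I_k.+1) : [/\ lam i = (t i)%:E, l <= t i, t i < g & (lambda_infty A g < (t i)%:E)%E].
  have li : (l%:E <= lam i)%E by rewrite -kl; apply: homo; rewrite -ltnS.
  have [E|[q [iq qg _ E]]] := vals i.
    by move: li; rewrite E leNgt il.
  by rewrite /t E /=; split => //; rewrite E lee_fin in li.
pose w (i : 'I_k.+1) : H := v (t i) (f (t i) i).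
have fm (i : 'I_k.+1) : (f (t i) i < m (t i))%N.
  have [Ei _ qg iq] := tP i; have [_ _ _ [+ _ _]] := hf _ iq qg; by apply.
have wE (i : 'I_k.+1) : eigen_space A (t i)%:C (w i).
  have [Ei _ qg iq] := tP i; have [_ + _ _] := hf _ iq qg; apply; exact: fm.
exists w, t; split; try by move=> i; case: (wE i).
  by move=> i; have [_ -> -> _] := tP i.
move=> c h j0; pose q := t j0.
pose G := \sum_(j | t j == q) c j *: w j.
have dw j : dom A (w j) by case: (wE j).
have orth i j : t i != t j -> dot (w i) (w j) = 0.
  by move=> tij; apply: (eigen_orth sA _ _ (wE i).2 (wE j).2 tij).
have dotsl (P : pred 'I_k.+1) y : dot (\sum_(j | P j) c j *: w j) y = \sum_(j | P j) c j * dot (w j) y.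
  elim/big_rec2 : _ => [|j ? ? _ <-]; first by rewrite linear0l.
  by rewrite dotDl dotZl.
have G0 : G = 0.
  have oG i : t i != q -> dot (w i) G = 0.
    move=> ti; rewrite dotC dotsl big1 ?rmorph0 // => j /eqP tj.
    by rewrite orth ?mulr0 // tj eq_sym.
  have : dot (\sum_j c j *: w j) G = dot G G.
    rewrite dotsl [in RHS]/G dotsl (bigID (fun j => t j == q)) /= [X in _ + X]big1 ?addr0 //.
    by move=> j ti; rewrite oG ?mulr0.
  rewrite h linear0l => /esym/eqP; rewrite hdot sqrf_eq0 normr_eq0 => /eqP //.
have [_ _ qg iq] := tP j0; have [hfree _ _ [_ finj _]] := hf q iq qg.
pose c' (i : nat) := \sum_(j | (t j == q) && (f q j == i)) c j.
have G1 : \sum_(i < m q) c' i *: v q i = 0.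
  rewrite -[RHS]G0 /G; under eq_bigr do rewrite scaler_suml.
  rewrite (exchange_big_dep (fun j => t j == q)) /=; last by move=> i j _ /andP[].
  apply: eq_bigr => j tj; have fj : (f q j < m q)%N by rewrite -(eqP tj); exact: fm.
  rewrite (big_pred1 (Ordinal fj)) /=; first by rewrite /w (eqP tj).
  by move=> i; rewrite /= tj -val_eqE /= eq_sym.
have := hfree c' G1 (f q j0) (fm j0); rewrite /c' (bigD1 j0) ?eqxx //= big1 ?addr0 //.
move=> j /andP[/andP[/eqP tj /eqP fj] nj]; case/eqP: nj; apply: val_inj.
apply: finj => //; rewrite inE /=; have [Ej _ _ _] := tP j; first by rewrite Ej tj.
by have [-> _ _ _] := tP j0.
Qed.

End Enumeration.

(** * Comparison of the two operators *)

Section Tools.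
Context {R : realType} {H : completeNormedModType R[i]}.
Variable (dot : {dot H for Num.conj}).
Hypothesis hdot : hilbert_dot dot.
Local Notation ip := (rdot dot).
Local Notation nm := (@vnorm R H).
Implicit Types (x y z : H) (J K : set R).

Lemma proj_complement P : orthogonal_projection dot P ->
  orthogonal_projection dot (fun x => x - P x).
Proof.
move=> oP; have [lP idP _] := oP.
have lQ : linear (fun x => x - P x).
  by move=> a x y; rewrite lP scalerBr opprD addrACA.
split => //; first by move=> x; rewrite (proj_compl0 _ oP) subr0.
apply/(symmetric_opP dot lQ) => x y.
by rewrite ipBl ipBr (proj_ip _ _ oP).
Qed.

Lemma reduces_complement P (A : unbounded_op H) : linear_op A -> reduces P A ->
  reduces (fun x => x - P x) A.
Proof.
move=> lA red x dx; have [dPx APx] := red x dx.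
by split; [exact: lin_subspaceB (dom_sub lA) dx dPx|rewrite (op_sub lA) // APx].
Qed.

Lemma reduces_opp P (A : unbounded_op H) : linear P -> reduces P A -> reduces P (op_opp A).
Proof. by move=> lP red x dx; have [? E] := red x dx; split => //=; rewrite E linN. Qed.

Lemma resolvent_shift (A A' : unbounded_op H) (z z' : R[i]) : dom A' = dom A ->
  (forall x, A x - z *: x = A' x - z' *: x) -> resolvent_set A z -> resolvent_set A' z'.
Proof.
move=> dE hA [S [bS h1 h2]]; exists S; split => // [x|y].
  by rewrite dE -hA; exact: h1.
by rewrite dE -hA; exact: h2.
Qed.

Lemma op_norm_bound (D : H -> H) x : linear D -> (op_norm D < +oo)%E ->
  nm (D x) <= fine (op_norm D) * nm x.
Proof.
move=> lD fin.
have ub y : nm y <= 1 -> ((nm (D y))%:E <= op_norm D)%E.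
  by move=> y1; apply: ereal_sup_ubound; exists y => //=; rewrite nmE lecR.
have f0 : (op_norm D \is a fin_num)%E.
  have := ub 0; rewrite nm0 ler01 => /(_ isT) h.
  by rewrite fin_real // (lt_le_trans _ h) ?ltNyr.
have [->|x0] := eqVneq x 0; first by rewrite (lin0 lD) nm0 mulr0.
have n0 := nm_gt0 x0.
have := ub ((nm x)^-1%:C *: x); rewrite nmZ gtr0_norm ?invr_gt0 // mulVf ?gt_eqF //.
rewrite lexx (linZ lD) nmZ gtr0_norm ?invr_gt0 // => /(_ isT).
by rewrite -(fineK f0) lee_fin ler_pdivrMl // mulrC.
Qed.

(** Finite constants between the norm of [D] and the distance, which is infinite
    when [X] is empty. *)
Lemma separation_constants (D : H -> H) (g : R) (X : set R[i]) : linear D ->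
  (op_norm D < dist_set g%:C X)%E ->
  exists b d : R, [/\ 0 <= b, b < d, forall x, nm (D x) <= b * nm x &
    forall s : R, X s%:C -> d <= `|g - s|].
Proof.
move=> lD lt.
have fin : (op_norm D < +oo)%E by apply: lt_le_trans lt (leey _).
have pos : (0 <= op_norm D)%E.
  apply: ereal_sup_ubound; exists 0; first by rewrite /= normr0.
  by rewrite (lin0 lD) normr0.
have f0 : (op_norm D \is a fin_num)%E by rewrite ge0_fin_numE.
pose b : R := fine (op_norm D).
have b0 : 0 <= b by apply: fine_ge0.
have bE : op_norm D = b%:E by rewrite fineK.
have [d bd dX] : exists2 d : R, b < d & (d%:E <= dist_set g%:C X)%E.
  move: lt; rewrite bE; case: (dist_set g%:C X) => [r|_|//].
    by rewrite lte_fin => br; exists r.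
  by exists (b + 1); rewrite ?ltrDl ?leey.
exists b, d; split => //; first by move=> x; exact: op_norm_bound.
move=> s Xs; rewrite -lee_fin; apply: le_trans dX _.
apply: ereal_inf_lbound; exists s%:C => //.
by rewrite -rmorphB normc_def /= expr0n addr0 sqrtr_sqr.
Qed.

Variables (T : unbounded_op H) (E : set R -> H -> H).
Hypothesis sT : self_adjoint dot T.
Hypothesis hE : spectral_measure dot T E.

(** Strictness comes from a nonzero component of [u] in some ]-oo, l - 1/(n+1)]. *)
Lemma E_lt (l : R) u : dom T u -> E `]-oo, l[%classic u = u -> u != 0 ->
  ip u (T u) < l * nm u ^+ 2.
Proof.
move=> du uJ u0.
pose J : set R := `]-oo, l[%classic; have mJ : measurable J by exact: measurable_itv.
pose F (n : nat) : set R := `]-oo, l - n.+1%:R^-1]%classic.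
have mF n : measurable (F n) by exact: measurable_itv.
have FJ n : F n `<=` J.
  move=> t; rewrite /F /J /= !in_itv /= => h; apply: le_lt_trans h _.
  by rewrite ltrBlDr ltrDl invr_gt0.
have [n hn] : exists n, E (F n) u <> 0.
  apply/existsNP => h; move/eqP: u0; apply; rewrite -uJ.
  have h' := E_null_union hdot hE mF h; move: h'.
  apply: (E_sub_null hE) => //; first exact: bigcupT_measurable.
  move=> t /=; rewrite in_itv /= => tl.
  have m0 : 0 < l - t by rewrite subr_gt0.
  have [n _ hn] := near_infty_natSinv_lt (PosNum m0).
  have := hn n (leqnn n); rewrite /= => k1; exists n => //.
  by rewrite /F /= in_itv /=; move: k1; set i := _^-1 => *; lra.
have mC := measurableC (mF n).
have [dF hform] := E_integrals hdot hE (mF n) du.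
have dC : dom T (E (~` F n) u) by exact: (E_dom hdot hE mC du).
have a0 : 0 < n.+1%:R^-1 :> R by rewrite invr_gt0.
have h1 : ip (E (F n) u) (T (E (F n) u)) <= (l - n.+1%:R^-1) * nm (E (F n) u) ^+ 2.
  apply: (E_le hdot hE (mF n) _ dF); last exact: (E_idem hE).
  by move=> t; rewrite /F /= in_itv.
have h2 : ip (E (~` F n) u) (T (E (~` F n) u)) <= l * nm (E (~` F n) u) ^+ 2.
  apply: (E_le hdot hE mJ _ dC).
    by move=> t; rewrite /J /= in_itv /= => /ltW.
  by rewrite (E_commute hE) // uJ.
have h3 : 0 < nm (E (F n) u) ^+ 2 by rewrite exprn_gt0 // nm_gt0 //; apply/eqP.
rewrite (hform dC) (proj_pyth hdot u (E_proj hE (mF n))) -(E_compl hdot hE) //.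
move: h1 h2 h3 a0; set i := _^-1; set X := nm _ ^+ 2; set Y := nm _ ^+ 2 => h1 h2 h3 a0.
have := mulr_gt0 a0 h3; lra.
Qed.

(** The projections [E (J `&` [-n, n])] satisfy the hypotheses of [davis_kahan]
    with the same [e] and converge strongly to [E J]. *)
Lemma angle_bound (S T' : unbounded_op H) (D : H -> H) (b d e : R) (p : H -> H) J :
  self_adjoint dot S -> self_adjoint dot T' -> dom T' = dom S -> dom T = dom S ->
  (forall x, dom S x -> T' x = S x + D x) ->
  0 <= b -> (forall x, nm (D x) <= b * nm x) -> 0 < d ->
  orthogonal_projection dot p -> reduces p S ->
  (forall x, dom S x -> d * nm x <= nm (S x)) ->
  (forall x, dom S x -> p x = x -> ip x (S x) <= - (d * nm x ^+ 2)) ->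
  (forall K, measurable K -> reduces (E K) T') ->
  measurable J -> 0 < e ->
  (forall x, dom T x -> E J x = x -> e * nm x ^+ 2 <= ip x (T' x)) ->
  (forall m, exists M : R, forall x, dom T x -> E (J `&` `[- m, m]) x = x ->
     ip x (T' x) <= M * nm x ^+ 2) ->
  forall x, p x = x -> (d + e) * nm (E J x) <= b * nm x.
Proof.
move=> sS sT' dT' dT TE b0 bD d0 op redp gap neg redE mJ e0 ge le x px.
have de0 : 0 < d + e by rewrite addr_gt0.
apply/ler_addgt0Pr => r r0.
have [n hn] := E_approx hdot hE x mJ (divr_gt0 r0 de0).
have {hn} := hn n (leqnn n); set K := J `&` _ => hn.
have mK : measurable K by apply: measurableI => //; exact: measurable_itv.
have KJ : K `<=` J by move=> t [].
have [M hM] := le n%:R.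
pose M' : R := Num.max M (e + 1).
have eM : e < M' by rewrite lt_max ltrDl ltr01 orbT.
have dK y : E K y = y -> dom T y.
  move=> yK; apply: (E_bounded_dom hdot hE mK (a := n%:R)) yK => t [_ /=].
  by rewrite in_itv /= ler_norml.
have fK y : E K y = y -> e * nm y ^+ 2 <= ip y (T' y) <= M' * nm y ^+ 2.
  move=> yK; have dy := dK y yK; apply/andP; split.
    by apply: ge => //; rewrite -yK (E_sub hE).
  apply: le_trans (hM y dy yK) _; apply: ler_wpM2r; first exact: sqr_ge0.
  by rewrite le_max lexx.
have dK' y : E K y = y -> dom T' y by rewrite dT' -dT; exact: dK.
have h := davis_kahan hdot sS sT' dT' TE b0 bD d0 op redp gap neg (E_proj hE mK) (redE _ mK) e0 eM dK' fK px.
have h2 := nm_dist (E J x) (E K x) 0; rewrite !subr0 in h2.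
have h3 : (d + e) * nm (E J x - E K x) <= r.
  by rewrite mulrC -ler_pdivlMr // ltW.
have := ler_wpM2l (ltW de0) h2; rewrite mulrDr; move: h h3; lra.
Qed.

End Tools.

Section Comparison.
Context {R : realType} {H : completeNormedModType R[i]}.
Variable (dot : {dot H for Num.conj}).
Hypothesis hdot : hilbert_dot dot.
Local Notation ip := (rdot dot).
Local Notation nm := (@vnorm R H).
Implicit Types (x y z : H) (J K : set R).
Variables (A : unbounded_op H) (B C : {linear H -> H}).
Hypothesis sA : self_adjoint dot A.
Hypotheses (sB : symmetric_op dot B) (sC : symmetric_op dot C).
Variable g : R.
Hypothesis hg : resolvent_set (perturb A C) g%:C.
Variable E : set R -> H -> H.
Hypothesis hE : spectral_measure dot (perturb A B) E.
Hypothesis hBC : forall x, range (E `]-oo, g]%classic) x -> dot x (C x) <= dot x (B x).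
Variables b d : R.
Hypotheses (b0 : 0 <= b) (bd : b < d).
Hypothesis bD : forall x, nm (B x - C x) <= b * nm x.
Hypothesis dC : forall s : R, spectrum (perturb A C) s%:C -> d <= `|g - s|.

Let SC := perturb A C.
Let TB := perturb A B.
Let D x := B x - C x.
Let S := perturb A (fun x => C x - g%:C *: x).
Let T := perturb A (fun x => B x - g%:C *: x).
Let e : R := (d - b) / 2.
Let c : R := b / (d + e).

Let e0 : 0 < e. Proof. by rewrite divr_gt0 // subr_gt0. Qed.
Let d0 : 0 < d. Proof. exact: le_lt_trans bd. Qed.
Let de0 : 0 < d + e. Proof. by rewrite addr_gt0. Qed.
Let c0 : 0 <= c. Proof. by rewrite divr_ge0 // ltW. Qed.
Let c1 : c < 1.
Proof. by rewrite ltr_pdivrMr // mul1r; apply: lt_trans bd _; rewrite ltrDl. Qed.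

Let sSC : self_adjoint dot SC.
Proof. by apply: perturb_sa => //; [exact: linearP|exact/(symmetric_opP dot (@linearP _ _ _ _ C))]. Qed.
Let sTB : self_adjoint dot TB.
Proof. by apply: perturb_sa => //; [exact: linearP|exact/(symmetric_opP dot (@linearP _ _ _ _ B))]. Qed.

Let shift_sa (F : {linear H -> H}) : symmetric_op dot F ->
  self_adjoint dot (perturb A (fun x => F x - g%:C *: x)).
Proof.
move=> sF; apply: perturb_sa => // [a x y|x y].
  by rewrite linearP !scalerDr opprD addrACA scalerN !scalerA (mulrC a).
by rewrite ipBl ipBr ipZl ipZr; move/(symmetric_opP dot (@linearP _ _ _ _ F)) : sF => ->.
Qed.

Let sS : self_adjoint dot S. Proof. exact: shift_sa. Qed.
Let sT : self_adjoint dot T. Proof. exact: shift_sa. Qed.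

Let lD : linear D.
Proof. by move=> a x y; rewrite /D (linearP B) (linearP C) opprD addrACA scalerBr. Qed.

Let TE x : dom S x -> T x = S x + D x.
Proof. by move=> _; rewrite /= /D; apply: (ip_ext hdot) => z; rewrite !(ipDl, ipNl); ring. Qed.

Let SE x : S x = SC x - g%:C *: x. Proof. by rewrite /= addrA. Qed.
Let TTB x : T x = TB x - g%:C *: x. Proof. by rewrite /= addrA. Qed.

Let gapS x : dom S x -> d * nm x <= nm (S x).
Proof.
apply: (gap_bound hdot sS d0).
  by apply: resolvent_shift hg => // y; rewrite SE scale0r subr0.
move=> s ns; have := @dC (s + g) _; rewrite opprD addrCA subrr addr0 normrN; apply.
move=> res; apply: ns; apply: resolvent_shift res => // y.
by rewrite SE rmorphD /= scalerDl opprD addrA addrAC.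
Qed.

Let redE K : measurable K -> reduces (E K) T.
Proof.
move=> mK x dx; have [dEx Ex] := E_reduces hdot sTB hE mK dx.
split => //; rewrite !TTB Ex (linB (E_lin hE mK)) (linZ (E_lin hE mK)) //.
Qed.

(** [||T x|| >= ||S x|| - ||D x|| >= 2 e ||x||] leaves the lower bound [e] at the
    points within distance [e] of [g]. *)
Let resB (q : R) : g - e <= q <= g + e -> resolvent_set TB q%:C.
Proof.
move=> /andP[q1 q2]; apply: (real_resolvent hdot sTB e0) => x dx.
have h1 := gapS dx; have h2 := bD x.
have h3 : nm (S x) <= nm (T x) + nm (D x) by rewrite -(addrK (D x) (S x)) -TE // nmB.
have h4 : nm (T x) <= nm (TB x - q%:C *: x) + e * nm x.
  have -> : T x = TB x - q%:C *: x + (q - g)%:C *: x.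
    by rewrite TTB rmorphB /= scalerBl addrA subrK.
  apply: le_trans (nmD _ _) _; rewrite lerD2l nmZ ler_wpM2r ?nm_ge0 //.
  by rewrite ler_norml; apply/andP; split; lra.
have h5 : d * nm x - b * nm x = 2 * (e * nm x) by rewrite /e; field.
move: h1 h2 h3 h4 h5; rewrite -/(D x); lra.
Qed.

Let E_gap K x : measurable K -> K `<=` `[g - e, g + e]%classic -> E K x = 0.
Proof.
move=> mK Kg; apply: (E_sub_null hE mK _ Kg); first exact: measurable_itv.
by apply: (E_resolvent_segment hdot sTB hE x _ resB); have := e0; lra.
Qed.

Let E_drop J K x : measurable J -> measurable K -> J `<=` K ->
  K `\` J `<=` `[g - e, g + e]%classic -> E K x = E J x.
Proof.
move=> mJ mK JK KJ; have mD : measurable (K `\` J) by exact: measurableD.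
have -> : E K x = E (K `\` J `|` J) x by rewrite setUC setDUK.
rewrite (E_setU hdot hE) // (E_compl hdot hE) //.
by rewrite (E_gap x mD KJ) subr0 add0r.
Qed.

Let P := E `]-oo, g]%classic.
Let mP : measurable (`]-oo, g]%classic : set R). Proof. exact: measurable_itv. Qed.

Let P_neg x : P x = E `]-oo, g - e[%classic x.
Proof.
apply: E_drop => //.
- by move=> t /=; rewrite !in_itv /=; have := e0; lra.
- by move=> t [] /=; rewrite !in_itv /= => h1 /negP; rewrite -leNgt => h2; have e1 := e0; apply/andP; split; lra.
Qed.

Let P_pos x : x - P x = E `]g + e, +oo[%classic x.
Proof.
rewrite /P -(E_compl hdot hE) // setCitvl; apply: E_drop => //; try exact: measurable_itv.
- by move=> t /=; rewrite !in_itv /= !andbT; have := e0; lra.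
- by move=> t [] /=; rewrite !in_itv /= !andbT => h1 /negP; rewrite -leNgt => h2; have e1 := e0; apply/andP; split; lra.
Qed.

Let signP x : P x = x -> 0 <= ip x (D x).
Proof.
move=> xP; have /hBC : range (E `]-oo, g]%classic) x by exists x.
by rewrite lecE => /andP[_]; rewrite /D ipBr subr_ge0.
Qed.

(** The second angle is the first one for [- S] and [- T], which exchanges lower
    and upper spectral subspaces. *)
Let separated : exists p, [/\ orthogonal_projection dot p, reduces p S,
  forall x, dom S x -> p x = 0 -> 0 <= ip x (S x),
  forall x, p x = x -> nm (x - P x) <= c * nm x &
  forall x, p x = 0 -> nm (P x) <= c * nm x].
Proof.
have [q [oq redq posq negq]] := gap_splitting hdot sS d0 gapS.
have [lq idq _] := oq.
have fin (y X : R) : (d + e) * X <= b * y -> X <= c * y.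
  by move=> h; rewrite /c mulrAC ler_pdivlMr // mulrC.
exists (fun x => x - q x); split.
- exact: proj_complement.
- exact: (reduces_complement (sa_lin sS)).
- move=> x dx /eqP; rewrite subr_eq0 => /eqP/esym qx.
  by apply: le_trans (posq x dx qx); rewrite mulr_ge0 ?sqr_ge0 // ltW.
- move=> x px; rewrite P_pos; apply: fin; move: x px.
  have mJ : measurable (`]g + e, +oo[%classic : set R) by exact: measurable_itv.
  apply: (angle_bound hdot hE sS sT erefl erefl TE b0 bD d0 (proj_complement oq)
    (reduces_complement (sa_lin sS) redq) gapS _ redE mJ e0).
  + move=> x dx px; apply: negq => //.
    by rewrite -px (proj_compl0 _ oq).
  + move=> x dx xJ; rewrite TTB ipBr ipZr -(nm2 hdot) lerBrDr -mulrDl addrC.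
    apply: (E_ge hdot hE (J := `]g + e, +oo[%classic)) => // t /=.
    by rewrite in_itv /= andbT => /ltW.
  + move=> m; exists (m - g) => x dx xJ.
    rewrite TTB ipBr ipZr -(nm2 hdot) lerBlDr -mulrDl subrK.
    apply: (E_le hdot hE (J := `]g + e, +oo[%classic `&` `[- m, m]%classic)) => //.
      by apply: measurableI; exact: measurable_itv.
    by move=> t [_ /=]; rewrite in_itv /= => /andP[].
- move=> x /eqP; rewrite subr_eq0 => /eqP/esym qx.
  rewrite P_neg; apply: fin; move: x qx.
  have lS := sa_lin sS.
  have mJ : measurable (`]-oo, g - e[%classic : set R) by exact: measurable_itv.
  have TE' x : dom (op_opp S) x -> op_opp T x = op_opp S x + - D x.
    by move=> dx; rewrite -[op_opp T x]/(- T x) (TE dx) opprD.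
  have bD' x : nm (- D x) <= b * nm x by rewrite nmN; exact: bD.
  apply: (angle_bound hdot hE (op_opp_sa sS) (op_opp_sa sT) erefl erefl TE' b0 bD' d0 oq
    (reduces_opp lq redq) _ _ _ mJ e0).
  + by move=> x dx; rewrite /= nmN; exact: gapS.
  + by move=> x dx qx; rewrite /= ipNr lerN2; exact: posq.
  + by move=> K mK; apply: reduces_opp (E_lin hE mK) (redE mK).
  + move=> x dx xJ; rewrite -[op_opp T x]/(- T x) ipNr TTB ipBr ipZr -(nm2 hdot).
    have : ip x (TB x) <= (g - e) * nm x ^+ 2.
      apply: (E_le hdot hE (J := `]-oo, g - e[%classic)) => // t /=.
      by rewrite in_itv /= => /ltW.
    lra.
  + move=> m; exists (m + g) => x dx xJ.
    rewrite -[op_opp T x]/(- T x) ipNr TTB ipBr ipZr -(nm2 hdot).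
    have : (- m) * nm x ^+ 2 <= ip x (TB x).
      apply: (E_ge hdot hE (J := `]-oo, g - e[%classic `&` `[- m, m]%classic)) => //.
        by apply: measurableI; exact: measurable_itv.
      by move=> t [_ /=]; rewrite in_itv /= => /andP[].
    lra.
Qed.

Let negT (l : R) u : l <= g -> dom T u -> P u = u -> E `[l, g]%classic u = 0 -> u != 0 ->
  ip u (T u) < (l - g) * nm u ^+ 2.
Proof.
move=> lg du Pu Gu u0.
have uJ : E `]-oo, l[%classic u = u.
  have mG : measurable (`[l, g]%classic : set R) by exact: measurable_itv.
  have mL : measurable (`]-oo, l[%classic : set R) by exact: measurable_itv.
  rewrite -[RHS]Pu /P.
  have -> : `]-oo, g]%classic = `[l, g]%classic `|` `]-oo, l[%classic :> set R.
    apply/seteqP; split => t /=; rewrite !in_itv /=.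
      by move=> tg; have [lt|lt] := leP l t; [left; rewrite tg|right].
    by case=> [/andP[]//|]; lra.
  by rewrite (E_setU hdot hE) // (E_compl hdot hE) // Gu subr0 add0r.
rewrite TTB ipBr ipZr -(nm2 hdot) mulrBl ltrD2r.
exact: (E_lt hdot hE du uJ u0).
Qed.

(** [spectral_count] at the level [l - g], undoing the shift by [g]. *)
Lemma count_bound : exists p, [/\ orthogonal_projection dot p, reduces p SC,
  forall x, dom SC x -> p x = 0 -> g * nm x ^+ 2 <= ip x (SC x) &
  forall (l : R) k (eb : 'I_k -> H), l <= g ->
    (forall x, in_span eb (E `[l, g]%classic x)) ->
    forall m (w : 'I_m -> H), free_family w ->
      (forall a : 'I_m -> R[i], let y := \sum_(i < m) a i *: w i in
        [/\ dom SC y, p y = y & l * nm y ^+ 2 <= ip y (SC y)]) -> (m <= k)%N].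
Proof.
have [p [op redp posp ang ang']] := separated.
have [lp _ _] := op.
exists p; split => //.
- move=> x dx; have [dpx Ex] := redp x dx; split => //.
  by move: Ex; rewrite !SE (linB lp) (linZ lp) => /addIr.
- by move=> x dx px; have := posp x dx px; rewrite SE ipBr ipZr -(nm2 hdot) subr_ge0.
move=> l k eb lg hspan m w fw hw.
have mG : measurable (`[l, g]%classic : set R) by exact: measurable_itv.
apply: (spectral_count hdot sS sT lD erefl TE b0 bD op redp (E_proj hE mP) (redE mP)
  c0 c1 ang ang' signP posp (E_lin hE mG) hspan (l := l - g) _ _ fw).
- by rewrite subr_le0.
- by move=> u du Pu Gu u0; exact: negT.
move=> a y; have [dy py hy] := hw a; split => //.
by rewrite SE ipBr ipZr -(nm2 hdot) mulrBl lerD2r.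
Qed.

Let decomposition (l : R) : (lambda_infty TB g < l%:E)%E -> l <= g ->
  eigen_decomposed TB E (fun q => l <= q < g /\ discrete_spectrum TB q%:C) `[l, g]%classic.
Proof.
move=> il lg; apply: (finite_decomposition hdot sTB hE lg) => q /andP[lq].
rewrite le_eqVlt => /orP[/eqP ->|qg].
  by left; apply: resB; have e1 := e0; apply/andP; split; lra.
have [res|nres] := pselect (resolvent_set TB q%:C); [by left|right].
split => //; apply: contrapT => nd.
have : (q%:E <= lambda_infty TB g)%E.
  by apply: ereal_sup_ubound; exists q.
move=> /le_lt_trans/(_ il); rewrite lte_fin; lra.
Qed.

(** A point of the essential spectrum of [A + C] above that of [A + B] would be
    in a region where the spectral projection of [A + B] has finite rank. *)
Lemma lambda_infty_le : (lambda_infty SC g <= lambda_infty TB g)%E.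
Proof.
have [p [op redp posp count]] := count_bound.
apply: ge_ereal_sup => _ [l [lg ess] <-]; rewrite leNgt; apply/negP => lt.
have [mu imu mul] : exists2 mu : R, (lambda_infty TB g < mu%:E)%E & mu < l.
  move: lt; case: (lambda_infty TB g) => [r|//|_].
    by rewrite lte_fin => rl; exists ((r + l) / 2); rewrite ?lte_fin; lra.
  by exists (l - 1); rewrite ?ltNyr // ltrBlDr ltrDl.
have mug : mu <= g by rewrite ltW // (lt_trans mul).
have [s [hs hz]] := decomposition imu mug.
have [q|k [eb heb]] := finite_span (s := s) (V := fun q => eigen_space TB q%:C).
  by move=> /hs[_ [_ _]].
have spn x : in_span eb (E `[mu, g]%classic x).
  have [zs [hzs ->]] := hz x; rewrite big_seq; apply: lin_subspace_sum.
    exact: in_span_sub.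
  by move=> z /hzs[q qs zq]; exact: heb qs zq.
case: ess => spec; apply.
exact: (below_discrete hdot sSC op redp posp (count mu k eb mug spn) mul lg spec).
Qed.

(** If [lamB k < lamC k = l], the spectral subspace of [A + B] for [l, g] is
    spanned by [k] vectors, whereas [A + C] has [k + 1] independent eigenvectors
    with eigenvalues in [l, g[. *)
Lemma enumeration_le (lamB lamC : nat -> \bar R) :
  eigenvalue_enumeration TB g lamB -> eigenvalue_enumeration SC g lamC ->
  forall k, (lamC k <= lamB k)%E.
Proof.
move=> hB hC k; rewrite leNgt; apply/negP => lt.
have Bk := enumeration_ge hB k.
have [_ vals _] := hC; have [Ck|[l [il lg _ Ck]]] := vals k.
  by move: lt; rewrite Ck ltNge (le_trans lambda_infty_le Bk).
rewrite Ck in lt; have ilB := le_lt_trans Bk lt.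
have [s [hs hz]] := decomposition ilB (ltW lg).
have [eb heb] := enumeration_span hB lt.
have spn x : in_span eb (E `[l, g]%classic x).
  have [zs [hzs ->]] := hz x; rewrite big_seq; apply: lin_subspace_sum.
    exact: in_span_sub.
  by move=> z /hzs[q /hs[qlg _] zq]; exact: heb qlg zq.
have [p [op redp posp count]] := count_bound.
have [w [t [dw Ew lt' fw]]] := enumeration_free hC hdot sSC Ck il.
suff : (k.+1 <= k)%N by rewrite ltnn.
exact: (eigen_count hdot sSC op redp posp (count l k eb (ltW lg) spn) dw Ew lt' fw).
Qed.

End Comparison.

Theorem corollary3p10 (R : realType) (H : completeNormedModType R[i])
    (dot : {dot H for Num.conj}) (hdot : hilbert_dot dot)
    (hdim : forall n : nat, ~ has_dim [set: H] n)
    (A : unbounded_op H) (hA : self_adjoint dot A)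
    (B C : {linear H -> H})
    (bB : bounded_op B) (sB : symmetric_op dot B)
    (bC : bounded_op C) (sC : symmetric_op dot C)
    (gamma : R) (hgamma : resolvent_set (perturb A C) gamma%:C)
    (E : set R -> H -> H) (hE : spectral_measure dot (perturb A B) E)
    (hBC : forall x, range (E `]-oo, gamma]%classic) x -> dot x (C x) <= dot x (B x))
    (hcase :
      (op_norm (B \- C)%R <
         (2^-1)%:E * dist_set gamma%:C (spectrum (perturb A C)))%E \/
      ((forall x, 0 <= dot x (B x - C x)) /\
       (op_norm (B \- C)%R <
         dist_set gamma%:C (spectrum (perturb A C)))%E)) :
  (lambda_infty (perturb A C) gamma <= lambda_infty (perturb A B) gamma)%E /\
  forall lamB lamC : nat -> \bar R,
    eigenvalue_enumeration (perturb A B) gamma lamB ->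
    eigenvalue_enumeration (perturb A C) gamma lamC ->
    forall k : nat, (lamC k <= lamB k)%E.
Proof.
have dist0 : (0 <= dist_set gamma%:C (spectrum (perturb A C)))%E.
  by apply: le_ereal_inf_tmp => _ [w _ <-]; rewrite lee_fin Re_norm_ge0.
have lt : (op_norm (B \- C)%R < dist_set gamma%:C (spectrum (perturb A C)))%E.
  case: hcase => [h|[_ //]]; apply: lt_le_trans h _.
  by rewrite -[leRHS]mul1e; apply: lee_wpmul2r => //; rewrite lee_fin; lra.
have lD : linear (B \- C)%R.
  by move=> a x y; rewrite /= (linearP B) (linearP C) opprD addrACA scalerBr.
have [b [d [b0 bd bD dC]]] := separation_constants lD lt.
split; first exact: (lambda_infty_le hdot hA sB sC hgamma hE hBC b0 bd bD dC).
move=> lamB lamC hB hC.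
exact: (enumeration_le hdot hA sB sC hgamma hE hBC b0 bd bD dC hB hC).
Qed.
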